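(* Consider the interface problem for the linear KdV equation described in the context, in one of the cases ($\sigma_1>0,\sigma_2<0$), ($\sigma_1>0,\sigma_2>0$), ($\sigma_1<0,\sigma_2>0$), with respectively two, three or four interface conditions, and assume that a solution exists. Assume that the matrix $\mathcal{A}$ of the linear system $\mathcal{A}X=Y+e^{ik^3T}\mathcal{Y}$ is full rank. Then a solution of the interface problem is given, for $0<t<T$, by $$q^{(1)}(x,t)=\frac{1}{2\pi}\int_{-\infty}^\infty e^{ikx-i\sigma_1^3k^3t}\hat{q}^{(1)}_0(k)\,dk+\frac{1}{2\pi}\int_{\Gamma^{(1)}} e^{i\frac{k}{\sigma_1}x-ik^3t} \left(\sigma_1^2g_2(ik^3,T)+ik\sigma_1g_1(ik^3,T)-k^2g_0(ik^3,T)\right)dk,\quad x<0,$$ $$q^{(2)}(x,t)=\frac{1}{2\pi}\int_{-\infty}^\infty e^{ikx-i\sigma_2^3k^3t}\hat{q}^{(2)}_0(k)\,dk-\frac{1}{2\pi}\int_{\Gamma^{(2)}} e^{i\frac{k}{\sigma_2}x-ik^3t}\left(\sigma_2^2h_2(ik^3,T)+ik \sigma_2 h_1(ik^3,T)-k^2h_0(ik^3,T)\right)dk,\quad x>0,$$ where $g_j(ik^3,T)$ and $h_j(ik^3,T)$, $j=0,1,2$, are taken to be the components of the solution $X=(g_0,g_1,g_2,h_0,h_1,h_2)^\top$ of the linear system $\mathcal{A}X=Y$ (i.e. with the unknown term $e^{ik^3T}\mathcal{Y}$ dropped).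
   Context: Interface problem: $q^{(1)}_t=\sigma_1^3 q^{(1)}_{xxx}$ for $x<0$, $0<t\le T$, and $q^{(2)}_t=\sigma_2^3 q^{(2)}_{xxx}$ for $x>0$, $0<t\le T$, where $\sigma_1,\sigma_2$ are nonzero real constants, with initial conditions $q^{(j)}(x,0)=q^{(j)}_0(x)$ and $N$ interface conditions $$\sum_{n=0}^2\left(\beta_{j,n+1}\,\partial_x^nq^{(1)}(0,t)+\beta_{j,n+4}\,\partial_x^nq^{(2)}(0,t)\right)=f_j(t),\quad j=1,\dots,N,$$ with constants $\beta_{j,\ell}$ and given functions $f_j$. It is assumed that $q^{(1)}(\cdot,t),q_0^{(1)}\in S(-\infty,0)$ and $q^{(2)}(\cdot,t),q_0^{(2)}\in S(0,\infty)$, where $S(I)$ is the space of restrictions to $I$ of Schwartz functions, and that the initial data are compatible with the interface conditions. Standing assumption: the interface conditions are not such that the problem reduces to a pair of half-line boundary value problems (i.e. such that the problem for $q^{(1)}$ or for $q^{(2)}$ can be solved as a half-line boundary value problem without knowing the other function, the result then being used to solve the other). The forms of the interface conditions: if $\sigma_1>0,\sigma_2<0$, then $N=2$ with general $\beta_{j,\ell}$; if $\sigma_1,\sigma_2>0$, then $N=3$ and the $3\times3$ block $(\beta_{j,\ell})_{1\le j\le3,\,4\le\ell\le6}$ is the identity; if $\sigma_1<0,\sigma_2>0$, then $N=4$, the block $(\beta_{j,\ell})_{1\le j,\ell\le3}$ is the identity and $\beta_{41}=\beta_{42}=\beta_{43}=0$. Notation: $\alpha=e^{2\pi i/3}$;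 $D=\{k\in\mathbb{C}:\operatorname{Re}(ik^3)<0\}=D^{(1)}\cup D^{(3)}\cup D^{(5)}$ with $D^{(1)}=\{0<\arg k<\pi/3\}$, $D^{(3)}=\{2\pi/3<\arg k<\pi\}$, $D^{(5)}=\{4\pi/3<\arg k<5\pi/3\}$. For $R>0$, $D_R^{(r)}=\{k\in D^{(r)}:|k|>R\}$ and $D_R=D_R^{(1)}\cup D_R^{(3)}\cup D_R^{(5)}$; bars denote closures. $\Gamma^{(j)}$ ($j=1,2$) is the boundary of $\{k\in D_R:(-1)^j\sigma_j\operatorname{Im}k>0\}$, oriented so that $D_R^{(1)}$ and $D_R^{(3)}$ lie to the left, and $D_R^{(5)}$ to the right, of any $\Gamma^{(j)}$ to which they are adjacent. (Thus $\Gamma^{(1)}$ bounds $D_R^{(5)}$ if $\sigma_1>0$ and $D_R^{(1)}\cup D_R^{(3)}$ if $\sigma_1<0$; $\Gamma^{(2)}$ bounds $D_R^{(1)}\cup D_R^{(3)}$ if $\sigma_2>0$ and $D_R^{(5)}$ if $\sigma_2<0$.) Put $$g_n(\omega,T)=\int_0^T e^{\omega s}\partial_x^n q^{(1)}(0,s)\,ds,\quad h_n(\omega,T)=\int_0^T e^{\omega s}\partial_x^n q^{(2)}(0,s)\,ds\quad(n=0,1,2),$$ $$\tilde f_j(\omega,T)=\int_0^T e^{\omega s}f_j(s)\,ds,$$ $\hat q^{(1)}(k,T)=\int_{-\infty}^0e^{-ikx}q^{(1)}(x,T)\,dx$ and $\hat q^{(1)}_0(k)=\int_{-\infty}^0e^{-ikx}q^{(1)}_0(x)\,dx$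 for $\operatorname{Im}k\ge0$, and $\hat q^{(2)}(k,T)=\int_0^{\infty}e^{-ikx}q^{(2)}(x,T)\,dx$ and $\hat q^{(2)}_0(k)=\int_0^{\infty}e^{-ikx}q^{(2)}_0(x)\,dx$ for $\operatorname{Im}k\le0$. The linear system: for a cube root of unity $\gamma$, let (G1$_\gamma$) and (G2$_\gamma$) denote the global relations $$\sigma_1^3g_2+i\gamma k\sigma_1^2g_1-\gamma^2k^2\sigma_1g_0=-\hat q^{(1)}_0(\gamma k/\sigma_1)+e^{ik^3T}\hat q^{(1)}(\gamma k/\sigma_1,T),\qquad(\mathrm{G1}_\gamma)$$ $$-\sigma_2^3h_2-i\gamma k\sigma_2^2h_1+\gamma^2k^2\sigma_2h_0=-\hat q^{(2)}_0(\gamma k/\sigma_2)+e^{ik^3T}\hat q^{(2)}(\gamma k/\sigma_2,T),\qquad(\mathrm{G2}_\gamma)$$ with $g_n,h_n$ evaluated at $(ik^3,T)$. The $6\times6$ system $\mathcal{A}X=Y+e^{ik^3T}\mathcal{Y}$ for $X=(g_0,g_1,g_2,h_0,h_1,h_2)^\top$, for $k\in\overline{D}_R^{(r)}$, consists of the $N$ transformed interface conditions $\sum_{n=0}^2(\beta_{j,n+1}g_n+\beta_{j,n+4}h_n)=\tilde f_j(ik^3,T)$ together with: - if $\sigma_1>0,\sigma_2<0$ ($r=5$): (G1$_\gamma$) and (G2$_\gamma$) for $\gamma=\alpha,\alpha^2$; - if $\sigma_1>0,\sigma_2>0$ ($r=1,3,5$): (G1$_\gamma$) for $\gamma=\alpha^r,\alpha^{r+2}$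 and (G2$_\gamma$) for $\gamma=\alpha^{r+1}$; - if $\sigma_1<0,\sigma_2>0$ ($r=1,3$): (G1$_\gamma$) and (G2$_\gamma$) for $\gamma=\alpha^{r+1}$. Here $\mathcal{A}=\mathcal{A}(k)$ is the coefficient matrix, $Y$ collects the explicitly known terms ($-\hat q_0^{(j)}$ and $\tilde f_j$), and $\mathcal{Y}$ collects the terms $\hat q^{(j)}(\cdot,T)$. ''Full rank'' means that $\det\mathcal{A}$, a polynomial in $k$, is not identically zero; $R>0$ is then chosen large enough that $\det\mathcal{A}$ has no zeros in $\overline{D}_R^{(r)}$ for the relevant $r$.
   Formalization: Γ^(j) has the opposite orientation when σ_j<0, since the stated one gives the wrong sign; integrals are limits as ε→0+ of those with factor e^{-ε|k|}; solutions are assumed continuous in t in the Schwartz seminorms (at t=0 only for at most two x-derivatives). *)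

(* Defs.v *)
(* Limits, derivatives and integrals of R[i]-valued functions are taken on real
   and imaginary parts. *)
From HB Require Import structures.
From mathcomp Require Import all_boot all_order all_algebra.
From mathcomp Require Import complex.
From mathcomp Require Import all_classical all_reals all_analysis.
Set Implicit Arguments.
Unset Strict Implicit.
Unset Printing Implicit Defensive.
Import Order.TTheory GRing.Theory Num.Theory.
Import numFieldNormedType.Exports.
Local Open Scope classical_set_scope.
Local Open Scope ring_scope.

Notation Re := complex.Re.
Notation Im := complex.Im.
Notation normc := ComplexField.Normc.normc.
Notation ii := ('i%C).
Notation "x %:C" := (x%:C%C) : ring_scope.

Section Calculus.
Context {R : realType}.
Implicit Types (u : R -> R[i]) (D : set R).

Definition cexp (z : R[i]) : R[i] :=
  (expR (Re z))%:C * (cos (Im z) +i* sin (Im z))%C.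

Definition ccvg {S : Type} (f : S -> R[i]) (F : set_system S) (l : R[i]) :=
  ((fun s => Re (f s)) @ F --> Re l) /\ ((fun s => Im (f s)) @ F --> Im l).

Definition clim u (F : set_system R) : R[i] :=
  (lim ((fun s => Re (u s)) @ F) +i* lim ((fun s => Im (u s)) @ F))%C.

Definition cderiv (n : nat) u (x : R) : R[i] :=
  (derive1n n (fun y => Re (u y)) x +i* derive1n n (fun y => Im (u y)) x)%C.

Definition cintegrable D u :=
  (@lebesgue_measure R).-integrable D (EFin \o (fun s => Re (u s))) /\
  (@lebesgue_measure R).-integrable D (EFin \o (fun s => Im (u s))).

Definition cintegral D u : R[i] :=
  (Rintegral (@lebesgue_measure R) D (fun s => Re (u s)) +i*
   Rintegral (@lebesgue_measure R) D (fun s => Im (u s)))%C.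

Definition schwartzR (v : R -> R) :=
  (forall n x, derivable (derive1n n v) x 1) /\
  (forall m n, exists M, forall x, `|x ^+ m * derive1n n v x| <= M).

Definition schwartz u :=
  schwartzR (fun x => Re (u x)) /\ schwartzR (fun x => Im (u x)).

(* membership in S(D); the values of u outside D are irrelevant *)
Definition schwartz_on D u :=
  exists2 phi, schwartz phi & forall x, D x -> u x = phi x.

End Calculus.

(* Lft carries the index 1 (x < 0) and Rgt the index 2 (x > 0). *)
Variant side := Lft | Rgt.

Definition pick_side (T : Type) (s : side) (a b : T) : T :=
  if s is Lft then a else b.

Section Contours.
Context {R : realType}.
Implicit Types (rho eps : R) (F : R[i] -> R[i]) (r : nat).

Definition polar (s theta : R) : R[i] := s%:C * cexp (ii * theta%:C).

Definition sector_lo r : R := r.-1%:R * pi / 3.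
Definition sector_hi r : R := r%:R * pi / 3.

(* D_rho^(r), for r = 1, 3, 5; the regular algebra R[i]^o only serves to give
   R[i] its usual topology, so that closure applies. *)
Definition Dsec rho r : set (R[i])^o :=
  [set k | exists s theta : R, [/\ rho < s,
     sector_lo r < theta < sector_hi r & k = polar s theta]].

(* an oriented piece of contour: parameter set, position and velocity *)
Record curve := Curve { dom : set R; pos : R -> R[i]; vel : R -> R[i] }.

Definition opp_curve (c : curve) := Curve (dom c) (pos c) (fun s => - vel c s).

Definition ray rho theta : curve :=
  Curve `[rho, +oo[ (polar^~ theta) (fun=> cexp (ii * theta%:C)).

Definition arc rho a b : curve :=
  Curve `[a, b] (polar rho) (fun theta => ii * polar rho theta).

Definition real_line : seq curve := [:: Curve setT (fun s => s%:C) (fun=> 1)].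

(* boundary of D_rho^(r), with D_rho^(r) on its left *)
Definition sector_boundary rho r : seq curve :=
  [:: opp_curve (ray rho (sector_hi r));
      opp_curve (arc rho (sector_lo r) (sector_hi r));
      ray rho (sector_lo r)].

(* the sectors that make up {k in D_rho : (-1)^j sigma_j Im k > 0} *)
Definition sectors_of (s : side) (sigma : R) : seq nat :=
  if pick_side s (0 < sigma) (sigma < 0) then [:: 5] else [:: 1; 3].

(* Gamma^(j).  The orientation is the one inherited from the real axis,
   traversed from -oo to +oo, under the substitution k -> sigma_j k that
   produces the contour.  It puts the adjacent sectors to the right of
   Gamma^(1) and to the left of Gamma^(2), whatever the signs of the sigma_j.
   When sigma_j > 0 this is the orientation that leaves D^(1), D^(3) on the
   left and D^(5) on the right; when sigma_j < 0 it is the opposite one, since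
   the substitution then reverses the real axis. *)
Definition Gamma (s : side) (sigma rho : R) : seq curve :=
  flatten [seq (if s is Lft then map opp_curve (sector_boundary rho r)
                else sector_boundary rho r) | r <- sectors_of s sigma].

Definition curve_integrable (G : seq curve) F :=
  forall i, (i < size G)%N ->
    let c := nth (Curve set0 (fun=> 0) (fun=> 0)) G i in
    cintegrable (dom c) (fun s => F (pos c s) * vel c s).

Definition curve_integral (G : seq curve) F : R[i] :=
  \sum_(c <- G) cintegral (dom c) (fun s => F (pos c s) * vel c s).

(* The integrands met below are not absolutely integrable along the real axis:
   they oscillate there, with an amplitude bounded by some power of |k|.  The
   integral is therefore the oscillatory (Abel) one,
     int_G F dk = lim_(eps -> 0+) int_G e^(- eps |k|) F dk,
   which coincides with the absolutely convergent or improper integral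
   whenever the latter exists. *)
Definition is_curve_integral (G : seq curve) F (I : R[i]) :=
  let damped eps := fun k => (expR (- eps * normc k))%:C * F k in
  (forall eps, 0 < eps -> curve_integrable G (damped eps)) /\
  ccvg (fun eps => curve_integral G (damped eps)) (0^'+) I.

End Contours.

Section Problem.
Context {R : realType}.
Implicit Types (u : R -> R[i]) (q : R -> R -> R[i]) (k : R[i]) (sigma T : R).

Definition halfline (s : side) : set R :=
  if s is Lft then `]-oo, 0[ else `]0, +oo[.

(* n-th derivative at the interface, as a one-sided limit *)
Definition trace (s : side) (n : nat) u : R[i] :=
  clim (cderiv n u) (if s is Lft then 0^'- else 0^'+).

Definition fourier (s : side) u k : R[i] :=
  cintegral (halfline s) (fun x => cexp (- (ii * k * x%:C)) * u x).

(* q = q x t solves q_t = sigma^3 q_xxx on one side of the interface, as a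
   curve in S(halfline s): it is continuous in t for all the seminorms of that
   space when t > 0, and at t = 0 for those that involve only the derivatives
   present in the interface conditions.  At t = T the time derivative is the
   one from the left. *)
Record half_solution (s : side) sigma T (q0 : R -> R[i]) q : Prop := {
  hs_data : schwartz_on (halfline s) q0 ;
  hs_schwartz : forall t, 0 <= t <= T -> schwartz_on (halfline s) (q^~ t) ;
  hs_continuous : forall t0 (m n : nat), 0 <= t0 <= T ->
    0 < t0 \/ (n <= 2)%N -> forall e, 0 < e ->
    \forall t \near within `[0, T] (nbhs t0), forall x, halfline s x ->
      normc (x%:C ^+ m * (cderiv n (q^~ t) x - cderiv n (q^~ t0) x)) <= e ;
  hs_initial : forall x, halfline s x -> q x 0 = q0 x ;
  hs_pde : forall x t, halfline s x -> 0 < t <= T ->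
    ccvg (fun t' => (t' - t)^-1%:C * (q x t' - q x t)) (within `[0, T] (t^'))
         (sigma%:C ^+ 3 * cderiv 3 (q^~ t) x) }.

(* sigma1 > 0 > sigma2, sigma1, sigma2 > 0 and sigma1 < 0 < sigma2 *)
Variant sign_case := PosNeg | PosPos | NegPos.

Definition signs (c : sign_case) (sigma1 sigma2 : R) : bool :=
  match c with
  | PosNeg => (0 < sigma1) && (sigma2 < 0)
  | PosPos => (0 < sigma1) && (0 < sigma2)
  | NegPos => (sigma1 < 0) && (0 < sigma2)
  end.

Definition nconds (c : sign_case) : nat :=
  match c with PosNeg => 2 | PosPos => 3 | NegPos => 4 end.

(* Columns 0, 1, 2 of beta (lsubmx) multiply the traces of q1, columns 3, 4, 5
   (rsubmx) those of q2.  For NegPos, pid_mx 3 is the 4 x 3 matrix made of the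
   identity and a zero last row. *)
Definition normal_form (c : sign_case) (beta : 'M[R[i]]_(nconds c, 3 + 3)) :=
  match c with
  | PosNeg => True
  | PosPos => rsubmx beta = pid_mx 3
  | NegPos => lsubmx beta = pid_mx 3
  end.

Definition interface_form m (beta : 'M[R[i]]_(m, 3 + 3)) (j : 'I_m) u1 u2 :=
  \sum_(n < 3) (beta j (lshift 3 n) * trace Lft n u1 +
                beta j (rshift 3 n) * trace Rgt n u2).

(* The rank of kermx (rsubmx beta) *m lsubmx beta is the number of independent
   conditions on q1 alone that follow from the interface conditions.  The
   problem for q1 is a half-line boundary value problem when this number
   reaches the number of boundary conditions that such a problem requires: one
   if sigma1 > 0, two if sigma1 < 0 (and conversely for q2). *)
Definition half_line_reducible m (sigma1 sigma2 : R)
    (beta : 'M[R[i]]_(m, 3 + 3)) : bool :=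
  ((if (0 < sigma1)%R then 1 else 2) <=
     \rank (kermx (rsubmx beta) *m lsubmx beta))%N ||
  ((if (0 < sigma2)%R then 2 else 1) <=
     \rank (kermx (lsubmx beta) *m rsubmx beta))%N.

Record interface_solution m sigma1 sigma2 T (beta : 'M[R[i]]_(m, 3 + 3))
    (f : 'I_m -> R -> R[i]) (q01 q02 : R -> R[i]) q1 q2 : Prop := {
  is_left : half_solution Lft sigma1 T q01 q1 ;
  is_right : half_solution Rgt sigma2 T q02 q2 ;
  is_compatible : forall j, interface_form beta j q01 q02 = f j 0 ;
  is_interface : forall j t, 0 < t <= T ->
    interface_form beta j (q1^~ t) (q2^~ t) = f j t }.

Definition alpha : R[i] := cexp (ii * (2 * pi / 3)%:C).

(* the sectors in which the linear system is considered *)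
Definition sectors (c : sign_case) : seq nat :=
  match c with
  | PosNeg => [:: 5] | PosPos => [:: 1; 3; 5] | NegPos => [:: 1; 3]
  end.

(* (Lft, p) stands for (G1_gamma) and (Rgt, p) for (G2_gamma), with
   gamma = alpha ^ p *)
Definition relations (c : sign_case) (r : nat) : seq (side * nat) :=
  match c with
  | PosNeg => [:: (Lft, 1); (Lft, 2); (Rgt, 1); (Rgt, 2)]
  | PosPos => [:: (Lft, r); (Lft, r + 2); (Rgt, r + 1)]
  | NegPos => [:: (Lft, r + 1); (Rgt, r + 1)]
  end%N.

Definition relation_of (c : sign_case) (r i : nat) : side * nat :=
  nth (Lft, 0) (relations c r) i.

Definition relation_row (s : side) (sigma : R) (gamma k : R[i]) :
    'rV[R[i]]_(3 + 3) :=
  let w := \row_(n < 3) ((ii * gamma * k) ^+ (2 - n) * sigma%:C ^+ n.+1) in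
  if s is Lft then row_mx w 0 else row_mx 0 (- w).

Lemma nconds_relations (c : sign_case) : (nconds c + (6 - nconds c) = 3 + 3)%N.
Proof. by case: c. Qed.

Definition system_matrix (c : sign_case) (sigma1 sigma2 : R)
    (beta : 'M[R[i]]_(nconds c, 3 + 3)) (r : nat) k : 'M[R[i]]_(3 + 3) :=
  castmx (nconds_relations c, erefl)
    (col_mx beta (\matrix_(i < 6 - nconds c)
       let: (s, p) := relation_of c r i in
       relation_row s (pick_side s sigma1 sigma2) (alpha ^+ p) k)).

(* the known part Y of the right-hand side; X = (g_0, g_1, g_2, h_0, h_1, h_2) *)
Definition system_rhs (c : sign_case) (sigma1 sigma2 T : R)
    (f : 'I_(nconds c) -> R -> R[i]) (q01 q02 : R -> R[i]) (r : nat) k :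
    'cV[R[i]]_(3 + 3) :=
  castmx (nconds_relations c, erefl)
    (col_mx
      (\col_j cintegral `[0, T] (fun s => cexp (ii * k ^+ 3 * s%:C) * f j s))
      (\col_(i < 6 - nconds c)
         let: (s, p) := relation_of c r i in
         - fourier s (pick_side s q01 q02)
             (alpha ^+ p * k / (pick_side s sigma1 sigma2)%:C))).

Definition gpart (X : 'cV[R[i]]_(3 + 3)) (n : nat) := X (lshift 3 (inord n)) 0.
Definition hpart (X : 'cV[R[i]]_(3 + 3)) (n : nat) := X (rshift 3 (inord n)) 0.

End Problem.

(* Main.v *)
From Pilot Require (* Last, so that Re and Im are the projections of R[i] again. *)
Import Defs.

(** Both half lines are brought to [y > 0] by [x = dir s * y], which turns
    [sigma] into [kappa = dir s * sigma]; the solution is then described by a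
    family [w n t y] of derivatives that is defined on the whole line
    ([half_data]).

    Write [V t k] for the Fourier transform of [w 0 t] over [y > 0].  Abel
    damping turns the inverse transform into a Poisson integral, hence the
    inversion formula [half_fourier_inversion]; integrating the equation by
    parts in [y] and then in [t] gives the [global_relation], which expresses
    [V t] by [V 0] and the boundary values up to time [t].  On the real axis the
    inversion integrand is therefore the difference of the integrand of the
    initial data and of a boundary term in which, after [k -> k / kappa], the
    time appears as [exp (i k^3 (s - t))] with [0 <= s <= t].

    This boundary term is entire, and in the sectors of even index where
    [Im (k / kappa) > 0] the cubic exponential is bounded while
    [exp (i k y / kappa)] decays.  Cauchy's theorem and a Jordan type argument
    ([sector_abel]) move the real axis to the boundary of the remaining sectors,
    those of [D] ([deform_pos], [deform_neg], [half_representation]).  One point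
    needs care: the two pieces of the inversion integrand must converge
    separately.  If [kappa < 0] the boundary term does, for its contour turns
    into the even sectors on both sides; if [kappa > 0] the initial data
    integral does, because its cubic exponential decays just below the real axis
    ([lower_cubic_decay]).  The other piece follows by subtraction.

    In [D] the cubic exponential decays for [s > t], so the part [t < s <= T] of
    the boundary term has zero integral over the contour and the time transforms
    may be taken over [0, T] ([half_formula]).  These true transforms solve the
    linear system with the final time terms kept.  Cramer's rule writes their
    difference with the solution of the truncated system as a sum of products of
    a polynomial, of the inverse of the determinant, of [exp (i k^3 (T - t))]
    and of transforms at the final time, evaluated at points
    [alpha^p k / kappa] of the lower half plane.  Everything is bounded or of
    polynomial growth in the sectors of [D], thanks to [poly_lower_bound] for
    the determinant, and [exp (i k x / sigma)] decays, so that Cauchy's theorem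
    makes the contribution of the difference vanish ([side_error]).

    The analysis is elementary throughout: all functions integrated along
    contours are superpositions [superp] of elementary functions, for which
    Cauchy's theorem in polar coordinates is an instance of Fubini's theorem. *)
From HB Require Import structures.
From mathcomp Require Import all_boot all_order all_algebra.
From mathcomp Require Import complex.
From mathcomp Require Import all_classical all_reals all_analysis.
From mathcomp Require Import measurable_realfun.
From mathcomp Require Import ring lra.
Set Implicit Arguments.
Unset Strict Implicit.
Unset Printing Implicit Defensive.
Import Order.TTheory GRing.Theory Num.Theory.
Import numFieldNormedType.Exports.
Local Open Scope classical_set_scope.
Local Open Scope ring_scope.
Import Defs.

(** * Complex numbers by real and imaginary parts *)

Section ComplexNumbers.
Context {R : realType}.
Implicit Types (x y z : R[i]) (a b : R).

Lemma ReD x y : Re (x + y) = Re x + Re y. Proof. by case: x y => [? ?] [? ?]. Qed.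
Lemma ImD x y : Im (x + y) = Im x + Im y. Proof. by case: x y => [? ?] [? ?]. Qed.
Lemma ReN x : Re (- x) = - Re x. Proof. by case: x. Qed.
Lemma ImN x : Im (- x) = - Im x. Proof. by case: x. Qed.
Lemma ReB x y : Re (x - y) = Re x - Re y. Proof. by rewrite ReD ReN. Qed.
Lemma ImB x y : Im (x - y) = Im x - Im y. Proof. by rewrite ImD ImN. Qed.
Lemma ReM x y : Re (x * y) = Re x * Re y - Im x * Im y.
Proof. by case: x y => [? ?] [? ?]. Qed.
Lemma ImM x y : Im (x * y) = Re x * Im y + Im x * Re y.
Proof. by case: x y => [? ?] [? ?]. Qed.
Lemma ReC a : Re a%:C = a. Proof. by []. Qed.
Lemma ImC a : Im a%:C = 0 :> R. Proof. by []. Qed.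
Lemma ReI : Re (ii : R[i]) = 0 :> R. Proof. by []. Qed.
Lemma ImI : Im (ii : R[i]) = 1. Proof. by []. Qed.
Lemma Re0 : Re (0 : R[i]) = 0 :> R. Proof. by []. Qed.
Lemma Im0 : Im (0 : R[i]) = 0 :> R. Proof. by []. Qed.
Lemma Re1 : Re (1 : R[i]) = 1. Proof. by []. Qed.
Lemma Im1 : Im (1 : R[i]) = 0 :> R. Proof. by []. Qed.

Lemma complex_ext x y : Re x = Re y -> Im x = Im y -> x = y.
Proof. by case: x y => [? ?] [? ?] /= -> ->. Qed.

Definition reimE := (ReD, ImD, ReN, ImN, ReM, ImM, ReI, ImI, Re0,
  Im0, Re1, Im1, ReC, ImC).

Lemma realCD a b : (a + b)%:C = a%:C + b%:C :> R[i].
Proof. by apply: complex_ext; rewrite !reimE ?addr0. Qed.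
Lemma realCB a b : (a - b)%:C = a%:C - b%:C :> R[i].
Proof. by apply: complex_ext; rewrite !reimE ?subr0. Qed.
Lemma realCN a : (- a)%:C = - a%:C :> R[i].
Proof. by apply: complex_ext; rewrite !reimE ?oppr0. Qed.
Lemma realCM a b : (a * b)%:C = a%:C * b%:C :> R[i].
Proof. by apply: complex_ext; rewrite !reimE /=; ring. Qed.
Lemma realC0 : 0%:C = 0 :> R[i]. Proof. by []. Qed.
Lemma realC1 : 1%:C = 1 :> R[i]. Proof. by []. Qed.
Lemma realCV a : (a^-1)%:C = (a%:C)^-1 :> R[i].
Proof. exact: fmorphV. Qed.
Lemma realCX a n : (a ^+ n)%:C = a%:C ^+ n :> R[i].
Proof. exact: rmorphXn. Qed.
Lemma iiK : ii * ii = -1 :> R[i].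
Proof. by apply: complex_ext; rewrite !reimE /=; ring. Qed.

Lemma normc_ge0 x : 0 <= normc x.
Proof. by case: x => a b /=; exact: sqrtr_ge0. Qed.
Lemma normcC a : normc a%:C = `|a|.
Proof. by rewrite /= expr0n /= addr0 sqrtr_sqr. Qed.
Lemma normcI : normc (ii : R[i]) = 1.
Proof. by rewrite /= expr0n /= add0r expr1n sqrtr1. Qed.
Lemma normc_sqr x : normc x ^+ 2 = Re x ^+ 2 + Im x ^+ 2.
Proof. by case: x => a b /=; rewrite sqr_sqrtr // addr_ge0 ?sqr_ge0. Qed.
Lemma Re_le_normc x : `|Re x| <= normc x.
Proof.
by rewrite -(ler_pXn2r (n:=2)) ?nnegrE ?normc_ge0// normc_sqr real_normK
  ?num_real// lerDl sqr_ge0.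
Qed.
Lemma Im_le_normc x : `|Im x| <= normc x.
Proof.
by rewrite -(ler_pXn2r (n:=2)) ?nnegrE ?normc_ge0// normc_sqr real_normK
  ?num_real// lerDr sqr_ge0.
Qed.
Lemma normc_le_ReIm x : normc x <= `|Re x| + `|Im x|.
Proof.
rewrite -(ler_pXn2r (n:=2)) ?nnegrE ?addr_ge0 ?normc_ge0//.
rewrite normc_sqr sqrrD !real_normK ?num_real//.
by rewrite -addrA lerD2l lerDr mulrn_wge0 // mulr_ge0.
Qed.
Lemma normcM x y : normc (x * y) = normc x * normc y.
Proof. exact: ComplexField.Normc.normcM. Qed.
Lemma normcD x y : normc (x + y) <= normc x + normc y.
Proof. exact: le_normcD. Qed.
Lemma normcNE x : normc (- x) = normc x.
Proof. exact: normcN. Qed.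
Lemma normcB x y : normc (x - y) <= normc x + normc y.
Proof. by rewrite -(normcNE y) normcD. Qed.
Lemma normcVE x : normc x^-1 = (normc x)^-1.
Proof. exact: ComplexField.Normc.normcV. Qed.
Lemma normc0E : normc (0 : R[i]) = 0.
Proof. exact: ComplexField.Normc.normc0. Qed.
Lemma normc1E : normc (1 : R[i]) = 1.
Proof. exact: ComplexField.Normc.normc1. Qed.
Lemma normcX x n : normc (x ^+ n) = normc x ^+ n.
Proof. by elim: n => [|n ih]; rewrite ?expr0 ?normc1E // !exprS normcM ih. Qed.
Lemma normc_eq0 x : (normc x == 0) = (x == 0).
Proof.
by apply/eqP/eqP => [|->]; [exact: ComplexField.Normc.eq0_normc|exact: normc0E].
Qed.
Lemma normc_norm x : `|x| = (normc x)%:C.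
Proof. by case: x => a b; rewrite normc_def. Qed.
Lemma Re_ge0_normc x : Re x <= normc x.
Proof. by rewrite (le_trans (ler_norm _)) // Re_le_normc. Qed.

Lemma cexpD x y : cexp (x + y) = cexp x * cexp y.
Proof.
by apply: complex_ext; rewrite /cexp !reimE /= expRD cosD sinD; ring.
Qed.
Lemma cexp0 : cexp (0 : R[i]) = 1.
Proof. by apply: complex_ext; rewrite /cexp !reimE /= expR0 cos0 sin0; ring. Qed.
Lemma cexpC a : cexp a%:C = (expR a)%:C.
Proof. by apply: complex_ext; rewrite /cexp !reimE /= cos0 sin0; ring. Qed.
Lemma normc_cexp x : normc (cexp x) = expR (Re x).
Proof.
rewrite /cexp normcM normcC ger0_norm ?expR_ge0 //=.
by rewrite cos2Dsin2 sqrtr1 mulr1.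
Qed.
Lemma cexpM_nat x n : cexp (x *+ n) = cexp x ^+ n.
Proof.
elim: n => [|n ih]; first by rewrite mulr0n cexp0 expr0.
by rewrite mulrS cexpD ih exprS.
Qed.
End ComplexNumbers.

(** * Calculus of complex functions of a real variable *)

Definition cder {R : realType} (u : R -> R[i]) (x : R) (d : R[i]) :=
  is_derive x (1 : R) (fun s => Re (u s)) (Re d) /\
  is_derive x (1 : R) (fun s => Im (u s)) (Im d).

Section ComplexDerivatives.
Context {R : realType}.
Implicit Types (u v : R -> R[i]) (x : R) (d e : R[i]).

Lemma is_derive_ext (f g : R -> R) x (d d' : R) :
  f =1 g -> d = d' -> is_derive x (1 : R) f d -> is_derive x (1 : R) g d'.
Proof. by move=> /funext -> ->. Qed.

Lemma cder_ext u v x d e : u =1 v -> d = e -> cder u x d -> cder v x e.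
Proof. by move=> /funext -> ->. Qed.

Lemma cder_cst x d : cder (fun=> d) x 0.
Proof. by split; exact: is_derive_cst. Qed.

Lemma cder_real (f : R -> R) x (a : R) :
  is_derive x (1 : R) f a -> cder (fun s => (f s)%:C) x a%:C.
Proof. by move=> h; split => //=; exact: is_derive_cst. Qed.

Lemma cder_id x : cder (fun s => s%:C) x 1.
Proof. by apply: cder_real; exact: is_derive_id. Qed.

Lemma cderD u v x d e : cder u x d -> cder v x e ->
  cder (fun s => u s + v s) x (d + e).
Proof.
move=> [u1 u2] [v1 v2]; split.
  apply: is_derive_ext (is_deriveD u1 v1) => [s|]; first by rewrite ReD.
  by rewrite ReD.
apply: is_derive_ext (is_deriveD u2 v2) => [s|]; first by rewrite ImD.
by rewrite ImD.
Qed.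

Lemma cderM u v x d e : cder u x d -> cder v x e ->
  cder (fun s => u s * v s) x (d * v x + u x * e).
Proof.
move=> [u1 u2] [v1 v2]; split.
  apply: is_derive_ext (is_deriveB (is_deriveM u1 v1) (is_deriveM u2 v2)) => [s|].
    by rewrite ReM.
  by rewrite !reimE /GRing.scale /=; ring.
apply: is_derive_ext (is_deriveD (is_deriveM u1 v2) (is_deriveM u2 v1)) => [s|].
  by rewrite ImM.
by rewrite !reimE /GRing.scale /=; ring.
Qed.

Lemma cderZ c u x d : cder u x d -> cder (fun s => c * u s) x (c * d).
Proof.
move=> h; apply: cder_ext (cderM (cder_cst x c) h) => //.
by rewrite mul0r add0r.
Qed.

Lemma cderN u x d : cder u x d -> cder (fun s => - u s) x (- d).
Proof.
move=> h; apply: cder_ext (cderZ (-1) h) => [s|]; by rewrite mulN1r.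
Qed.

Lemma cder_cexp u x d : cder u x d -> cder (fun s => cexp (u s)) x (cexp (u x) * d).
Proof.
move=> [u1 u2].
have hE := is_derive1_comp (is_derive_expR (Re (u x))) u1.
have hC := is_derive1_comp (is_derive_cos (Im (u x))) u2.
have hS := is_derive1_comp (is_derive_sin (Im (u x))) u2.
split.
  apply: is_derive_ext (is_deriveM hE hC) => [s|].
    by rewrite /cexp !reimE /=; rewrite mul0r subr0.
  by rewrite /cexp !reimE /GRing.scale /=; ring.
apply: is_derive_ext (is_deriveM hE hS) => [s|].
  by rewrite /cexp !reimE /=; rewrite mul0r addr0.
by rewrite /cexp !reimE /GRing.scale /=; ring.
Qed.

Lemma invcE (z : R[i]) : z^-1 = ((normc z ^+ 2)^-1)%:C * (Re z +i* (- Im z))%C.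
Proof.
have [->|z0] := eqVneq z 0.
  by rewrite invr0; apply: complex_ext; rewrite !reimE /=; ring.
apply: (mulfI z0); rewrite divff //.
have n0 : normc z ^+ 2 != 0 by rewrite expf_neq0 // normc_eq0.
by apply: complex_ext; rewrite !reimE /= normc_sqr in n0 *; field.
Qed.

Lemma cderV u x d : u x != 0 -> cder u x d ->
  cder (fun s => (u s)^-1) x (- (u x)^-1 ^+ 2 * d).
Proof.
move=> ux0 [u1 u2].
pose N s := Re (u s) ^+ 2 + Im (u s) ^+ 2.
have N0 : N x != 0 by rewrite /N -normc_sqr expf_neq0 // normc_eq0.
have hN := is_deriveD (is_deriveM u1 u1) (is_deriveM u2 u2).
have hN' : is_derive x (1 : R) N (2 * (Re (u x) * Re d + Im (u x) * Im d)).
  by apply: is_derive_ext hN => [s|]; rewrite ?/N /GRing.scale /=;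
    [rewrite !expr2|ring].
have hV := is_deriveV N0 hN'.
split.
  apply: is_derive_ext (is_deriveM u1 hV) => [s|].
    by rewrite invcE normc_sqr !reimE /=; rewrite mul0r subr0 mulrC.
  rewrite invcE normc_sqr -/(N x) !reimE /GRing.scale /=.
  rewrite /N in N0 *; field; exact: N0.
apply: is_derive_ext (is_deriveN (is_deriveM u2 hV)) => [s|].
  by rewrite invcE normc_sqr !reimE /=; rewrite mul0r addr0 mulrN mulrC.
rewrite invcE normc_sqr -/(N x) !reimE /GRing.scale /=.
by rewrite /N in N0 *; field; exact: N0.
Qed.

Lemma cder_comp_real u (g : R -> R) x (b : R) d :
  cder u (g x) d -> is_derive x (1 : R) g b -> cder (u \o g) x (b%:C * d).
Proof.
move=> [u1 u2] hg; split.
  apply: is_derive_ext (is_derive1_comp u1 hg) => // ; rewrite !reimE; ring.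
apply: is_derive_ext (is_derive1_comp u2 hg) => // ; rewrite !reimE; ring.
Qed.

End ComplexDerivatives.

(** * Measurability and integration *)

Definition cmeas {R : realType} d (T : measurableType d) (D : set T)
    (u : T -> R[i]) :=
  measurable_fun D (fun x => Re (u x)) /\ measurable_fun D (fun x => Im (u x)).

Lemma measurable_invr {R : realType} :
  measurable_fun setT (GRing.inv : R -> R).
Proof.
have -> : [set: R] = [set~ 0] `|` [set 0] by rewrite setUC setUv.
apply/measurable_funU => //; first exact: measurableC.
split.
  apply: open_continuous_measurable_fun.
    rewrite openC; apply: accessible_closed_set1; apply: hausdorff_accessible.
    exact: Rhausdorff.
  by move=> x /set_mem /= /eqP x0; apply: inv_continuous.
by apply: measurable_fun_set1.
Qed.

Definition extend0 {R : realType} T (D : set T) (u : T -> R[i]) :=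
  fun x => if x \in D then u x else 0.

Section ComplexMeasurability.
Context {R : realType} d (T : measurableType d).
Implicit Types (D : set T) (u v : T -> R[i]).

Lemma cmeas_ext D u v : u =1 v -> cmeas D u -> cmeas D v.
Proof. by move=> /funext ->. Qed.

Lemma cmeas_cst D (c : R[i]) : cmeas D (fun=> c).
Proof. by split; exact: measurable_cst. Qed.

Lemma cmeas_real D (f : T -> R) : measurable_fun D f -> cmeas D (fun x => (f x)%:C).
Proof. by move=> h; split => //=; exact: measurable_cst. Qed.

Lemma cmeasD D u v : cmeas D u -> cmeas D v -> cmeas D (fun x => u x + v x).
Proof.
move=> [a b] [a' b']; split.
  rewrite (_ : (fun x => _) = (fun x => Re (u x)) \+ (fun x => Re (v x))).
    exact: measurable_funD.
  by apply/funext => x /=; rewrite ReD.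
rewrite (_ : (fun x => _) = (fun x => Im (u x)) \+ (fun x => Im (v x))).
  exact: measurable_funD.
by apply/funext => x /=; rewrite ImD.
Qed.

Lemma cmeasM D u v : cmeas D u -> cmeas D v -> cmeas D (fun x => u x * v x).
Proof.
move=> [a b] [a' b']; split.
  rewrite (_ : (fun x => _) = ((fun x => Re (u x)) \* (fun x => Re (v x))) \-
     ((fun x => Im (u x)) \* (fun x => Im (v x)))).
    by apply: measurable_funB; apply: measurable_funM.
  by apply/funext => x /=; rewrite ReM.
rewrite (_ : (fun x => _) = ((fun x => Re (u x)) \* (fun x => Im (v x))) \+
     ((fun x => Im (u x)) \* (fun x => Re (v x)))).
  by apply: measurable_funD; apply: measurable_funM.
by apply/funext => x /=; rewrite ImM.
Qed.

Lemma cmeasZ D c u : cmeas D u -> cmeas D (fun x => c * u x).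
Proof. by move=> h; apply: cmeasM => //; exact: cmeas_cst. Qed.

Lemma cmeasN D u : cmeas D u -> cmeas D (fun x => - u x).
Proof. by move=> h; apply: cmeas_ext (cmeasZ (-1) h) => x; rewrite mulN1r. Qed.

Lemma cmeasB D u v : cmeas D u -> cmeas D v -> cmeas D (fun x => u x - v x).
Proof. by move=> h1 h2; exact: (cmeasD h1 (cmeasN h2)). Qed.

Lemma cmeas_cexp D u : cmeas D u -> cmeas D (fun x => cexp (u x)).
Proof.
move=> [a b].
have e : measurable_fun D (fun x => expR (Re (u x))).
  exact: (measurableT_comp (@measurable_expR R) a).
have c : measurable_fun D (fun x => cos (Im (u x))).
  apply: (measurableT_comp _ b); apply: continuous_measurable_fun.
  exact: continuous_cos.
have s : measurable_fun D (fun x => sin (Im (u x))).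
  apply: (measurableT_comp _ b); apply: continuous_measurable_fun.
  exact: continuous_sin.
by apply: cmeasM; [exact: cmeas_real|split].
Qed.

Lemma cmeasV D u : cmeas D u -> cmeas D (fun x => (u x)^-1).
Proof.
move=> [a b].
have n2 : measurable_fun D (fun x => (Re (u x) ^+ 2 + Im (u x) ^+ 2)^-1).
  apply: (measurableT_comp measurable_invr).
  by apply: measurable_funD; exact: measurable_funX.
apply: (@cmeas_ext D (fun x => ((Re (u x) ^+ 2 + Im (u x) ^+ 2)^-1)%:C *
   (Re (u x) +i* (- Im (u x)))%C)).
  by move=> x; rewrite invcE normc_sqr.
by apply: cmeasM; [exact: cmeas_real|split => //=; exact: measurableT_comp].
Qed.

Lemma cmeas_normc D u : cmeas D u -> measurable_fun D (fun x => normc (u x)).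
Proof.
move=> [a b].
rewrite (_ : (fun x => _) = (fun x => Num.sqrt (Re (u x) ^+ 2 + Im (u x) ^+ 2))).
  apply: (measurableT_comp (continuous_measurable_fun (@sqrt_continuous R))).
  by apply: measurable_funD; exact: measurable_funX.
by apply/funext => x; case: (u x).
Qed.

Lemma cmeasS (E D : set T) u : measurable E -> D `<=` E -> cmeas E u -> cmeas D u.
Proof. by move=> mE DE [a b]; split; exact: (measurable_funS mE DE). Qed.

Lemma cmeas_restrict D u : measurable D -> cmeas D u ->
  cmeas setT (extend0 D u).
Proof.
move=> mD [a b]; split.
  rewrite (_ : (fun x => _) = (fun x => Re (u x)) \_ D).
    exact/(measurable_restrictT _ mD).
  by apply/funext => x; rewrite /extend0 !patchE; case: ifP.
rewrite (_ : (fun x => _) = (fun x => Im (u x)) \_ D).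
  exact/(measurable_restrictT _ mD).
by apply/funext => x; rewrite /extend0 !patchE; case: ifP.
Qed.

End ComplexMeasurability.

Lemma cmeas_comp {R : realType} d d' (T : measurableType d)
    (T' : measurableType d') (u : T -> R[i]) (f : T' -> T) :
  cmeas setT u -> measurable_fun setT f -> cmeas setT (u \o f).
Proof. by move=> [a b] mf; split; [exact: (measurableT_comp a)|exact: (measurableT_comp b)]. Qed.

(* Lebesgue measure lives on the alias measurableTypeR R of R. *)
Notation cmeasR := (@cmeas _ _ (measurableTypeR _)).
Notation measurableR := (@measurable _ (measurableTypeR _)).

Section ComplexIntegral.
Context {R : realType}.
Local Notation mu := (@lebesgue_measure R).
Implicit Types (D : set R) (u v : R -> R[i]) (g : R -> R).

Lemma cintegrable_cmeas D u : cintegrable D u -> cmeasR D u.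
Proof.
by move=> [/integrableP[a _] /integrableP[b _]]; split; exact/measurable_EFinP.
Qed.

Lemma cintegrable_dom D u g : measurableR D -> cmeasR D u ->
  mu.-integrable D (EFin \o g) -> (forall x, D x -> normc (u x) <= g x) ->
  cintegrable D u.
Proof.
move=> mD [mr mi] ig h; split.
  apply: (le_integrable mD _ _ ig); first exact/measurable_EFinP.
  move=> x Dx /=; rewrite lee_fin (le_trans (Re_le_normc _))//.
  by rewrite (le_trans (h x Dx)) // ler_norm.
apply: (le_integrable mD _ _ ig); first exact/measurable_EFinP.
move=> x Dx /=; rewrite lee_fin (le_trans (Im_le_normc _))//.
by rewrite (le_trans (h x Dx)) // ler_norm.
Qed.

Lemma cintegrable_normc D u : measurableR D -> cintegrable D u ->
  mu.-integrable D (EFin \o (fun x => normc (u x))).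
Proof.
move=> mD iu; have [mr mi] := cintegrable_cmeas iu; case: iu => ir ii'.
have := integrableD mD (integrable_norm ir) (integrable_norm ii').
apply: le_integrable => //.
  by apply/measurable_EFinP; apply: cmeas_normc; split.
move=> x Dx /=; rewrite lee_fin ger0_norm ?normc_ge0//.
by rewrite ger0_norm ?addr_ge0// normc_le_ReIm.
Qed.

Lemma cintegral_eq D u v : (forall x, D x -> u x = v x) ->
  cintegral D u = cintegral D v.
Proof.
move=> h; rewrite /cintegral.
congr (_ +i* _)%C; apply: eq_Rintegral => x /set_mem Dx; by rewrite h.
Qed.

Lemma cintegrable_eq D u v : measurableR D -> (forall x, D x -> u x = v x) ->
  cintegrable D u -> cintegrable D v.
Proof.
move=> mD h [a b]; split.
  by apply: eq_integrable a => // x /set_mem Dx /=; rewrite h.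
by apply: eq_integrable b => // x /set_mem Dx /=; rewrite h.
Qed.

Lemma cintegrableD D u v : measurableR D -> cintegrable D u -> cintegrable D v ->
  cintegrable D (fun x => u x + v x).
Proof.
move=> mD [a b] [a' b']; split.
  have := integrableD mD a a'; apply: eq_integrable => // x _ /=.
  by rewrite ReD.
have := integrableD mD b b'; apply: eq_integrable => // x _ /=.
by rewrite ImD.
Qed.

Lemma cintegralD D u v : measurableR D -> cintegrable D u -> cintegrable D v ->
  cintegral D (fun x => u x + v x) = cintegral D u + cintegral D v.
Proof.
move=> mD [a b] [a' b']; rewrite /cintegral; apply: complex_ext => /=.
  by rewrite -RintegralD //; apply: eq_Rintegral => x _; rewrite ReD.
by rewrite -RintegralD //; apply: eq_Rintegral => x _; rewrite ImD.
Qed.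

Lemma cintegrableZ D c u : measurableR D -> cintegrable D u ->
  cintegrable D (fun x => c * u x).
Proof.
move=> mD iu; apply: (@cintegrable_dom _ _ (fun x => normc c * normc (u x))) => //.
- by apply: cmeasZ; exact: cintegrable_cmeas.
- have := integrableZl mD (normc c) (cintegrable_normc mD iu).
  by apply: eq_integrable => // x _ /=.
- by move=> x _; rewrite normcM.
Qed.

Lemma cintegralZ D c u : measurableR D -> cintegrable D u ->
  cintegral D (fun x => c * u x) = c * cintegral D u.
Proof.
move=> mD [a b]; rewrite /cintegral.
have zint (r : R) (f : R -> R) : mu.-integrable D (EFin \o f) ->
    mu.-integrable D (EFin \o (fun x => r * f x)).
  move=> hf; have := integrableZl mD r hf.
  by apply: eq_integrable => // x _ /=.
apply: complex_ext; rewrite !reimE /=.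
  rewrite -!RintegralZl // -RintegralB; [|by []|exact: zint|exact: zint].
  by apply: eq_Rintegral => x _; rewrite ReM.
rewrite -!RintegralZl // -RintegralD; [|by []|exact: zint|exact: zint].
by apply: eq_Rintegral => x _; rewrite ImM.
Qed.

Lemma cintegrableN D u : measurableR D -> cintegrable D u ->
  cintegrable D (fun x => - u x).
Proof.
move=> mD h; apply: (cintegrable_eq mD _ (cintegrableZ (-1) mD h)) => x _.
by rewrite mulN1r.
Qed.

Lemma cintegralN D u : measurableR D -> cintegrable D u ->
  cintegral D (fun x => - u x) = - cintegral D u.
Proof.
move=> mD h; rewrite -mulN1r -cintegralZ //; apply: cintegral_eq => x _.
by rewrite mulN1r.
Qed.

Lemma cintegrableB D u v : measurableR D -> cintegrable D u -> cintegrable D v ->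
  cintegrable D (fun x => u x - v x).
Proof. by move=> mD h1 h2; exact: cintegrableD (cintegrableN mD h2). Qed.

Lemma cintegralB D u v : measurableR D -> cintegrable D u -> cintegrable D v ->
  cintegral D (fun x => u x - v x) = cintegral D u - cintegral D v.
Proof.
by move=> mD h1 h2; rewrite cintegralD ?cintegralN//; exact: cintegrableN.
Qed.

Lemma cintegrable_sum (I : eqType) (r : seq I) D (F : I -> R -> R[i]) :
  measurableR D -> (forall i, i \in r -> cintegrable D (F i)) ->
  cintegrable D (fun x => \sum_(i <- r) F i x) /\
  cintegral D (fun x => \sum_(i <- r) F i x) = \sum_(i <- r) cintegral D (F i).
Proof.
move=> mD; elim: r => [|i r ih] h.
  split.
    apply: (@cintegrable_eq _ (fun=> 0)) => // [x _|]; first by rewrite big_nil.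
    by split; apply: eq_integrable (integrable0 _ _) => // x _ /=.
  rewrite big_nil; transitivity (cintegral D (fun=> 0)).
    by apply: cintegral_eq => x _; rewrite big_nil.
  by rewrite /cintegral /= /Rintegral integral0.
have [i1 i2] := ih (fun j jr => h j (mem_behead (s := i :: r) jr)).
have hi := h i (mem_head _ _).
split.
  apply: (cintegrable_eq mD _ (cintegrableD mD hi i1)) => x _.
  by rewrite big_cons.
rewrite big_cons -i2 -cintegralD //; apply: cintegral_eq => x _.
by rewrite big_cons.
Qed.

(** The two real parts are bounded separately, whence the factor 2. *)
Lemma normc_cintegral_le D u g : measurableR D -> cmeasR D u ->
  mu.-integrable D (EFin \o g) -> (forall x, D x -> normc (u x) <= g x) ->
  normc (cintegral D u) <= 2 * Rintegral mu D g.
Proof.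
move=> mD mu' ig h; have [a b] := cintegrable_dom mD mu' ig h.
rewrite (le_trans (normc_le_ReIm _)) // mulr2n mulrDl mul1r /=.
have aux (f : R -> R) : mu.-integrable D (EFin \o f) ->
    (forall x, D x -> `|f x| <= normc (u x)) ->
    `|Rintegral mu D f| <= Rintegral mu D g.
  move=> hf hfu; rewrite (le_trans (le_normr_Rintegral mD hf)) //.
  apply: le_Rintegral => //; first exact: (integrable_norm hf).
  by move=> x Dx; rewrite (le_trans (hfu x Dx)) // h.
by apply: lerD; apply: aux => // x _; [exact: Re_le_normc|exact: Im_le_normc].
Qed.

Lemma cintegrableS (E D : set R) u : measurableR E -> measurableR D -> D `<=` E ->
  cintegrable E u -> cintegrable D u.
Proof. by move=> mE mD DE [a b]; split; apply: (integrableS mE mD DE). Qed.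

Lemma cintegral_setU (A B : set R) u : measurableR A -> measurableR B ->
  cintegrable (A `|` B) u -> [disjoint A & B] ->
  cintegral (A `|` B) u = cintegral A u + cintegral B u.
Proof.
by move=> mA mB [a b] AB; rewrite /cintegral !Rintegral_setU.
Qed.

Lemma cintegral_mkcond D u : cintegral D u = cintegral setT (extend0 D u).
Proof.
rewrite /cintegral Rintegral_mkcond [X in (_ +i* X)%C]Rintegral_mkcond.
by congr (_ +i* _)%C; apply: eq_Rintegral => x _; rewrite /extend0 !patchE; case: ifP.
Qed.

Lemma cintegrable_mkcond D u : measurableR D ->
  cintegrable D u -> cintegrable setT (extend0 D u).
Proof.
move=> mD [a b]; split.
  have := (integrable_restrict mu mD measurableT (EFin \o (fun s => Re (u s)))).1.
  rewrite setTI => /(_ a); apply: eq_integrable => // x _ /=.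
  by rewrite /extend0 !patchE; case: ifP.
have := (integrable_restrict mu mD measurableT (EFin \o (fun s => Im (u s)))).1.
rewrite setTI => /(_ b); apply: eq_integrable => // x _ /=.
by rewrite /extend0 !patchE; case: ifP.
Qed.

Lemma cintegrable_cst_itv a b (c : R) : mu.-integrable `[a, b] (EFin \o (fun=> c)).
Proof.
apply: continuous_compact_integrable; first exact: segment_compact.
by apply: continuous_subspaceT => x; exact: cst_continuous.
Qed.

Lemma normc_cintegral_itv_le a b u (M : R) : a <= b -> cmeasR `[a, b] u ->
  (forall x, a <= x <= b -> normc (u x) <= M) ->
  normc (cintegral `[a, b] u) <= 2 * (M * (b - a)).
Proof.
move=> ab mu' h.
have muE : fine (mu `[a, b]) = b - a.
  rewrite lebesgue_measure_itv /= lte_fin; case: ltP => // ba.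
  by rewrite /= (le_anti (introT andP (conj ab ba))) subrr.
rewrite -muE -Rintegral_cst //; apply: normc_cintegral_le => //.
exact: cintegrable_cst_itv.
Qed.

Lemma cintegrable_itv_bounded a b u (M : R) : cmeasR `[a, b] u ->
  (forall x, a <= x <= b -> normc (u x) <= M) -> cintegrable `[a, b] u.
Proof.
move=> mu' h; apply: (cintegrable_dom (measurable_itv _) mu' (cintegrable_cst_itv a b M)).
by move=> x /=; rewrite in_itv /=; exact: h.
Qed.

End ComplexIntegral.

(** * The fundamental theorem of calculus *)

Definition ccont_on {R : realType} (D : set R) (u : R -> R[i]) :=
  {within D, continuous (fun s => Re (u s))} /\
  {within D, continuous (fun s => Im (u s))}.

Section FundamentalTheorem.
Context {R : realType}.
Local Notation mu := (@lebesgue_measure R).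
Implicit Types (D : set R) (u U : R -> R[i]) (a b : R).

Lemma ccont_on_cmeas D u : measurableR D -> ccont_on D u -> cmeasR D u.
Proof.
by move=> mD [c1 c2]; split; exact: (subspace_continuous_measurable_fun mD).
Qed.

Lemma ccont_onS D E u : D `<=` E -> ccont_on E u -> ccont_on D u.
Proof. by move=> DE [c1 c2]; split; exact: (continuous_subspaceW DE). Qed.

Lemma cderiv_ccont_itv (i : interval R) U :
  (forall x, x \in i -> exists d, cder U x d) -> ccont_on [set` i] U.
Proof.
move=> h; split; apply: derivable_within_continuous => x xi.
  by have [? [[]]] := h x xi.
by have [? [_ []]] := h x xi.
Qed.

Lemma cintegrable_cont a b u : ccont_on `[a, b] u -> cintegrable `[a, b] u.
Proof.
move=> [c1 c2]; split; apply: continuous_compact_integrable => //;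
  exact: segment_compact.
Qed.

Let FTC_real (f F : R -> R) a b : a < b ->
  {within `[a, b], continuous f} -> {within `[a, b], continuous F} ->
  (forall x, a < x < b -> is_derive x (1 : R) F (f x)) ->
  Rintegral mu `[a, b] f = F b - F a.
Proof.
move=> ab cf cF dF; rewrite /Rintegral (@continuous_FTC2 _ f F) //.
  have [_ Fa Fb] := (continuous_within_itvP F ab).1 cF.
  by split => // x; rewrite in_itv /= => /dF[].
by move=> x; rewrite in_itv /= => /dF h; rewrite derive1E (@derive_val _ _ _ _ _ _ _ h).
Qed.

Lemma cFTC a b u U : a <= b -> ccont_on `[a, b] u -> ccont_on `[a, b] U ->
  (forall x, a < x < b -> cder U x (u x)) ->
  cintegral `[a, b] u = U b - U a.
Proof.
rewrite le_eqVlt => /predU1P[-> _ _ _|ab [u1 u2] [U1 U2] h].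
  by rewrite /cintegral set_itv1 !Rintegral_set1 subrr.
have e1 := FTC_real ab u1 U1 (fun x xab => proj1 (h x xab)).
have e2 := FTC_real ab u2 U2 (fun x xab => proj2 (h x xab)).
rewrite /cintegral e1 e2.
by apply: complex_ext; rewrite !reimE.
Qed.

Lemma Rintegral_dominated D (f_ : nat -> R -> R) (f g : R -> R) :
  measurableR D -> (forall n, measurable_fun (D : set (measurableTypeR R)) (f_ n)) ->
  (forall x, D x -> f_ n x @[n --> \oo] --> f x) ->
  mu.-integrable D (EFin \o g) -> (forall n x, D x -> `|f_ n x| <= g x) ->
  Rintegral mu D (f_ n) @[n --> \oo] --> Rintegral mu D f.
Proof.
move=> mD mf_ cf gi fg.
have mf_' n : measurable_fun (D : set (measurableTypeR R)) (EFin \o f_ n).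
  exact/measurable_EFinP.
have cf' (x : measurableTypeR R) : D x ->
    (EFin \o f_ n) x @[n --> \oo] --> (EFin \o f) x.
  by move=> Dx; apply: cvg_EFin; [exact: nearW|exact: cf].
have mf' : measurable_fun (D : set (measurableTypeR R)) (EFin \o f).
  exact: (emeasurable_fun_cvg _ _ mf_' cf').
have [fi _ h] := dominated_convergence mD mf_' mf' (aeW mu cf') gi
  (aeW mu (fun x n (Dx : D x) => fg n x Dx)).
apply: fine_cvg; rewrite fineK //; exact: integrable_fin_num.
Qed.

Let cvg_integral_real (f : R -> R) a : mu.-integrable `[a, +oo[ (EFin \o f) ->
  Rintegral mu `[a, a + n%:R] f @[n --> \oo] --> Rintegral mu `[a, +oo[ f.
Proof.
move=> fi; have /integrableP[mf _] := fi.
pose fn n x := (f \_ `[a, a + n%:R]) x.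
have sub n : `[a, a + n%:R] `<=` `[a, +oo[.
  by move=> x /=; rewrite !in_itv /= => /andP[->].
rewrite (_ : (fun n : nat => _) = (fun n => Rintegral mu `[a, +oo[ (fn n))); last first.
  apply/funext => n; rewrite [LHS]Rintegral_mkcond [RHS]Rintegral_mkcond.
  apply: eq_Rintegral => x _ /=; rewrite /fn !patchE.
  case: ifPn => h1; last by case: ifPn.
  have /mem_set -> // : `[a, +oo[%classic x by apply: (sub n); exact: (set_mem h1).
apply: (@Rintegral_dominated _ _ _ (fun x => `|f x|)) => //.
- move=> n; apply: measurable_funTS.
  apply/(measurable_restrictT _ (measurable_itv _)).
  apply: (measurable_funS (measurable_itv `[a, +oo[) (sub n)).
  exact/measurable_EFinP.
- move=> x ax; apply: cvg_near_cst.
  near=> n; rewrite /fn /= patchE mem_set //= in_itv /=.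
  move: ax; rewrite /= in_itv /= andbT => ->/=.
  rewrite -lerBlDl; near: n.
  exact: nbhs_infty_ger.
- exact: (integrable_norm fi).
- move=> n x ax; rewrite /fn /= patchE.
  by case: ifP => // _; rewrite normr0.
Unshelve. all: by end_near. Qed.

Lemma cintegral_cvg_ray a u : cintegrable `[a, +oo[ u ->
  ccvg (fun n => cintegral `[a, a + n%:R] u) \oo (cintegral `[a, +oo[ u).
Proof. by move=> [h1 h2]; split => /=; exact: cvg_integral_real. Qed.

Lemma ccvg_unique S (F : set_system S) {FF : ProperFilter F} (f : S -> R[i]) l l' :
  ccvg f F l -> ccvg f F l' -> l = l'.
Proof.
move=> [a b] [a' b']; apply: complex_ext.
  exact: (cvg_unique _ a a').
exact: (cvg_unique _ b b').
Qed.

Lemma ccvgD S (F : set_system S) {FF : Filter F} (f g : S -> R[i]) l m :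
  ccvg f F l -> ccvg g F m -> ccvg (fun s => f s + g s) F (l + m).
Proof.
move=> [a b] [a' b']; split.
  rewrite ReD; under eq_fun do rewrite ReD; exact: cvgD.
rewrite ImD; under eq_fun do rewrite ImD; exact: cvgD.
Qed.

Lemma ccvg_cst S (F : set_system S) {FF : Filter F} (l : R[i]) :
  ccvg (fun=> l) F l.
Proof. by split; exact: cvg_cst. Qed.

Lemma ccvgN S (F : set_system S) {FF : Filter F} (f : S -> R[i]) l :
  ccvg f F l -> ccvg (fun s => - f s) F (- l).
Proof.
move=> [a b]; split.
  rewrite ReN; under eq_fun do rewrite ReN; exact: cvgN.
rewrite ImN; under eq_fun do rewrite ImN; exact: cvgN.
Qed.

Lemma ccvgB S (F : set_system S) {FF : Filter F} (f g : S -> R[i]) l m :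
  ccvg f F l -> ccvg g F m -> ccvg (fun s => f s - g s) F (l - m).
Proof. by move=> h1 h2; exact: (ccvgD h1 (ccvgN h2)). Qed.

Lemma ccvgM S (F : set_system S) {FF : Filter F} (f g : S -> R[i]) l m :
  ccvg f F l -> ccvg g F m -> ccvg (fun s => f s * g s) F (l * m).
Proof.
move=> [a b] [a' b']; split.
  by rewrite ReM; under eq_fun do rewrite ReM; apply: cvgB; apply: cvgM.
by rewrite ImM; under eq_fun do rewrite ImM; apply: cvgD; apply: cvgM.
Qed.

Lemma ccvg0 S (F : set_system S) {FF : Filter F} (f : S -> R[i]) (g : S -> R) :
  (forall s, normc (f s) <= g s) -> g @ F --> (0 : R) -> ccvg f F 0.
Proof.
move=> fg g0; split; apply: norm_cvg0 => /=.
  apply: (squeeze_cvgr _ (cvg_cst 0) g0); apply: nearW => s.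
  by rewrite normr_ge0 (le_trans (Re_le_normc _)).
apply: (squeeze_cvgr _ (cvg_cst 0) g0); apply: nearW => s.
by rewrite normr_ge0 (le_trans (Im_le_normc _)).
Qed.

Lemma cFTCy a u U L : cintegrable `[a, +oo[ u -> ccont_on `[a, +oo[ u ->
  ccont_on `[a, +oo[ U -> (forall x, a < x -> cder U x (u x)) ->
  ccvg (fun n => U (a + n%:R)) \oo L ->
  cintegral `[a, +oo[ u = L - U a.
Proof.
move=> ui cu cU dU UL; apply: (ccvg_unique (cintegral_cvg_ray ui)).
have sub n : `[a, a + n%:R] `<=` `[a, +oo[.
  by move=> x /=; rewrite !in_itv /= => /andP[->].
rewrite (_ : (fun n => _) = (fun n => U (a + n%:R) - U a)).
  exact: (ccvgB UL (ccvg_cst _)).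
apply/funext => n; apply: cFTC.
- by rewrite lerDl.
- exact: (ccont_onS (sub n)).
- exact: (ccont_onS (sub n)).
- by move=> x /andP[ax _]; exact: dU.
Qed.

Lemma cintegral_obnd a u : cintegrable `[a, +oo[ u ->
  cintegral `]a, +oo[ u = cintegral `[a, +oo[ u.
Proof.
move=> ui; have [h1 h2] : cintegrable `]a, +oo[ u.
  apply: cintegrableS ui; [exact: measurable_itv|exact: measurable_itv|].
  by move=> x /=; rewrite !in_itv /= !andbT => /ltW.
by rewrite /cintegral !Rintegral_itv_obnd_cbnd.
Qed.

End FundamentalTheorem.

Section ExplicitIntegrals.
Context {R : realType}.
Local Notation mu := (@lebesgue_measure R).

Lemma cvg_expR_decay (c a : R) : 0 < c ->
  expR (- c * (a + n%:R)) @[n --> \oo] --> (0 : R).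
Proof.
move=> c0.
rewrite (_ : (fun n : nat => _) = (fun n : nat => expR (- (c * (a + n%:R))))); last first.
  by apply/funext => n; rewrite mulNr.
have h : c * (a + n%:R) @[n --> \oo] --> +oo.
  apply/cvgryPge => A; near=> n; rewrite -ler_pdivrMl // -lerBlDl; near: n.
  exact: nbhs_infty_ger.
exact: (cvg_comp _ _ h (@cvgr_expR R)).
Unshelve. all: by end_near. Qed.

Lemma integrable_expR_decay (c a : R) : 0 < c ->
  mu.-integrable `[a, +oo[ (EFin \o (fun s => expR (- c * s))).
Proof.
move=> c0.
have cf : continuous (fun s : R => expR (- c * s)).
  move=> s; apply: (@continuous_comp _ _ _ (fun s => - c * s) expR).
    exact: mulrl_continuous.
  exact: continuous_expR.
apply/integrableP; split.
  apply/measurable_EFinP; apply: measurable_funTS.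
  exact: continuous_measurable_fun.
have dF (x : R) : is_derive x (1 : R) (fun s => - c^-1 * expR (- c * s)) (expR (- c * x)).
  have h : is_derive x (1 : R) (fun s => - c * s) (- c).
    by apply: is_derive_ext (is_deriveZ (- c) (is_derive_id x 1)) => //=; rewrite /GRing.scale /= mulr1.
  apply: is_derive_ext (is_deriveZ (- c^-1) (is_derive1_comp (is_derive_expR _) h)) => // .
  by rewrite /GRing.scale /= mulrCA mulrNN mulVf ?mulr1 ?gt_eqF.
under eq_integral do rewrite /= ger0_norm ?expR_ge0//.
rewrite (@ge0_continuous_FTC2y _ _ (fun s => - c^-1 * expR (- c * s)) _ 0).
- by rewrite -EFinB ltry.
- by move=> x _; exact: expR_ge0.
- exact: continuous_subspaceT.
- rewrite -[X in _ --> X](mulr0 (- c^-1)); apply: cvgMr.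
  rewrite (_ : (fun x : R => _) = (fun x : R => expR (- (c * x)))); last first.
    by apply/funext => x; rewrite mulNr.
  have h : c * x @[x --> +oo] --> +oo by apply: gt0_cvgMry.
  exact: (cvg_comp _ _ h (@cvgr_expR R)).
- by move=> x _; case: (dF x).
- have [/derivable1_diffP/differentiable_continuous h _] := dF a.
  exact: cvg_at_right_filter.
- by move=> x _; rewrite derive1E (@derive_val _ _ _ _ _ _ _ (dF x)).
Qed.

Lemma integrable_invDsqr :
  mu.-integrable `[0, +oo[ (EFin \o (fun s : R => (1 + s ^+ 2)^-1)).
Proof.
apply/integrableP; split.
  apply/measurable_EFinP; apply: measurable_funTS.
  by apply: continuous_measurable_fun; exact: continuous_oneDsqrV.
under eq_integral.
  move=> x _; rewrite /= ger0_norm; last by rewrite invr_ge0 addr_ge0 ?sqr_ge0.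
  over.
by rewrite integral0y_oneDsqr ltry.
Qed.

End ExplicitIntegrals.

(** * Fubini's theorem and linear changes of variable *)

Section FubiniScaling.
Context {R : realType}.
Local Notation mu := (@lebesgue_measure R).
Local Notation mR := (measurableTypeR R).
Implicit Types (D : set R) (u : R -> R[i]).

Let fubini_real (f : mR * mR -> R) (g h : R -> R) :
  measurable_fun setT f ->
  mu.-integrable setT (EFin \o g) -> mu.-integrable setT (EFin \o h) ->
  (forall x y, `|f (x, y)| <= g x * h y) ->
  measurable_fun (setT : set mR) (fun x => Rintegral mu setT (fun y => f (x, y))) /\
  Rintegral mu setT (fun x => Rintegral mu setT (fun y => f (x, y))) =
  Rintegral mu setT (fun y => Rintegral mu setT (fun x => f (x, y))).
Proof.
move=> mf ig ih fgh.
have mF : measurable_fun setT (EFin \o f) by exact/measurable_EFinP.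
have i1 x : mu.-integrable setT (EFin \o (fun y => f (x, y))).
  apply: (le_integrable _ _ _ (integrableZl measurableT (g x) ih)) => //.
    apply/measurable_EFinP.
    exact: (measurableT_comp mf (measurable_pair1 x)).
  by move=> y _ /=; rewrite lee_fin (le_trans (fgh x y)) // ler_norm.
have i2 y : mu.-integrable setT (EFin \o (fun x => f (x, y))).
  apply: (le_integrable _ _ _ (integrableZr measurableT (h y) ig)) => //.
    apply/measurable_EFinP.
    exact: (measurableT_comp mf (measurable_pair2 y)).
  by move=> x _ /=; rewrite lee_fin (le_trans (fgh x y)) // ler_norm.
have int2 : (mu \x mu)%E.-integrable setT (EFin \o f).
  apply/(integrable12ltyP mu mu mF).
  have hfin : (\int[mu]_y `|h y|%:E)%E \is a fin_num.
    by apply: integrable_fin_num => //; exact: (integrable_norm ih).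
  pose H := Rintegral mu setT (fun y => `|h y|).
  have iH := integrableZr measurableT H (integrable_norm ig).
  apply: (@le_lt_trans _ _ (\int[mu]_x ((`|g x| * H)%R)%:E)%E); last first.
    rewrite -ge0_fin_numE; first exact: (integrable_fin_num measurableT iH).
    apply: integral_ge0 => x _; rewrite lee_fin mulr_ge0 //.
    exact: Rintegral_ge0.
  apply: ge0_le_integral => //.
  - by move=> x _; exact: integral_ge0.
  - apply: (measurable_fun_fubini_tonelli_F (abse \o (EFin \o f))) => //.
      exact: measurableT_comp.
    by move=> z; exact: abse_ge0.
  - exact: (measurable_int _ iH).
  - move=> x _.
    have iHx := integrableZl measurableT `|g x| (integrable_norm ih).
    have -> : (`|g x| * H)%:E = (\int[mu]_y ((`|g x| * `|h y|)%R)%:E)%E.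
      rewrite -[RHS]fineK; last exact: (integrable_fin_num measurableT iHx).
      by rewrite -[H]/(fine _) -RintegralZl //; exact: (integrable_norm ih).
    apply: ge0_le_integral => //.
    + apply: measurableT_comp => //.
      by apply/measurable_EFinP; exact: (measurableT_comp mf (measurable_pair1 x)).
    + exact: (measurable_int _ iHx).
    + move=> y _ /=; rewrite lee_fin (le_trans (fgh x y)) //.
      by rewrite -normrM ler_norm.
have e1 x : (Rintegral mu setT (fun y => f (x, y)))%:E =
    (\int[mu]_y (EFin \o f) (x, y))%E.
  by rewrite fineK //; exact: integrable_fin_num (i1 x).
have e2 y : (Rintegral mu setT (fun x => f (x, y)))%:E =
    (\int[mu]_x (EFin \o f) (x, y))%E.
  by rewrite fineK //; exact: integrable_fin_num (i2 y).
split.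
  apply/measurable_EFinP.
  rewrite (_ : _ \o _ = (fun x => (\int[mu]_y (EFin \o f) (x, y))%E)).
    exact: (measurable_fubini_F int2).
  by apply/funext => x /=; rewrite e1.
rewrite /Rintegral; congr fine.
under eq_integral do rewrite e1.
under [RHS]eq_integral do rewrite e2.
exact: (Fubini int2).
Qed.

Let cFubiniT (K : mR * mR -> R[i]) (g h : R -> R) :
  cmeas setT K ->
  mu.-integrable setT (EFin \o g) -> mu.-integrable setT (EFin \o h) ->
  (forall x y, normc (K (x, y)) <= g x * h y) ->
  cmeasR setT (fun x => cintegral setT (fun y => K (x, y))) /\
  cintegral setT (fun x => cintegral setT (fun y => K (x, y))) =
  cintegral setT (fun y => cintegral setT (fun x => K (x, y))).
Proof.
move=> [m1 m2] ig ih Kgh.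
have [a1 a2] := fubini_real m1 ig ih
  (fun x y => le_trans (Re_le_normc _) (Kgh x y)).
have [b1 b2] := fubini_real m2 ig ih
  (fun x y => le_trans (Im_le_normc _) (Kgh x y)).
split; first by split.
by apply: complex_ext.
Qed.

Lemma cmeas_eq_on d (T : measurableType d) (D : set T) (u v : T -> R[i]) :
  (forall x, D x -> u x = v x) -> cmeas D u -> cmeas D v.
Proof.
move=> uv [a b]; split.
  by apply: eq_measurable_fun a => x /set_mem Dx; rewrite uv.
by apply: eq_measurable_fun b => x /set_mem Dx; rewrite uv.
Qed.

Lemma cmeas_fst (D1 D2 : set mR) u : measurable D1 -> measurable D2 ->
  cmeasR D1 u -> cmeas (D1 `*` D2) (fun z : mR * mR => u z.1).
Proof.
move=> mD1 mD2 mu1.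
apply: (@cmeas_eq_on _ _ _ (fun z => extend0 D1 u z.1)).
  by move=> [x y] [/= Dx _]; rewrite /extend0 mem_set.
apply: (@cmeasS _ _ _ setT) => //.
exact: (cmeas_comp (cmeas_restrict mD1 mu1) measurable_fst).
Qed.

Lemma cmeas_snd (D1 D2 : set mR) u : measurable D1 -> measurable D2 ->
  cmeasR D2 u -> cmeas (D1 `*` D2) (fun z : mR * mR => u z.2).
Proof.
move=> mD1 mD2 mu1.
apply: (@cmeas_eq_on _ _ _ (fun z => extend0 D2 u z.2)).
  by move=> [x y] [/= _ Dy]; rewrite /extend0 mem_set.
apply: (@cmeasS _ _ _ setT) => //.
exact: (cmeas_comp (cmeas_restrict mD2 mu1) measurable_snd).
Qed.

Lemma cFubini (D1 D2 : set mR) (K : mR * mR -> R[i]) (g h : R -> R) :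
  measurable D1 -> measurable D2 -> cmeas (D1 `*` D2) K ->
  mu.-integrable D1 (EFin \o g) -> mu.-integrable D2 (EFin \o h) ->
  (forall x y, D1 x -> D2 y -> normc (K (x, y)) <= g x * h y) ->
  cmeasR D1 (fun x => cintegral D2 (fun y => K (x, y))) /\
  cintegral D1 (fun x => cintegral D2 (fun y => K (x, y))) =
  cintegral D2 (fun y => cintegral D1 (fun x => K (x, y))).
Proof.
move=> mD1 mD2 mK ig ih Kgh.
have res (D : set mR) (f : R -> R) : measurable D -> mu.-integrable D (EFin \o f) ->
    mu.-integrable setT (EFin \o (f \_ D)).
  move=> mD fi; rewrite -restrict_EFin; apply/integrable_restrict => //.
  by rewrite setTI.
have bound x y : normc (extend0 (D1 `*` D2) K (x, y)) <= (g \_ D1) x * (h \_ D2) y.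
  rewrite /extend0 !patchE; case: ifPn => [/set_mem[/= d1 d2]|].
    by rewrite !mem_set // Kgh.
  rewrite notin_setE => nd; rewrite normc0E.
  case: ifPn => [/set_mem d1|]; last by rewrite mul0r.
  by case: ifPn => [/set_mem d2|]; [exfalso; exact: nd|rewrite mulr0].
have [c1 c2] := cFubiniT (cmeas_restrict (measurableX mD1 mD2) mK)
  (res _ _ mD1 ig) (res _ _ mD2 ih) bound.
have e1 x : D1 x -> cintegral setT (fun y => extend0 (D1 `*` D2) K (x, y)) =
    cintegral D2 (fun y => K (x, y)).
  move=> Dx; rewrite [RHS]cintegral_mkcond; apply: cintegral_eq => y _.
  rewrite /extend0; case: (pselect (D2 y)) => Dy.
    by rewrite !mem_set.
  by rewrite !memNset // => -[].
split.
  by apply: (cmeas_eq_on e1); apply: cmeasS c1.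
rewrite [LHS]cintegral_mkcond [RHS]cintegral_mkcond.
transitivity (cintegral setT (fun x => cintegral setT
    (fun y => extend0 (D1 `*` D2) K (x, y)))).
  apply: cintegral_eq => x _; rewrite {1}/extend0; case: ifPn => [/set_mem Dx|].
    by rewrite e1.
  rewrite notin_setE => nd.
  rewrite (_ : (fun y => _) = (fun=> 0)); last first.
    by apply/funext => y; rewrite /extend0 memNset // => -[].
  by rewrite /cintegral /= /Rintegral integral0.
rewrite c2; apply: cintegral_eq => y _; rewrite {2}/extend0; case: ifPn => [/set_mem Dy|].
  rewrite [RHS]cintegral_mkcond; apply: cintegral_eq => x _.
  rewrite /extend0; case: (pselect (D1 x)) => Dx.
    by rewrite !mem_set.
  by rewrite !memNset // => -[].
rewrite notin_setE => nd.
rewrite (_ : (fun y => _) = (fun=> 0)); last first.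
  by apply/funext => x; rewrite /extend0 memNset // => -[].
by rewrite /cintegral /= /Rintegral integral0.
Qed.

(** Both sides are measures that agree on half-open intervals. *)
Lemma lebesgue_measure_scale (c : R) (A : set mR) : c != 0 -> measurable A ->
  mu A = (`|c|%:E * mu ((fun x : R => (c * x)%R) @^-1` A))%E.
Proof.
move=> c0 mA.
have mc : measurable_fun setT (fun x : mR => c * x : mR).
  exact: (continuous_measurable_fun (@mulrl_continuous _ c)).
pose nu : {measure set mR -> \bar R} := mscale (NngNum (normr_ge0 c))
  (pushforward mu (fun x : mR => c * x : mR)).
suff h X : ocitv X -> mu X = nu mc X by rewrite (lebesgue_measure_unique h mA).
move=> [[a b]] _ <-; rewrite /nu.
suff : mu `]a, b] = (`|c|%:E * mu ((fun x : R => (c * x)%R) @^-1` `]a, b]))%E by [].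
have [cp|cn|/esym/eqP] := ltgtP 0 c; last by rewrite (negbTE c0).
  have -> : (fun x : R => c * x) @^-1` `]a, b]%classic = `]a / c, b / c]%classic.
    apply/seteqP; split => x /=; rewrite !in_itv /= ltr_pdivrMr // ler_pdivlMr //;
      by rewrite mulrC.
  rewrite !lebesgue_measure_itv /= !lte_fin ltr_pM2r ?invr_gt0 //.
  case: ifPn => _; last by rewrite mule0.
  by rewrite -!EFinB -EFinM gtr0_norm // -mulrBl mulrCA divff // mulr1.
have -> : (fun x : R => c * x) @^-1` `]a, b]%classic = `[b / c, a / c[%classic.
  apply/seteqP; split => x /=; rewrite !in_itv /= ltr_ndivlMr // ler_ndivrMr //;
    by rewrite mulrC andbC.
rewrite !lebesgue_measure_itv /= !lte_fin ltr_nM2r ?invr_lt0 //.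
case: ifPn => _; last by rewrite mule0.
rewrite -!EFinB -EFinM ltr0_norm // -mulrBl mulrCA mulNr divff // mulrN1.
by rewrite opprB.
Qed.

Let scale_ge0 (c : R) (f : R -> \bar R) : c != 0 ->
  measurable_fun (setT : set mR) f -> (forall x, 0 <= f x)%E ->
  (\int[mu]_x f x = `|c|%:E * \int[mu]_x f (c * x)%R)%E.
Proof.
move=> c0 mf f0.
have mc : measurable_fun setT (fun x : mR => c * x : mR).
  exact: (continuous_measurable_fun (@mulrl_continuous _ c)).
pose nu : {measure set mR -> \bar R} := mscale (NngNum (normr_ge0 c))
  (pushforward mu (fun x : mR => c * x : mR)).
rewrite (@eq_measure_integral _ _ _ _ (nu mc)); last first.
  by move=> A mA _; exact: lebesgue_measure_scale.
rewrite /nu ge0_integral_mscale //; congr (_ * _)%E.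
by rewrite ge0_integral_pushforward.
Qed.

Lemma integrable_scale (c : R) (f : R -> R) : c != 0 ->
  mu.-integrable setT (EFin \o f) ->
  mu.-integrable setT (EFin \o (fun x => f (c * x))) /\
  Rintegral mu setT f = `|c| * Rintegral mu setT (fun x => f (c * x)).
Proof.
move=> c0 fi; have /integrableP[mf fin] := fi.
have mc : measurable_fun setT (fun x : mR => c * x : mR).
  exact: (continuous_measurable_fun (@mulrl_continuous _ c)).
have mfc : measurable_fun setT (EFin \o (fun x : mR => f (c * x))).
  exact: (measurableT_comp mf mc).
have fci : mu.-integrable setT (EFin \o (fun x => f (c * x))).
  apply/integrableP; split => //.
  have := @scale_ge0 c (fun x => `|(f x)%:E|%E) c0
    (measurableT_comp (@abse_measurable _ _) mf) (fun=> abse_ge0 _).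
  move=> h; move: fin; rewrite h => fin.
  rewrite ltey; apply/negP => /eqP e; move: fin.
  by rewrite [X in (_ * X)%E]e gt0_muley ?ltxx // lte_fin normr_gt0.
split => //.
rewrite /Rintegral integralE (scale_ge0 c0 (measurable_funepos mf)) //.
rewrite (scale_ge0 c0 (measurable_funeneg mf)) //.
have p := integrable_pos_fin_num measurableT fci.
have n := integrable_neg_fin_num measurableT fci.
rewrite [in RHS]integralE.
rewrite (_ : (\int[mu]_x _^\+ (c * x)%R)%E =
  (\int[mu]_x ((EFin \o (fun x => f (c * x)%R))^\+)%E x)%E) //.
rewrite (_ : (\int[mu]_x _^\- (c * x)%R)%E =
  (\int[mu]_x ((EFin \o (fun x => f (c * x)%R))^\-)%E x)%E) //.
  by rewrite -(fineK p) -(fineK n) /= mulrBr.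
  by apply: eq_integral => x _; rewrite !funenegE.
by apply: eq_integral => x _; rewrite !funeposE.
Qed.

Lemma cintegral_scale (c : R) u : c != 0 -> cintegrable setT u ->
  cintegrable setT (fun x => u (c * x)) /\
  cintegral setT u = `|c|%:C * cintegral setT (fun x => u (c * x)).
Proof.
move=> c0 [u1 u2]; have [a1 b1] := integrable_scale c0 u1.
have [a2 b2] := integrable_scale c0 u2; split; first by split.
apply: complex_ext.
  by rewrite ReM ReC ImC mul0r subr0; exact: b1.
by rewrite ImM ReC ImC mul0r addr0; exact: b2.
Qed.

End FubiniScaling.

(** * Elementary functions and Cauchy's theorem *)

Section Elementary.
Context {R : realType}.
Variable S : set R[i].
Implicit Types (F G : R[i] -> R[i]) (u : R -> R[i]).

(** The set [S] matters only for inverses, which must stay away from the zeros of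
    their argument there: this makes every member bounded on bounded parts of
    [S] and measurable everywhere. *)
Inductive elem : (R[i] -> R[i]) -> Prop :=
| elem_cst c : elem (fun=> c)
| elem_id : elem (fun k => k)
| elemD F G : elem F -> elem G -> elem (fun k => F k + G k)
| elemM F G : elem F -> elem G -> elem (fun k => F k * G k)
| elem_cexp F : elem F -> elem (fun k => cexp (F k))
| elemV F (c : R) : 0 < c -> (forall k, S k -> c <= normc (F k)) -> elem F ->
    elem (fun k => (F k)^-1).

Lemma elem_ext F G : F =1 G -> elem F -> elem G.
Proof. by move=> /funext ->. Qed.

Lemma elemZ c F : elem F -> elem (fun k => c * F k).
Proof. by move=> h; apply: elemM => //; exact: elem_cst. Qed.

Lemma elemN F : elem F -> elem (fun k => - F k).
Proof. by move=> h; apply: elem_ext (elemZ (-1) h) => k; rewrite mulN1r. Qed.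

Lemma elemB F G : elem F -> elem G -> elem (fun k => F k - G k).
Proof. by move=> h1 h2; exact: (elemD h1 (elemN h2)). Qed.

Lemma elemX F n : elem F -> elem (fun k => F k ^+ n).
Proof.
move=> h; elim: n => [|n ih].
  by apply: elem_ext (elem_cst 1) => k; rewrite expr0.
by apply: elem_ext (elemM h ih) => k; rewrite exprS.
Qed.

Lemma elem_horner (p : {poly R[i]}) : elem (fun k => p.[k]).
Proof.
elim/poly_ind: p => [|p c ih].
  by apply: elem_ext (elem_cst 0) => k; rewrite horner0.
apply: elem_ext (elemD (elemM ih elem_id) (elem_cst c)) => k.
by rewrite hornerMXaddC.
Qed.

Lemma elem_cmeas F d (T : measurableType d) (D : set T) (K : T -> R[i]) :
  elem F -> cmeas D K -> cmeas D (fun z => F (K z)).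
Proof.
move=> + mK; elim=> [c||{}F G _ h1 _ h2|{}F G _ h1 _ h2|{}F _ h|{}F c _ _ _ h].
- exact: cmeas_cst.
- exact: mK.
- exact: cmeasD.
- exact: cmeasM.
- exact: cmeas_cexp.
- exact: cmeasV.
Qed.

Lemma elem_bounded F (L : R) : elem F ->
  exists M, forall k, S k -> normc k <= L -> normc (F k) <= M.
Proof.
elim=> [c||{}F G _ [m1 h1] _ [m2 h2]|{}F G _ [m1 h1] _ [m2 h2]|{}F _ [m h]|{}F c c0 hc _ _].
- by exists (normc c).
- by exists L.
- exists (m1 + m2) => k Sk kL; rewrite (le_trans (normcD _ _)) // lerD //.
    exact: h1.
  exact: h2.
- exists (m1 * m2) => k Sk kL; rewrite normcM ler_pM ?normc_ge0 //.
    exact: h1.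
  exact: h2.
- exists (expR m) => k Sk kL; rewrite normc_cexp ler_expR.
  by rewrite (le_trans (Re_ge0_normc _)) // h.
- exists c^-1 => k Sk kL; rewrite normcVE lef_pV2 ?posrE ?hc //.
  exact: lt_le_trans (hc k Sk).
Qed.

(** The chain rule along curves is all that is used of holomorphy; stated in this
    form it needs no complex differentiation. *)
Lemma elem_deriv F : elem F -> exists F', elem F' /\
  forall u x d, S (u x) -> cder u x d ->
    cder (fun s => F (u s)) x (F' (u x) * d).
Proof.
elim=> [c||{}F G eF [F' [e1 h1]] eG [G' [e2 h2]]|{}F G eF [F' [e1 h1]] eG [G' [e2 h2]]
  |{}F eF [F' [e1 h]]|{}F c c0 hc eF [F' [e1 h]]].
- exists (fun=> 0); split; first exact: elem_cst.
  by move=> u x d _ _; rewrite mul0r; exact: cder_cst.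
- exists (fun=> 1); split; first exact: elem_cst.
  by move=> u x d _ h; rewrite mul1r.
- exists (fun k => F' k + G' k); split; first exact: elemD.
  move=> u x d Su ud; rewrite mulrDl; exact: cderD (h1 _ _ _ Su ud) (h2 _ _ _ Su ud).
- exists (fun k => F' k * G k + F k * G' k); split.
    by apply: elemD; exact: elemM.
  move=> u x d Su ud.
  apply: cder_ext (cderM (h1 _ _ _ Su ud) (h2 _ _ _ Su ud)) => //.
  by ring.
- exists (fun k => cexp (F k) * F' k); split.
    by apply: elemM => //; exact: elem_cexp.
  move=> u x d Su ud; rewrite -mulrA; apply: cder_cexp; exact: h.
- exists (fun k => - (F k)^-1 ^+ 2 * F' k); split.
    apply: elemM => //; apply: elemN; apply: elemX; exact: elemV c0 hc eF.
  move=> u x d Su ud; rewrite -mulrA; apply: (@cderV _ (fun s => F (u s))).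
    by rewrite -normc_eq0 gt_eqF // (lt_le_trans c0) // hc.
  exact: h.
Qed.

End Elementary.

Section Polar.
Context {R : realType}.
Implicit Types (s theta r a b : R).

Lemma normc_polar s theta : 0 <= s -> normc (polar s theta) = s.
Proof.
move=> s0; rewrite /polar normcM normcC ger0_norm // normc_cexp !reimE /=.
by rewrite !(mul0r, mulr0, subr0) expR0 mulr1.
Qed.

Lemma Im_polar s theta : Im (polar s theta) = s * sin theta.
Proof.
rewrite /polar /cexp !reimE /=.
by rewrite !(mul0r, mulr0, mul1r, subr0, addr0, add0r) expR0 mul1r.
Qed.

Lemma Re_polar s theta : Re (polar s theta) = s * cos theta.
Proof.
rewrite /polar /cexp !reimE /=.
by rewrite !(mul0r, mulr0, mul1r, subr0, addr0, add0r) expR0 mul1r.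
Qed.

Lemma cder_polar_r s theta :
  cder (fun s => polar s theta) s (cexp (ii * theta%:C)).
Proof.
apply: cder_ext (cderM (cder_id s) (cder_cst s (cexp (ii * theta%:C)))) => //.
by rewrite mulr0 addr0 mul1r.
Qed.

Lemma cder_expi theta :
  cder (fun th => cexp (ii * th%:C)) theta (ii * cexp (ii * theta%:C)).
Proof.
apply: cder_ext (cder_cexp (cderZ ii (cder_id theta))) => //.
by rewrite mulr1 mulrC.
Qed.

Lemma cder_polar_theta s theta :
  cder (fun th => polar s th) theta (ii * polar s theta).
Proof.
apply: cder_ext (cderZ s%:C (cder_expi theta)) => //.
by rewrite /polar mulrCA.
Qed.

Definition segint (F : R[i] -> R[i]) r1 r2 theta : R[i] :=
  cintegral `[r1, r2] (fun s => F (polar s theta) * cexp (ii * theta%:C)).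

Definition arcint (F : R[i] -> R[i]) r a b : R[i] :=
  cintegral `[a, b] (fun theta => F (polar r theta) * (ii * polar r theta)).

Lemma cmeas_polar :
  cmeas setT (fun z : measurableTypeR R * measurableTypeR R => polar z.2 z.1).
Proof.
apply: cmeasM; first by apply: cmeas_real; exact: measurable_snd.
by apply: cmeas_cexp; apply: cmeasZ; apply: cmeas_real; exact: measurable_fst.
Qed.

(** Cauchy's theorem for an annular sector.  The functions
    [d/dtheta (F e^(i theta))] and [d/dr (i r F e^(i theta))] of [(r, theta)]
    coincide; integrating them over the rectangle in the two possible orders
    gives the two sides. *)
Lemma elem_cauchy (S : set R[i]) F r1 r2 a b : elem S F -> 0 <= r1 -> r1 <= r2 ->
  a <= b -> (forall s theta, r1 <= s <= r2 -> a <= theta <= b -> S (polar s theta)) ->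
  segint F r1 r2 b - segint F r1 r2 a = arcint F r2 a b - arcint F r1 a b.
Proof.
move=> eF r10 r12 ab hS.
have [F' [eF' dF]] := elem_deriv eF.
have [F'' [_ dF']] := elem_deriv eF'.
pose G th s := (F' (polar s th) * (ii * polar s th) + F (polar s th) * ii) *
  cexp (ii * th%:C).
have sin s : s \in `[r1, r2] -> r1 <= s <= r2 by rewrite in_itv.
have tin th : th \in `[a, b] -> a <= th <= b by rewrite in_itv.
have dth s th : r1 <= s <= r2 -> a <= th <= b ->
    cder (fun th => F (polar s th) * cexp (ii * th%:C)) th (G th s).
  move=> hs hth.
  apply: cder_ext (cderM (dF (fun th => polar s th) th _ (hS _ _ hs hth)
    (cder_polar_theta s th)) (cder_expi th)) => //.
  by rewrite /G; ring.
have ds s th : r1 <= s <= r2 -> a <= th <= b ->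
    cder (fun s => F (polar s th) * (ii * polar s th)) s (G th s).
  move=> hs hth.
  apply: cder_ext (cderM (dF (fun s => polar s th) s _ (hS _ _ hs hth)
    (cder_polar_r s th)) (cderZ ii (cder_polar_r s th))) => //.
  by rewrite /G; ring.
have cG1 th : a <= th <= b -> ccont_on `[r1, r2] (fun s => G th s).
  move=> hth; apply: cderiv_ccont_itv => s /sin hs; eexists.
  apply: cderM; last exact: cder_cst.
  apply: cderD.
    apply: cderM; first exact: (dF' (fun s => polar s th) s _ (hS _ _ hs hth) (cder_polar_r s th)).
    exact: (cderZ ii (cder_polar_r s th)).
  apply: cderM; last exact: cder_cst.
  exact: (dF (fun s => polar s th) s _ (hS _ _ hs hth) (cder_polar_r s th)).
have cG2 s : r1 <= s <= r2 -> ccont_on `[a, b] (fun th => G th s).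
  move=> hs; apply: cderiv_ccont_itv => th /tin hth; eexists.
  apply: cderM; last exact: cder_expi.
  apply: cderD.
    apply: cderM; first exact: (dF' (fun th => polar s th) th _ (hS _ _ hs hth) (cder_polar_theta s th)).
    exact: (cderZ ii (cder_polar_theta s th)).
  apply: cderM; last exact: cder_cst.
  exact: (dF (fun th => polar s th) th _ (hS _ _ hs hth) (cder_polar_theta s th)).
have [m0 b0] := elem_bounded r2 eF.
have [m1 b1] := elem_bounded r2 eF'.
have Gb th s : a <= th <= b -> r1 <= s <= r2 -> normc (G th s) <= (m1 * r2 + m0) * 1.
  move=> hth hs.
  have s0 : 0 <= s by case/andP: hs => h _; exact: le_trans h.
  have ns : normc (polar s th) <= r2 by rewrite normc_polar //; case/andP: hs.
  rewrite /G normcM normc_cexp !reimE /= !(mul0r, mulr0, subr0) expR0 !mulr1.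
  rewrite (le_trans (normcD _ _)) // lerD //.
    rewrite normcM; apply: ler_pM; rewrite ?normc_ge0 //.
      by apply: b1 => //; exact: hS.
    by rewrite normcM normcI mul1r.
  by rewrite normcM normcI mulr1 b0 //; exact: hS.
have [_ fub] := @cFubini R `[a, b] `[r1, r2] (fun z => G z.1 z.2)
  (fun=> m1 * r2 + m0) (fun=> 1) (measurable_itv _) (measurable_itv _)
  ltac:(apply: (@cmeasS _ _ _ setT) => //; apply: cmeasM;
    [apply: cmeasD; apply: cmeasM;
       [exact: elem_cmeas eF' cmeas_polar|apply: cmeasZ; exact: cmeas_polar
       |exact: elem_cmeas eF cmeas_polar|exact: cmeas_cst]
    |apply: cmeas_cexp; apply: cmeasZ; apply: cmeas_real; exact: measurable_fst])
  (cintegrable_cst_itv _ _ _) (cintegrable_cst_itv _ _ _)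
  (fun th s hth hs => Gb th s (tin th hth) (sin s hs)).
have cont_seg th : a <= th <= b ->
    cintegrable `[r1, r2] (fun s => F (polar s th) * cexp (ii * th%:C)).
  move=> hth; apply: cintegrable_cont; apply: cderiv_ccont_itv => s /sin hs; eexists.
  apply: cderM; last exact: cder_cst.
  exact: (dF (fun s => polar s th) s _ (hS _ _ hs hth) (cder_polar_r s th)).
have cont_arc s : r1 <= s <= r2 ->
    cintegrable `[a, b] (fun th => F (polar s th) * (ii * polar s th)).
  move=> hs; apply: cintegrable_cont; apply: cderiv_ccont_itv => th /tin hth; eexists.
  apply: cderM; last exact: (cderZ ii (cder_polar_theta s th)).
  exact: (dF (fun th => polar s th) th _ (hS _ _ hs hth) (cder_polar_theta s th)).
have mr : measurableR `[r1, r2] by exact: measurable_itv.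
have ma : measurableR `[a, b] by exact: measurable_itv.
have la : a <= a <= b by rewrite lexx.
have lb : a <= b <= b by rewrite lexx andbT.
have l1 : r1 <= r1 <= r2 by rewrite lexx.
have l2 : r1 <= r2 <= r2 by rewrite lexx andbT.
rewrite /segint /arcint -(cintegralB mr (cont_seg b lb) (cont_seg a la)).
rewrite -(cintegralB ma (cont_arc r2 l2) (cont_arc r1 l1)).
transitivity (cintegral `[r1, r2] (fun s => cintegral `[a, b] (fun th => G th s))).
  apply: cintegral_eq => s /sin hs; apply/esym.
  apply: (@cFTC R a b _ (fun th => F (polar s th) * cexp (ii * th%:C)) ab (cG2 s hs)).
    by apply: cderiv_ccont_itv => th /tin hth; eexists; exact: dth.
  move=> t /andP[h1 h2].
  exact: (dth s t hs (introT andP (conj (ltW h1) (ltW h2)))).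
rewrite -fub; apply: cintegral_eq => th /tin hth.
apply: (@cFTC R r1 r2 _ (fun s => F (polar s th) * (ii * polar s th)) r12 (cG1 th hth)).
  by apply: cderiv_ccont_itv => s /sin hs; eexists; exact: ds.
move=> s /andP[h1 h2].
exact: (ds s th (introT andP (conj (ltW h1) (ltW h2))) hth).
Qed.

End Polar.

(** * Superpositions of exponentials *)

Section Superposition.
Context {R : realType}.
Local Notation mu := (@lebesgue_measure R).
Local Notation mR := (measurableTypeR R).
Variable S : set R[i].
Implicit Types (F M p : R[i] -> R[i]) (tau : R -> R) (w : R -> R[i]).

(** An elementary amplitude times a continuous superposition of elementary
    exponentials: Fourier transforms of half-line data and time transforms of
    boundary values are both of this form, which makes Cauchy's theorem for
    them a consequence of the elementary case and Fubini's theorem.  Sums are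
    included because the three parts of a boundary term need not converge
    separately on the real axis. *)
Inductive superp : (R[i] -> R[i]) -> Prop :=
| Superp M p (D : set mR) tau w :
    elem S M -> elem S p -> measurable D ->
    measurable_fun D tau -> cintegrable D w ->
    (forall L : R, exists C : R, forall k, S k -> normc k <= L ->
       forall y, D y -> tau y * Re (p k) <= C) ->
    superp (fun k => M k * cintegral D (fun y => cexp ((tau y)%:C * p k) * w y))
| superpD F G : superp F -> superp G -> superp (fun k => F k + G k).

Lemma superp_mul M F : elem S M -> superp F -> superp (fun k => M k * F k).
Proof.
move=> eM; elim=> [N p D tau w eN ep mD mtau iw hC|F1 F2 _ h1 _ h2].
  apply: (eq_ind (fun k => (M k * N k) *
    cintegral D (fun y => cexp ((tau y)%:C * p k) * w y)) superp).
    by apply: Superp => //; exact: elemM.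
  by apply/funext => k; rewrite mulrA.
apply: (eq_ind (fun k => M k * F1 k + M k * F2 k) superp); first exact: superpD.
by apply/funext => k; rewrite mulrDr.
Qed.

Lemma superp_bounded F (L : R) : superp F ->
  exists m : R, forall k, S k -> normc k <= L -> normc (F k) <= m.
Proof.
elim=> [N p D tau w eN ep mD mtau iw hC|F1 F2 _ [m1 h1] _ [m2 h2]]; last first.
  exists (m1 + m2) => k Sk kL; rewrite (le_trans (normcD _ _)) // lerD //.
    exact: h1.
  exact: h2.
have [m hm] := elem_bounded L eN; have [C hC'] := hC L.
exists (m * (2 * Rintegral mu D (fun y => expR C * normc (w y)))) => k Sk kL.
have mw := cintegrable_cmeas iw.
rewrite normcM; apply: ler_pM; rewrite ?normc_ge0 //; first exact: hm.
apply: normc_cintegral_le => //.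
- exact: (cmeasM (cmeas_cexp (cmeasM (cmeas_real mtau) (cmeas_cst _ _))) mw).
- have := integrableZl mD (expR C) (cintegrable_normc mD iw).
  by apply: eq_integrable => // y _ /=.
- move=> y Dy; rewrite normcM normc_cexp ler_wpM2r ?normc_ge0 // ler_expR.
  by rewrite !reimE /= mul0r subr0; exact: hC'.
Qed.

Lemma cintegrable0 (D : set mR) : measurable D -> cintegrable D (fun=> 0 : R[i]).
Proof. by move=> mD; split; apply: eq_integrable (integrable0 _ _). Qed.

Lemma cintegral_itv_lt (x1 x2 : R) (u : R -> R[i]) : x2 < x1 ->
  cintegral `[x1, x2] u = 0.
Proof.
move=> x21; rewrite /cintegral set_itv_ge ?Rintegral_set0 //.
by rewrite bnd_simp -ltNge.
Qed.

(** Integration along a bounded piece of contour (position [c], velocity [v])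
    commutes with the superposition. *)
Lemma superp_swap N p (D : set mR) tau w (x1 x2 : R) (c v : R -> R[i]) (L V : R) :
  elem S N -> elem S p -> measurable D ->
  measurable_fun D tau -> cintegrable D w ->
  (forall L : R, exists C : R, forall k, S k -> normc k <= L ->
       forall y, D y -> tau y * Re (p k) <= C) ->
  cmeasR `[x1, x2] c -> cmeasR `[x1, x2] v ->
  (forall x, x1 <= x <= x2 -> S (c x) /\ normc (c x) <= L) ->
  (forall x, x1 <= x <= x2 -> normc (v x) <= V) ->
  let F k := N k * cintegral D (fun y => cexp ((tau y)%:C * p k) * w y) in
  let J y := cintegral `[x1, x2]
     (fun x => (N (c x) * cexp ((tau y)%:C * p (c x))) * v x) * w y in
  [/\ cmeasR `[x1, x2] (fun x => F (c x) * v x), cintegrable D J &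
    cintegral `[x1, x2] (fun x => F (c x) * v x) = cintegral D J].
Proof.
move=> eN ep mD mtau iw hC mc mv hc hv F J.
have [m hm] := elem_bounded L eN; have [C hC'] := hC L.
have mI := measurable_itv `[x1, x2] : measurableR `[x1, x2].
have mw := cintegrable_cmeas iw.
have xin x : `[x1, x2]%classic x -> x1 <= x <= x2 by rewrite /= in_itv.
pose K (z : mR * mR) := N (c z.1) * v z.1 * (cexp ((tau z.2)%:C * p (c z.1)) * w z.2).
have mK : cmeas (`[x1, x2] `*` D) K.
  apply: cmeasM; first apply: cmeasM.
  - exact: (cmeas_fst mI mD (elem_cmeas eN mc)).
  - exact: (cmeas_fst mI mD mv).
  - apply: cmeasM; last exact: (cmeas_snd mI mD mw).
    apply: cmeas_cexp; apply: cmeasM.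
      exact: (cmeas_snd mI mD (cmeas_real mtau)).
    exact: (cmeas_fst mI mD (elem_cmeas ep mc)).
have kb x y : `[x1, x2]%classic x -> D y ->
    normc (cexp ((tau y)%:C * p (c x))) <= expR C.
  move=> /xin hx Dy; rewrite normc_cexp ler_expR !reimE /= mul0r subr0.
  by apply: hC' => //; case: (hc x hx).
have nb x : `[x1, x2]%classic x -> normc (N (c x) * v x) <= m * V.
  move=> /xin hx; rewrite normcM; apply: ler_pM; rewrite ?normc_ge0 ?hv //.
  by apply: hm; case: (hc x hx).
have Kb x y : `[x1, x2]%classic x -> D y ->
    normc (K (x, y)) <= (m * V) * (expR C * normc (w y)).
  move=> hx Dy; rewrite /K normcM.
  apply: ler_pM; [exact: normc_ge0|exact: normc_ge0|exact: nb|rewrite normcM].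
  by apply: ler_wpM2r; [exact: normc_ge0|exact: (kb x y hx Dy)].
have iCw : mu.-integrable D (EFin \o (fun y => expR C * normc (w y))).
  have := integrableZl mD (expR C) (cintegrable_normc mD iw).
  by apply: eq_integrable => // y _ /=.
have [m1 fub] := cFubini mI mD mK (cintegrable_cst_itv x1 x2 (m * V)) iCw Kb.
have iK x : `[x1, x2]%classic x ->
    cintegrable D (fun y => cexp ((tau y)%:C * p (c x)) * w y).
  move=> hx; apply: (cintegrable_dom mD _ iCw).
    exact: (cmeasM (cmeas_cexp (cmeasM (cmeas_real mtau) (cmeas_cst _ _))) mw).
  move=> y Dy; rewrite normcM.
  by apply: ler_wpM2r; [exact: normc_ge0|exact: (kb x y hx Dy)].
have eF x : `[x1, x2]%classic x ->
    cintegral D (fun y => K (x, y)) = F (c x) * v x.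
  move=> hx; rewrite /F mulrAC.
  exact: (cintegralZ (N (c x) * v x) mD (iK x hx)).
have mJ0 y : cmeasR `[x1, x2] (fun x => N (c x) * cexp ((tau y)%:C * p (c x)) * v x).
  apply: cmeasM mv; apply: cmeasM; first exact: (elem_cmeas eN mc).
  by apply: cmeas_cexp; apply: cmeasZ; exact: (elem_cmeas ep mc).
have bJ0 y x : D y -> x1 <= x <= x2 ->
    normc (N (c x) * cexp ((tau y)%:C * p (c x)) * v x) <= m * V * expR C.
  move=> Dy hx; rewrite -mulrA [X in normc (_ * X)]mulrC mulrA normcM.
  have hx' : `[x1, x2]%classic x by rewrite /= in_itv.
  by apply: ler_pM; [exact: normc_ge0|exact: normc_ge0|exact: nb|exact: kb].
have eJ y : D y -> cintegral `[x1, x2] (fun x => K (x, y)) = J y.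
  move=> Dy; have iJ0 := cintegrable_itv_bounded (mJ0 y) (fun x => bJ0 y x Dy).
  rewrite /J mulrC -(cintegralZ (w y) mI iJ0).
  have assoc (A B C' D' : R[i]) : A * B * (C' * D') = D' * (A * C' * B) by ring.
  by apply: cintegral_eq => x _; exact: assoc.
split.
- exact: (cmeas_eq_on eF).
- have mK' : cmeas (D `*` `[x1, x2]) (fun z : mR * mR => K (z.2, z.1)).
    apply: cmeasM; first apply: cmeasM.
    - exact: (cmeas_snd mD mI (elem_cmeas eN mc)).
    - exact: (cmeas_snd mD mI mv).
    - apply: cmeasM; last exact: (cmeas_fst mD mI mw).
      apply: cmeas_cexp; apply: cmeasM.
        exact: (cmeas_fst mD mI (cmeas_real mtau)).
      exact: (cmeas_snd mD mI (elem_cmeas ep mc)).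
  have [mJ _] := cFubini mD mI mK' iCw (cintegrable_cst_itv x1 x2 (m * V))
    (fun y x Dy hx => ltac:(rewrite mulrC; exact: (Kb x y hx Dy))).
  have [x12|x21] := leP x1 x2; last first.
    apply: (cintegrable_eq mD _ (cintegrable0 mD)) => y _.
    by rewrite /J (cintegral_itv_lt _ x21) mul0r.
  apply: (@cintegrable_dom _ D _ (fun y => 2 * (m * V * expR C * (x2 - x1)) * normc (w y)) mD).
  + exact: (cmeas_eq_on eJ mJ).
  + have := integrableZl mD (2 * (m * V * expR C * (x2 - x1))) (cintegrable_normc mD iw).
    by apply: eq_integrable.
  + move=> y Dy; rewrite /J normcM; apply: ler_wpM2r; first exact: normc_ge0.
    exact: (normc_cintegral_itv_le x12 (mJ0 y) (fun x => bJ0 y x Dy)).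
- rewrite -(cintegral_eq eF) fub; exact: cintegral_eq.
Qed.

Lemma superp_cmeas F (x1 x2 : R) (c v : R -> R[i]) (L V : R) : superp F ->
  cmeasR `[x1, x2] c -> cmeasR `[x1, x2] v ->
  (forall x, x1 <= x <= x2 -> S (c x) /\ normc (c x) <= L) ->
  (forall x, x1 <= x <= x2 -> normc (v x) <= V) ->
  cmeasR `[x1, x2] (fun x => F (c x) * v x).
Proof.
move=> sF mc mv hc hv; elim: sF => [N p D tau w eN ep mD mtau iw hC|F1 F2 _ h1 _ h2].
  by have [] := superp_swap eN ep mD mtau iw hC mc mv hc hv.
by apply: cmeas_ext (cmeasD h1 h2) => x; rewrite mulrDl.
Qed.

Lemma superp_cintegrable F (x1 x2 : R) (c v : R -> R[i]) (L V : R) : superp F ->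
  cmeasR `[x1, x2] c -> cmeasR `[x1, x2] v ->
  (forall x, x1 <= x <= x2 -> S (c x) /\ normc (c x) <= L) ->
  (forall x, x1 <= x <= x2 -> normc (v x) <= V) ->
  cintegrable `[x1, x2] (fun x => F (c x) * v x).
Proof.
move=> sF mc mv hc hv; have [m hm] := superp_bounded L sF.
apply: (cintegrable_itv_bounded (M := m * V) (superp_cmeas sF mc mv hc hv)) => x hx.
rewrite normcM; apply: ler_pM; [exact: normc_ge0|exact: normc_ge0| |exact: hv].
by have [h1 h2] := hc x hx; exact: hm.
Qed.

End Superposition.

Section SuperpositionCauchy.
Context {R : realType}.
Implicit Types (r a b : R).

Lemma cmeas_ray (D : set R) theta : cmeasR D (polar^~ theta).
Proof.
apply: cmeasM; last exact: cmeas_cst.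
by apply: cmeas_real; exact: measurable_id.
Qed.

Lemma cmeas_arc (D : set R) r : cmeasR D (polar r).
Proof.
apply: cmeasZ; apply: cmeas_cexp; apply: cmeasZ.
by apply: cmeas_real; exact: measurable_id.
Qed.

Let sub_cintegral_eq (D : set (measurableTypeR R)) (A B C E : R[i]) (u1 u2 u3 u4 : R -> R[i]) :
  measurable D -> cintegrable D u1 -> cintegrable D u2 ->
  cintegrable D u3 -> cintegrable D u4 ->
  A = cintegral D u1 -> B = cintegral D u2 -> C = cintegral D u3 ->
  E = cintegral D u4 -> (forall y, D y -> u1 y - u2 y = u3 y - u4 y) ->
  A - B = C - E.
Proof.
move=> mD i1 i2 i3 i4 -> -> -> -> h.
by rewrite -(cintegralB mD i1 i2) -(cintegralB mD i3 i4); exact: cintegral_eq.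
Qed.

Lemma normc_expi (th : R) : normc (cexp (ii * th%:C)) = 1.
Proof. by rewrite normc_cexp !reimE !(mul0r, mulr0, subr0) expR0. Qed.

Lemma superp_cauchy (S : set R[i]) F r1 r2 a b : superp S F ->
  0 <= r1 -> r1 <= r2 -> a <= b ->
  (forall s theta, r1 <= s <= r2 -> a <= theta <= b -> S (polar s theta)) ->
  segint F r1 r2 b - segint F r1 r2 a = arcint F r2 a b - arcint F r1 a b.
Proof.
move=> sF r10 r12 ab hS.
have r20 : 0 <= r2 := le_trans r10 r12.
have pb r th : r1 <= r <= r2 -> normc (polar r th) <= r2.
  by move=> /andP[h1 h2]; rewrite normc_polar // (le_trans r10).
have e1b (th : R) : forall s, r1 <= s <= r2 -> normc (cexp (ii * th%:C)) <= 1.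
  by move=> s _; rewrite (normc_expi th).
have avb r : r1 <= r <= r2 -> forall th, a <= th <= b -> normc (ii * polar r th) <= r2.
  by move=> hr th _; rewrite normcM normcI mul1r pb.
have segI G th : superp S G -> a <= th <= b ->
    cintegrable `[r1, r2] (fun s => G (polar s th) * cexp (ii * th%:C)).
  move=> sG hth; exact: (superp_cintegrable sG (cmeas_ray _ th) (cmeas_cst _ _)
    (fun s hs => conj (hS s th hs hth) (pb s th hs)) (e1b th)).
have arcI G r : superp S G -> r1 <= r <= r2 ->
    cintegrable `[a, b] (fun th => G (polar r th) * (ii * polar r th)).
  move=> sG hr; exact: (superp_cintegrable sG (cmeas_arc _ r) (cmeasZ ii (cmeas_arc _ r))
    (fun th hth => conj (hS r th hr hth) (pb r th hr)) (avb r hr)).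
have hb : a <= b <= b by rewrite ab lexx.
have ha : a <= a <= b by rewrite ab lexx.
have h2 : r1 <= r2 <= r2 by rewrite r12 lexx.
have h1 : r1 <= r1 <= r2 by rewrite r12 lexx.
elim: sF => [N p D tau w eN ep mD mtau iw hC|F1 F2 s1 i1 s2 i2]; last first.
  have mI x y : measurableR `[(x : R), y] by exact: measurable_itv.
  have segD th : a <= th <= b -> segint (fun k => F1 k + F2 k) r1 r2 th =
      segint F1 r1 r2 th + segint F2 r1 r2 th.
    move=> hth; rewrite /segint -(cintegralD (mI _ _) (segI F1 th s1 hth) (segI F2 th s2 hth)).
    by apply: cintegral_eq => s _; exact: mulrDl.
  have arcD r : r1 <= r <= r2 -> arcint (fun k => F1 k + F2 k) r a b =
      arcint F1 r a b + arcint F2 r a b.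
    move=> hr; rewrite /arcint -(cintegralD (mI _ _) (arcI F1 r s1 hr) (arcI F2 r s2 hr)).
    by apply: cintegral_eq => s _; exact: mulrDl.
  have shuffle (A B C E A' B' C' E' : R[i]) : A - B = C - E -> A' - B' = C' - E' ->
      A + A' - (B + B') = C + C' - (E + E').
    by move=> e1 e2; rewrite opprD addrACA e1 e2 opprD addrACA.
  rewrite (segD b hb) (segD a ha) (arcD r2 h2) (arcD r1 h1); exact: shuffle.
have seg th (hth : a <= th <= b) :=
  superp_swap eN ep mD mtau iw hC (cmeas_ray `[r1, r2] th)
   (cmeas_cst `[r1, r2] (cexp (ii * th%:C)))
   (fun s hs => conj (hS s th hs hth) (pb s th hs)) (e1b th).
have arc r (hr : r1 <= r <= r2) :=
  superp_swap eN ep mD mtau iw hC (cmeas_arc `[a, b] r)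
   (cmeasZ ii (cmeas_arc `[a, b] r))
   (fun th hth => conj (hS r th hr hth) (pb r th hr)) (avb r hr).
have [_ ib eb] := seg b hb.
have [_ ia ea] := seg a ha.
have [_ i2 e2] := arc r2 h2.
have [_ i1 e1] := arc r1 h1.
refine (sub_cintegral_eq mD ib ia i2 i1 eb ea e2 e1 _) => y Dy.
rewrite -[LHS]mulrBl -[RHS]mulrBl; congr (_ * _).
exact: (elem_cauchy (elemM eN (elem_cexp (elemZ (tau y)%:C ep))) r10 r12 ab hS).
Qed.

End SuperpositionCauchy.

(** * Abel summation along contours *)

Section AbelIntegral.
Context {R : realType}.
Local Notation mu := (@lebesgue_measure R).
Implicit Types (G : seq (@curve R)) (c : @curve R) (F : R[i] -> R[i]) (l m : R[i]).

Definition damped (eps : R) F k := (expR (- eps * normc k))%:C * F k.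

(** Abel integrals with a linear rate of convergence.  The rate is what makes
    limits exchangeable with finite sums and with changes of contour without
    further domination arguments. *)
Definition abel G F l :=
  (forall eps, 0 < eps -> curve_integrable G (damped eps F)) /\
  exists C : R, forall eps, 0 < eps ->
    normc (curve_integral G (damped eps F) - l) <= C * eps.

Lemma curve_integrable_nil F : curve_integrable [::] F.
Proof. by []. Qed.

Lemma curve_integrable_cons c G F :
  curve_integrable (c :: G) F <->
  cintegrable (dom c) (fun s => F (pos c s) * vel c s) /\ curve_integrable G F.
Proof.
split => [h|[h1 h2]]; first by split; [exact: (h 0%N)|move=> i hi; exact: (h i.+1)].
by case => [|i] hi //; exact: h2.
Qed.

Lemma curve_integral_cons c G F : curve_integral (c :: G) F =
  cintegral (dom c) (fun s => F (pos c s) * vel c s) + curve_integral G F.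
Proof. by rewrite /curve_integral big_cons. Qed.

Lemma curve_integral1 c F : curve_integral [:: c] F =
  cintegral (dom c) (fun s => F (pos c s) * vel c s).
Proof. by rewrite /curve_integral big_seq1. Qed.

Lemma curve_integral_cat G1 G2 F :
  curve_integral (G1 ++ G2) F = curve_integral G1 F + curve_integral G2 F.
Proof. by rewrite /curve_integral big_cat. Qed.

Lemma curve_integrable_cat G1 G2 F : curve_integrable G1 F ->
  curve_integrable G2 F -> curve_integrable (G1 ++ G2) F.
Proof.
elim: G1 => [//|c G1 ih] /curve_integrable_cons[h1 h2] h3.
by apply/curve_integrable_cons; split => //; exact: ih.
Qed.

Lemma abel_nil F : abel [::] F 0.
Proof.
split=> [eps _|]; first exact: curve_integrable_nil.
by exists 0 => eps _; rewrite /curve_integral big_nil subrr normc0E mul0r.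
Qed.

Lemma abel_cat G1 G2 F l1 l2 : abel G1 F l1 -> abel G2 F l2 ->
  abel (G1 ++ G2) F (l1 + l2).
Proof.
move=> [i1 [C1 h1]] [i2 [C2 h2]]; split=> [eps e0|].
  by apply: curve_integrable_cat; [exact: i1|exact: i2].
exists (C1 + C2) => eps e0; rewrite curve_integral_cat mulrDl opprD addrACA.
by rewrite (le_trans (normcD _ _)) // lerD ?h1 ?h2.
Qed.

Lemma abel_ccvg G F l : abel G F l ->
  ccvg (fun eps => curve_integral G (damped eps F)) (0^'+) l.
Proof.
move=> [_ [C hC]]; have cb (f : R -> R) (r : R) :
    (forall eps, 0 < eps -> `|f eps - r| <= C * eps) -> f @ 0^'+ --> r.
  move=> h; apply/cvgrPdist_le => e e0; near=> x.
  have x0 : 0 < x by near: x; exact: nbhs_right_gt.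
  rewrite distrC; apply: (le_trans (h x x0)).
  apply: (@le_trans _ _ ((`|C| + 1) * x)).
    apply: ler_wpM2r; first exact: ltW.
    by rewrite (le_trans (ler_norm _)) // lerDl.
  rewrite mulrC -ler_pdivlMr; last by rewrite ltr_wpDl.
  near: x; apply: nbhs_right_le; apply: divr_gt0 => //; by rewrite ltr_wpDl.
split; apply: cb => eps e0.
  by rewrite -ReB (le_trans (Re_le_normc _)) // hC.
by rewrite -ImB (le_trans (Im_le_normc _)) // hC.
Unshelve. all: by end_near. Qed.

Lemma abel_is_curve_integral G F l : abel G F l -> is_curve_integral G F l.
Proof. by move=> h; split; [exact: h.1|exact: abel_ccvg]. Qed.

Lemma abel_opp1 c F l : measurableR (dom c) -> abel [:: c] F l ->
  abel [:: opp_curve c] F (- l).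
Proof.
move=> mc [i1 [C h]].
have ic eps (e0 : 0 < eps) := (proj1 (proj1 (curve_integrable_cons _ _ _) (i1 eps e0))).
have eqv (e : R) s : - (damped e F (pos c s) * vel c s) =
  damped e F (pos (opp_curve c) s) * vel (opp_curve c) s by rewrite /= mulrN.
split=> [eps e0|].
  apply/curve_integrable_cons; split; last exact: curve_integrable_nil.
  apply: (cintegrable_eq mc _ (cintegrableN mc (ic eps e0))) => s _.
  exact: eqv.
exists C => eps e0; have := h eps e0; rewrite !curve_integral1.
rewrite (_ : cintegral (dom (opp_curve c)) _ =
  - cintegral (dom c) (fun s => damped eps F (pos c s) * vel c s)).
  by rewrite -opprD normcNE.
rewrite -(cintegralN mc (ic eps e0)); apply: cintegral_eq => s _.
by rewrite eqv.
Qed.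

Lemma normc_cexp_sub1 (z : R[i]) : Re z <= 0 -> normc (cexp z - 1) <= 2 * normc z.
Proof.
move=> z0.
have d (u : R) : cder (fun u => cexp (u%:C * z)) u (cexp (u%:C * z) * z).
  by apply: cder_cexp; apply: cder_ext (cderM (cder_id u) (cder_cst u z)) => //;
    rewrite mul1r mulr0 addr0.
have cu : ccont_on `[0, 1] (fun u : R => cexp (u%:C * z) * z).
  apply: cderiv_ccont_itv => u _; eexists.
  by apply: cderM; [exact: d|exact: cder_cst].
have -> : cexp z - 1 = cintegral `[0, 1] (fun u : R => cexp (u%:C * z) * z).
  rewrite (@cFTC _ _ _ _ (fun u : R => cexp (u%:C * z)) ler01 cu) //.
    by rewrite mul1r mul0r cexp0.
  by apply: cderiv_ccont_itv => u _; eexists; exact: d.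
apply: (@le_trans _ _ (2 * (normc z * (1 - 0)))); last by rewrite subr0 mulr1.
apply: normc_cintegral_itv_le => //.
  exact: (ccont_on_cmeas (measurable_itv _) cu).
move=> u /andP[u0 _]; rewrite normcM ler_piMl ?normc_ge0 // normc_cexp.
by rewrite !reimE mul0r subr0 -expR0 ler_expR mulr_ge0_le0.
Qed.

(** The rates of convergence below come from this comparison of an integrand with
    a multiple [m] of it, [m] being within [O(e)] of 1. *)
Lemma factor_estimate (D : set R) (u m : R -> R[i]) (g : R -> R) (e : R) :
  measurableR D -> cintegrable D u -> cintegrable D (fun x => m x * u x) ->
  mu.-integrable D (EFin \o g) ->
  (forall x, D x -> normc (m x - 1) * normc (u x) <= e * g x) ->
  normc (cintegral D (fun x => m x * u x) - cintegral D u) <=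
    2 * (e * Rintegral mu D g).
Proof.
move=> mD iu imu ig h; rewrite -(cintegralB mD imu iu) -RintegralZl //.
apply: normc_cintegral_le => //.
- exact: (cintegrable_cmeas (cintegrableB mD imu iu)).
- have := integrableZl mD e ig; exact: eq_integrable.
- by move=> x Dx; rewrite -[X in _ - X]mul1r -mulrBl normcM; exact: h.
Qed.

Lemma mul_expR_decay (c s : R) : 0 < c -> s * expR (- c * s) <= 2 / c * expR (- (c / 2) * s).
Proof.
move=> c0.
have -> : expR (- c * s) = expR (- (c / 2) * s) * expR (- (c / 2) * s).
  by rewrite -expRD; congr expR; field.
rewrite mulrA ler_wpM2r ?expR_ge0 //.
have h : c / 2 * s <= expR (c / 2 * s).
  by rewrite (le_trans _ (expR_ge1Dx _)) // lerDr.
rewrite mulNr expRN ler_pdivrMr ?expR_gt0 //.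
have := ler_wpM2l (ltW (divr_gt0 (ltr0n _ 2) c0)) h.
by rewrite mulrA (_ : 2 / c * (c / 2) = 1) ?mul1r //; field; rewrite gt_eqF.
Qed.

End AbelIntegral.

(** * Rotation of contours in unbounded sectors *)

Section SectorTheorem.
Context {R : realType}.
Local Notation mu := (@lebesgue_measure R).

Definition rayint (F : R[i] -> R[i]) rho theta : R[i] :=
  cintegral `[rho, +oo[ (fun s : R => F (polar s theta) * cexp (ii * theta%:C)).

Let mray (r : R) : measurableR `[r, +oo[.
Proof. exact: measurable_itv. Qed.

Lemma superp_cmeas_ray (S : set R[i]) F (rho theta : R) (v : R[i]) : superp S F ->
  0 <= rho -> (forall s, rho <= s -> S (polar s theta)) ->
  cmeasR `[rho, +oo[ (fun s => F (polar s theta) * v).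
Proof.
move=> sF r0 hS.
have e : `[rho, +oo[%classic = \bigcup_n `[rho, rho + n%:R]%classic :> set R.
  apply/seteqP; split => x /=; rewrite in_itv /= andbT.
    move=> rx; exists (Num.Def.trunc (x - rho)).+1 => //=.
    rewrite in_itv /= rx /= -lerBlDl; apply/ltW.
    exact: truncnS_gt.
  by move=> [n _] /=; rewrite in_itv /= => /andP[].
have h n : cmeasR `[rho, rho + n%:R] (fun s => F (polar s theta) * v).
  apply: (superp_cmeas (L := rho + n%:R) (V := normc v) sF (cmeas_ray _ theta)
    (cmeas_cst _ v)) => s.
    move=> /andP[h1 h2]; split; first exact: hS.
    by rewrite normc_polar // (le_trans r0).
  by [].
have mE n : measurableR (`[rho, rho + n%:R]%classic : set R) by exact: measurable_itv.
rewrite e; split.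
  exact: (proj2 (@measurable_fun_bigcup _ _ (measurableTypeR R) R _ _ mE)
    (fun n => proj1 (h n))).
exact: (proj2 (@measurable_fun_bigcup _ _ (measurableTypeR R) R _ _ mE)
  (fun n => proj2 (h n))).
Qed.

Lemma rayint_integrable (S : set R[i]) F (rho theta C c : R) : superp S F ->
  0 <= rho -> (forall s, rho <= s -> S (polar s theta)) -> 0 < c ->
  (forall s, rho <= s -> normc (F (polar s theta)) <= C * expR (- c * s)) ->
  cintegrable `[rho, +oo[ (fun s => F (polar s theta) * cexp (ii * theta%:C)).
Proof.
move=> sF r0 hS c0 hF.
apply: (@cintegrable_dom _ _ _ (fun s => C * expR (- c * s)) (measurable_itv _)).
- exact: superp_cmeas_ray sF r0 hS.
- have := integrableZl (mray rho) C (integrable_expR_decay rho c0).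
  exact: eq_integrable.
- by move=> s /=; rewrite in_itv /= andbT => rs; rewrite normcM normc_expi mulr1 hF.
Qed.

(** The factor [exp (- eps |k|)] on the ray of argument [phi], continued
    analytically off that ray. *)
Definition damping (eps phi : R) (k : R[i]) :=
  cexp ((- eps)%:C * (cexp (- (ii * phi%:C)) * k)).

Lemma elem_damping S eps phi : elem S (damping eps phi).
Proof. by apply: elem_cexp; apply: elemZ; apply: elemZ; exact: elem_id. Qed.

Lemma damping_arg (eps phi s theta : R) :
  (- eps)%:C * (cexp (- (ii * phi%:C)) * polar s theta) =
  (- eps)%:C * polar s (theta - phi).
Proof.
congr (_ * _); rewrite /polar mulrCA -cexpD; congr (_ * cexp _).
by rewrite realCB mulrBr addrC.
Qed.

Lemma damping_on (eps phi s : R) : damping eps phi (polar s phi) = (expR (- eps * s))%:C.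
Proof.
rewrite /damping damping_arg subrr /polar realC0 mulr0 cexp0 mulr1.
by rewrite -realCM cexpC.
Qed.

Lemma normc_damping (eps phi s theta : R) :
  normc (damping eps phi (polar s theta)) = expR (- eps * (s * cos (theta - phi))).
Proof.
by rewrite /damping damping_arg normc_cexp ReM ReC ImC mul0r subr0 Re_polar.
Qed.

Lemma damping_sub1 (eps phi s theta : R) : 0 <= eps -> 0 <= s ->
  0 <= cos (theta - phi) ->
  normc (damping eps phi (polar s theta) - 1) <= 2 * (eps * s).
Proof.
move=> e0 s0 c0; rewrite /damping damping_arg.
apply: (le_trans (normc_cexp_sub1 _)).
  rewrite ReM ReC ImC mul0r subr0 Re_polar mulNr oppr_le0.
  by rewrite mulr_ge0 // mulr_ge0.
by rewrite normcM normcC normc_polar // normrN ger0_norm.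
Qed.

Let shuffle_eps (x e : R) : 2 * x * e = 2 * (e * x).
Proof. by ring. Qed.

(** On a bounded piece of contour the damping factor is within [O(eps)] of 1. *)
Lemma abel_bounded (S : set R[i]) F (x1 x2 L V : R) (p v : R -> R[i]) :
  superp S F -> 0 <= L -> cmeasR `[x1, x2] p -> cmeasR `[x1, x2] v ->
  (forall x, x1 <= x <= x2 -> S (p x) /\ normc (p x) <= L) ->
  (forall x, x1 <= x <= x2 -> normc (v x) <= V) ->
  abel [:: Curve `[x1, x2] p v] F (cintegral `[x1, x2] (fun x => F (p x) * v x)).
Proof.
move=> sF L0 mp mv hp hv.
have mI : measurableR `[x1, x2] by exact: measurable_itv.
have [M hM] := superp_bounded L sF.
have mFv := superp_cmeas sF mp mv hp hv.
have bFv x : x1 <= x <= x2 -> normc (F (p x) * v x) <= M * V.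
  move=> hx; rewrite normcM; apply: ler_pM; [exact: normc_ge0|exact: normc_ge0| |exact: hv].
  by have [h1 h2] := hp x hx; exact: hM.
have iFv := cintegrable_itv_bounded mFv bFv.
pose m (eps x : R) : R[i] := (expR (- eps * normc (p x)))%:C.
have mm eps : cmeasR `[x1, x2] (m eps).
  apply: cmeas_real; apply: (measurableT_comp (@measurable_expR R)).
  apply: (measurableT_comp (continuous_measurable_fun (@mulrl_continuous _ (- eps)))).
  exact: (cmeas_normc mp).
have bm eps x : 0 < eps -> normc (m eps x) <= 1.
  move=> e0; rewrite normcC ger0_norm ?expR_ge0 // -expR0 ler_expR mulNr oppr_le0.
  by rewrite mulr_ge0 ?normc_ge0 // ltW.
have imF eps : 0 < eps -> cintegrable `[x1, x2] (fun x => m eps x * (F (p x) * v x)).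
  move=> e0; apply: (cintegrable_itv_bounded (M := 1 * (M * V)) (cmeasM (mm eps) mFv)).
  move=> x hx; rewrite normcM.
  by apply: ler_pM; [exact: normc_ge0|exact: normc_ge0|exact: bm|exact: bFv].
have eqv eps x : m eps x * (F (p x) * v x) = damped eps F (p x) * v x by exact: mulrA.
split=> [eps e0|].
  apply/curve_integrable_cons; split; last exact: curve_integrable_nil.
  exact: (cintegrable_eq mI (fun x _ => eqv eps x) (imF eps e0)).
exists (2 * Rintegral mu `[x1, x2] (fun=> 2 * L * (M * V))) => eps e0.
rewrite curve_integral1 -(cintegral_eq (fun x _ => eqv eps x)).
rewrite (shuffle_eps (Rintegral _ _ _) eps).
apply: (@factor_estimate _ _ _ (m eps) _ eps mI iFv (imF eps e0)
  (cintegrable_cst_itv x1 x2 (2 * L * (M * V)))) => x hx'.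
have hx : x1 <= x <= x2 by move: hx'; rewrite /= in_itv.
rewrite (_ : eps * _ = (2 * (eps * L)) * (M * V)); last by ring.
apply: ler_pM; [exact: normc_ge0|exact: normc_ge0| |exact: bFv].
rewrite /m -cexpC; apply: (le_trans (normc_cexp_sub1 _)).
  by rewrite ReC mulNr oppr_le0 mulr_ge0 ?normc_ge0 // ltW.
rewrite normcC mulNr normrN ger0_norm; last by rewrite mulr_ge0 ?normc_ge0 // ltW.
by rewrite !ler_pM2l //; case: (hp x hx).
Qed.

Lemma abel_arc (S : set R[i]) F (rho a b : R) : superp S F -> 0 <= rho ->
  (forall th, a <= th <= b -> S (polar rho th)) ->
  abel [:: arc rho a b] F (arcint F rho a b).
Proof.
move=> sF r0 hS; apply: (abel_bounded (L := rho) (V := rho) sF r0 (cmeas_arc _ rho)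
  (cmeasZ ii (cmeas_arc _ rho))) => th hth.
  by split; [exact: hS|rewrite normc_polar].
by rewrite normcM normcI mul1r normc_polar.
Qed.

Section Sector.
Variables (S : set R[i]) (F : R[i] -> R[i]) (rho a b eta : R).
Hypothesis sF : superp S F.
Hypothesis rho0 : 0 <= rho.
Hypothesis ab : a <= b.
Hypothesis abpi : b - a < pi / 2.
Hypothesis hS : forall s theta, rho <= s -> a <= theta <= b -> S (polar s theta).
Hypothesis growth : forall d, 0 < d -> exists C : R, forall s theta,
  rho <= s -> a <= theta <= b ->
  normc (F (polar s theta)) <= C * expR (d * s - eta * (s * sin theta)).
Hypothesis eta_sin : forall theta, a <= theta <= b -> 0 <= eta * sin theta.

Let s_ge0 s : rho <= s -> 0 <= s. Proof. exact: le_trans. Qed.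

Let c0 := cos (b - a).
Let c0_gt0 : 0 < c0.
Proof. by apply: cos_gt0_pihalf; rewrite abpi andbT; have p := @pi_gt0 R; have := ab => h; lra. Qed.

Let cos_ge theta phi : a <= theta <= b -> a <= phi <= b -> c0 <= cos (theta - phi).
Proof.
move=> /andP[h1 h2] /andP[h3 h4].
have p := @pi_gt0 R; have h5 := abpi.
have aux x : 0 <= x -> x <= b - a -> c0 <= cos x.
  move=> x0; rewrite /c0 le_eqVlt => /predU1P[->//|xb]; apply: ltW.
  by rewrite ltr_cos // in_itv /=; apply/andP; split; lra.
have [|] := leP phi theta => h.
  by apply: aux; lra.
by rewrite -cosN; apply: aux; lra.
Qed.

Let growth0 (d : R) : 0 < d -> exists2 C : R, 0 <= C & forall s theta,
  rho <= s -> a <= theta <= b -> normc (F (polar s theta)) <= C * expR (d * s).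
Proof.
move=> d0; have [C hC] := growth d0; exists `|C| => // s theta rs hth.
apply: (le_trans (hC s theta rs hth)).
apply: (@le_trans _ _ (`|C| * expR (d * s - eta * (s * sin theta)))).
  by apply: ler_wpM2r; [exact: expR_ge0|exact: ler_norm].
apply: ler_wpM2l => //; rewrite ler_expR gerBl mulrCA.
by apply: mulr_ge0; [exact: s_ge0|exact: eta_sin].
Qed.

Let mid theta (phi : R) := a <= theta <= b /\ a <= phi <= b.

Let damped_bound (eps phi : R) : 0 < eps -> a <= phi <= b ->
  exists2 C : R, 0 <= C & forall s theta, rho <= s -> a <= theta <= b ->
   normc (damping eps phi (polar s theta) * F (polar s theta)) <=
     C * expR (- (eps * c0 / 2) * s).
Proof.
move=> e0 hphi; have d0 : 0 < eps * c0 / 2 by rewrite divr_gt0 // mulr_gt0.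
have [C C0 hC] := growth0 d0; exists C => // s theta rs hth.
rewrite normcM normc_damping mulrC.
apply: (@le_trans _ _ ((C * expR (eps * c0 / 2 * s)) * expR (- eps * (s * c0)))).
  apply: ler_pM; [exact: normc_ge0|exact: expR_ge0|exact: hC|].
  rewrite ler_expR !mulNr lerN2; apply: ler_wpM2l; first exact: ltW.
  by apply: ler_wpM2l; [exact: s_ge0|exact: cos_ge].
rewrite -mulrA -expRD le_eqVlt; apply/orP; left; apply/eqP.
by congr (_ * expR _); field.
Qed.

Let sdF eps phi : superp S (fun k => damping eps phi k * F k).
Proof. exact: superp_mul (elem_damping _ _ _) sF. Qed.

(** The arc that closes the sector at radius [r] is exponentially small in [r]. *)
Let damped_cauchy (eps phi : R) : 0 < eps -> a <= phi <= b ->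
  rayint (fun k => damping eps phi k * F k) rho b -
  rayint (fun k => damping eps phi k * F k) rho a =
  - arcint (fun k => damping eps phi k * F k) rho a b.
Proof.
move=> e0 hphi; set G := (fun k => damping eps phi k * F k).
have [C C0 hC] := damped_bound e0 hphi.
have d0 : 0 < eps * c0 / 2 by rewrite divr_gt0 // mulr_gt0.
have hb : a <= b <= b by rewrite ab lexx.
have ha : a <= a <= b by rewrite ab lexx.
have ray th : a <= th <= b ->
    ccvg (fun n => segint G rho (rho + n%:R) th) \oo (rayint G rho th).
  move=> hth; apply: cintegral_cvg_ray.
  apply: (rayint_integrable (sdF eps phi) rho0 _ d0) => s rs; first exact: hS.
  exact: hC.
have arcs : ccvg (fun n => arcint G (rho + n%:R) a b) \oo 0.
  apply: (@ccvg0 _ _ _ _ _ (fun n : nat =>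
    (2 * C * (b - a) * (2 / (eps * c0 / 2))) *
      expR (- (eps * c0 / 2 / 2) * (rho + n%:R)))); last first.
    rewrite -[X in _ --> X](mulr0 (2 * C * (b - a) * (2 / (eps * c0 / 2)))).
    by apply: cvgMr; apply: cvg_expR_decay; rewrite divr_gt0.
  move=> n; set r := rho + n%:R.
  have rr : rho <= r by rewrite /r lerDl.
  have r0 : 0 <= r by exact: s_ge0.
  apply: (@le_trans _ _ (2 * ((C * (r * expR (- (eps * c0 / 2) * r))) * (b - a)))).
    apply: normc_cintegral_itv_le => //.
      apply: (superp_cmeas (L := r) (V := r) (sdF eps phi) (cmeas_arc _ r)
        (cmeasZ ii (cmeas_arc _ r))) => th hth.
        by split; [exact: hS|rewrite normc_polar].
      by rewrite normcM normcI mul1r normc_polar.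
    move=> th hth; rewrite normcM [normc (ii * _)]normcM normcI mul1r normc_polar //.
    rewrite mulrCA mulrC ler_wpM2l //.
    exact: hC.
  have shuffle (x y : R) : 2 * (C * x * y) = 2 * C * y * x by ring.
  rewrite shuffle -(mulrA (2 * C * (b - a))); apply: ler_wpM2l.
    by rewrite mulr_ge0 ?subr_ge0 // mulr_ge0.
  exact: mul_expR_decay.
rewrite -(sub0r (arcint G rho a b)).
apply: (ccvg_unique (ccvgB (ray b hb) (ray a ha))).
rewrite (_ : (fun s => _) = (fun n : nat => arcint G (rho + n%:R) a b - arcint G rho a b)).
  exact: (ccvgB arcs (ccvg_cst _)).
apply/funext => n; apply: (superp_cauchy (sdF eps phi) rho0 _ ab).
  by rewrite lerDl.
by move=> s th /andP[rs _]; exact: hS.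
Qed.

Let measurable_ray (theta : R) : measurableR (dom (ray rho theta)).
Proof. exact: measurable_itv. Qed.

Let damped_ray (eps phi : R) :
  cintegral (dom (ray rho phi)) (fun s =>
    damped eps F (pos (ray rho phi) s) * vel (ray rho phi) s) =
  rayint (fun k => damping eps phi k * F k) rho phi.
Proof.
apply: cintegral_eq => s /=; rewrite in_itv /= andbT => rs.
by rewrite damping_on /damped normc_polar //; exact: s_ge0.
Qed.

Let damped_ray_integrable (eps phi : R) : 0 < eps -> a <= phi <= b ->
  curve_integrable [:: ray rho phi] (damped eps F).
Proof.
move=> e0 hphi; apply/curve_integrable_cons; split; last exact: curve_integrable_nil.
have [C C0 hC] := damped_bound e0 hphi.
have d0 : 0 < eps * c0 / 2 by rewrite divr_gt0 // mulr_gt0.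
apply: (cintegrable_eq (measurable_ray _) _ (rayint_integrable (sdF eps phi) rho0
  (fun s rs => hS rs hphi) d0 (fun s rs => hC s phi rs hphi))) => s /=.
rewrite in_itv /= andbT => rs.
by rewrite damping_on /damped normc_polar //; exact: s_ge0.
Qed.

Let decays psi := exists C c : R, [/\ 0 < c, 0 <= C & forall s, rho <= s ->
   normc (F (polar s psi)) <= C * expR (- c * s)].

Let decays_of psi : a <= psi <= b -> 0 < eta * sin psi -> decays psi.
Proof.
move=> hpsi h; have [|C hC] := @growth (eta * sin psi / 2); first by rewrite divr_gt0.
exists `|C|, (eta * sin psi / 2); split => //; first by rewrite divr_gt0.
move=> s rs; apply: (le_trans (hC s psi rs hpsi)).
rewrite (_ : _ * s - _ = - (eta * sin psi / 2) * s); last by field.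
by apply: ler_wpM2r; [exact: expR_ge0|exact: ler_norm].
Qed.

(** On a decaying ray every damping differs from none by [O(eps)], whatever the
    ray on which it is the modulus. *)
Let damping_ray_close psi phi : a <= psi <= b -> a <= phi <= b -> decays psi ->
  exists K : R, forall eps, 0 < eps ->
   normc (rayint (fun k => damping eps phi k * F k) rho psi - rayint F rho psi)
     <= K * eps.
Proof.
move=> hpsi hphi [C [c [cp C0 hC]]].
exists (2 * Rintegral mu `[rho, +oo[ (fun s => 2 * C * (2 / c) * expR (- (c / 2) * s))).
move=> eps e0.
have [C' C'0 hC'] := damped_bound e0 hphi.
have d0 : 0 < eps * c0 / 2 by rewrite divr_gt0 // mulr_gt0.
have i1 := rayint_integrable sF rho0 (fun s rs => hS rs hpsi) cp hC.
have i2 := rayint_integrable (sdF eps phi) rho0 (fun s rs => hS rs hpsi) d0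
  (fun s rs => hC' s psi rs hpsi).
rewrite (shuffle_eps (Rintegral _ _ _) eps).
rewrite (_ : rayint (fun k => damping eps phi k * F k) rho psi =
  cintegral `[rho, +oo[ (fun s : R => damping eps phi (polar s psi) *
   (F (polar s psi) * cexp (ii * psi%:C)))); last first.
  by apply: cintegral_eq => s _; exact/esym/mulrA.
apply: factor_estimate => //.
- apply: (cintegrable_eq (measurable_ray psi) _ i2) => s _.
  exact/esym/mulrA.
- have := integrableZl (mray rho) (2 * C * (2 / c))
    (integrable_expR_decay rho (divr_gt0 cp (ltr0n _ 2))).
  exact: eq_integrable.
- move=> s hs; have rs : rho <= s by move: hs; rewrite /= in_itv /= andbT.
  rewrite normcM normc_expi mulr1.
  apply: (@le_trans _ _ ((2 * (eps * s)) * (C * expR (- c * s)))).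
    apply: ler_pM; [exact: normc_ge0|exact: normc_ge0| |exact: hC].
    apply: damping_sub1; [exact: ltW|exact: s_ge0|].
    exact: le_trans (ltW c0_gt0) (cos_ge hpsi hphi).
  rewrite (_ : 2 * (eps * s) * _ = (eps * (2 * C)) * (s * expR (- c * s))); last by ring.
  rewrite -!mulrA ler_pM2l // ler_pM2l // ler_wpM2l //.
  by rewrite mulrA; exact: mul_expR_decay.
Qed.

Let arc_cmeas G : superp S G ->
  cmeasR `[a, b] (fun th => G (polar rho th) * (ii * polar rho th)).
Proof.
move=> sG; apply: (superp_cmeas (L := rho) (V := rho) sG (cmeas_arc _ rho)
        (cmeasZ ii (cmeas_arc _ rho))) => th hth.
  by split; [exact: hS|rewrite normc_polar].
by rewrite normcM normcI mul1r normc_polar.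
Qed.

Let arc_integrable G : superp S G ->
  cintegrable `[a, b] (fun th => G (polar rho th) * (ii * polar rho th)).
Proof.
move=> sG; have [M hM] := superp_bounded rho sG.
apply: (cintegrable_itv_bounded (M := M * rho) (arc_cmeas sG)) => th hth.
rewrite normcM; apply: ler_pM; [exact: normc_ge0|exact: normc_ge0| |].
  by apply: hM; [exact: hS|rewrite normc_polar].
by rewrite normcM normcI mul1r normc_polar.
Qed.

Let damping_arc_close phi : a <= phi <= b -> exists K : R, forall eps, 0 < eps ->
   normc (arcint (fun k => damping eps phi k * F k) rho a b - arcint F rho a b)
     <= K * eps.
Proof.
move=> hphi; have [M hM] := superp_bounded rho sF.
exists (2 * Rintegral mu `[a, b] (fun=> 2 * rho * (M * rho))) => eps e0.
rewrite (shuffle_eps (Rintegral _ _ _) eps).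
rewrite (_ : arcint (fun k => damping eps phi k * F k) rho a b =
  cintegral `[a, b] (fun th : R => damping eps phi (polar rho th) *
   (F (polar rho th) * (ii * polar rho th)))); last first.
  by apply: cintegral_eq => s _; exact/esym/mulrA.
apply: factor_estimate.
- exact: measurable_itv.
- exact: arc_integrable.
- apply: (cintegrable_eq (measurable_itv _) _ (arc_integrable (sdF eps phi))) => th _.
  exact/esym/mulrA.
- exact: cintegrable_cst_itv.
- move=> th hth'; have hth : a <= th <= b by move: hth'; rewrite /= in_itv.
  rewrite (_ : eps * _ = (2 * (eps * rho)) * (M * rho)); last by ring.
  apply: ler_pM; [exact: normc_ge0|exact: normc_ge0| |].
    apply: damping_sub1; [exact: ltW|by []|].
    exact: le_trans (ltW c0_gt0) (cos_ge hth hphi).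
  rewrite normcM; apply: ler_pM; [exact: normc_ge0|exact: normc_ge0| |].
    by apply: hM; [exact: hS|rewrite normc_polar].
  by rewrite normcM normcI mul1r normc_polar.
Qed.

Let abel_ray_decays psi : a <= psi <= b -> decays psi ->
  abel [:: ray rho psi] F (rayint F rho psi).
Proof.
move=> hpsi dpsi; split=> [eps e0|]; first exact: damped_ray_integrable.
have [K hK] := damping_ray_close hpsi hpsi dpsi.
by exists K => eps e0; rewrite curve_integral1 damped_ray; exact: hK.
Qed.

(** Cauchy's theorem for the unbounded sector.  One bounding ray may carry a
    merely oscillating integrand: its damping is continued analytically into the
    sector, where it still decays because the sector is narrower than a
    quarter turn, and the contour is turned onto the other ray. *)
Theorem sector_abel : 0 < eta * sin a \/ 0 < eta * sin b ->
  exists la lb : R[i], [/\ abel [:: ray rho a] F la, abel [:: ray rho b] F lb &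
    la = lb + arcint F rho a b].
Proof.
have ha : a <= a <= b by rewrite lexx ab.
have hb : a <= b <= b by rewrite ab lexx.
move=> [da|db].
  have dec := decays_of ha da.
  exists (rayint F rho a), (rayint F rho a - arcint F rho a b).
  split; [exact: abel_ray_decays| |by rewrite subrK].
  split=> [eps e0|]; first exact: damped_ray_integrable.
  have [K hK] := damping_ray_close ha hb dec.
  have [K' hK'] := damping_arc_close hb.
  exists (K + K') => eps e0; rewrite curve_integral1 damped_ray.
  have rearrange (rb ra arc ra0 arc0 : R[i]) : rb - ra = - arc ->
      rb - (ra0 - arc0) = (ra - ra0) - (arc - arc0).
    by move=> /(canRL (subrK _)) ->; ring.
  rewrite (rearrange _ _ _ _ _ (damped_cauchy e0 hb)) mulrDl.
  apply: (le_trans (normcB _ _)); apply: lerD; [exact: hK|exact: hK'].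
have dec := decays_of hb db.
exists (rayint F rho b + arcint F rho a b), (rayint F rho b).
split; [|exact: abel_ray_decays|by []].
split=> [eps e0|]; first exact: damped_ray_integrable.
have [K hK] := damping_ray_close hb ha dec.
have [K' hK'] := damping_arc_close ha.
exists (K + K') => eps e0; rewrite curve_integral1 damped_ray.
have rearrange (rb ra arc rb0 arc0 : R[i]) : rb - ra = - arc ->
    ra - (rb0 + arc0) = (rb - rb0) + (arc - arc0).
  by move=> /(canRL (subrK _)) ->; ring.
rewrite (rearrange _ _ _ _ _ (damped_cauchy e0 ha)) mulrDl.
by apply: (le_trans (normcD _ _)); apply: lerD; [exact: hK|exact: hK'].
Qed.

End Sector.

End SectorTheorem.

(** * Calculus of oscillatory contour integrals *)

Section CurveIntegralCalculus.
Context {R : realType}.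
Implicit Types (G : seq (@curve R)) (c : @curve R) (F : R[i] -> R[i]) (l m : R[i]).

Lemma ici_cat G1 G2 F l1 l2 : is_curve_integral G1 F l1 ->
  is_curve_integral G2 F l2 -> is_curve_integral (G1 ++ G2) F (l1 + l2).
Proof.
move=> [i1 h1] [i2 h2]; split=> [eps e0|].
  by apply: curve_integrable_cat; [exact: i1|exact: i2].
rewrite (_ : (fun eps => _) = (fun eps => curve_integral G1 (damped eps F) +
   curve_integral G2 (damped eps F))); first exact: (ccvgD h1 h2).
by apply/funext => eps; rewrite curve_integral_cat.
Qed.

Definition measurable_curves G := forall i, (i < size G)%N ->
    measurableR (dom (nth (Curve set0 (fun=> 0) (fun=> 0)) G i)).

(** All the operations below reduce to this principle. *)
Lemma ici_transfer G G' F F' l l' (r : R -> R[i]) (m : R[i]) :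
  is_curve_integral G F l ->
  (forall eps, 0 < eps -> curve_integrable G' (damped eps F') /\
     curve_integral G' (damped eps F') = curve_integral G (damped eps F) + r eps) ->
  ccvg r (0^'+) m -> l' = l + m -> is_curve_integral G' F' l'.
Proof.
move=> [_ h] e rm ->; split=> [eps e0|]; first exact: (e eps e0).1.
have near_eq : \forall eps \near 0^'+, curve_integral G' (damped eps F') =
    curve_integral G (damped eps F) + r eps.
  near=> eps; apply: (e eps _).2; near: eps; exact: nbhs_right_gt.
have [h1 h2] := ccvgD h rm; split.
  by apply: cvg_trans h1; apply: near_eq_cvg; apply: filterS near_eq => eps ->.
by apply: cvg_trans h2; apply: near_eq_cvg; apply: filterS near_eq => eps ->.
Unshelve. all: by end_near. Qed.

Let curves_opp G F eps : measurable_curves G -> curve_integrable G (damped eps F) ->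
  curve_integrable (map opp_curve G) (damped eps F) /\
  curve_integral (map opp_curve G) (damped eps F) = - curve_integral G (damped eps F).
Proof.
elim: G => [_ _|c G ih] /=; first by split => //; rewrite /curve_integral !big_nil oppr0.
move=> mG /curve_integrable_cons[ic iG].
have [j1 j2] := ih (fun i hi => mG i.+1 hi) iG.
have mc := mG 0%N isT.
have eqv s : - (damped eps F (pos c s) * vel c s) =
  damped eps F (pos (opp_curve c) s) * vel (opp_curve c) s by rewrite /= mulrN.
split.
  apply/curve_integrable_cons; split => //.
  by apply: (cintegrable_eq mc _ (cintegrableN mc ic)) => s _; exact: eqv.
rewrite !curve_integral_cons j2 opprD; congr (_ + _).
rewrite -(cintegralN mc ic); apply: cintegral_eq => s _.
by rewrite eqv.
Qed.

Lemma ici_opp G F l : measurable_curves G -> is_curve_integral G F l ->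
  is_curve_integral (map opp_curve G) F (- l).
Proof.
move=> mG [i1 h1]; split=> [eps e0|]; first exact: (curves_opp mG (i1 eps e0)).1.
have near_eq : \forall eps \near 0^'+, curve_integral (map opp_curve G) (damped eps F) =
    - curve_integral G (damped eps F).
  near=> eps; apply: (curves_opp mG (i1 eps _)).2; near: eps; exact: nbhs_right_gt.
have [h2 h3] := ccvgN h1; split.
  by apply: cvg_trans h2; apply: near_eq_cvg; apply: filterS near_eq => eps ->.
by apply: cvg_trans h3; apply: near_eq_cvg; apply: filterS near_eq => eps ->.
Unshelve. all: by end_near. Qed.

Let curves_add G F1 F2 eps : measurable_curves G ->
  curve_integrable G (damped eps F1) -> curve_integrable G (damped eps F2) ->
  curve_integrable G (damped eps (fun k => F1 k + F2 k)) /\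
  curve_integral G (damped eps (fun k => F1 k + F2 k)) =
    curve_integral G (damped eps F1) + curve_integral G (damped eps F2).
Proof.
elim: G => [_ _ _|c G ih] /=.
  by split => //; rewrite /curve_integral !big_nil addr0.
move=> mG /curve_integrable_cons[ic iG] /curve_integrable_cons[ic' iG'].
have [j1 j2] := ih (fun i hi => mG i.+1 hi) iG iG'.
have mc := mG 0%N isT.
have eqv s : damped eps F1 (pos c s) * vel c s + damped eps F2 (pos c s) * vel c s
  = damped eps (fun k => F1 k + F2 k) (pos c s) * vel c s.
  by rewrite -mulrDl -mulrDr.
split.
  apply/curve_integrable_cons; split => //.
  by apply: (cintegrable_eq mc _ (cintegrableD mc ic ic')) => s _; exact: eqv.
rewrite !curve_integral_cons j2 addrACA; congr (_ + _).
by rewrite -(cintegralD mc ic ic'); apply: cintegral_eq => s _; rewrite eqv.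
Qed.

Lemma ici_D G F1 F2 l1 l2 : measurable_curves G ->
  is_curve_integral G F1 l1 -> is_curve_integral G F2 l2 ->
  is_curve_integral G (fun k => F1 k + F2 k) (l1 + l2).
Proof.
move=> mG h1 h2; apply: (ici_transfer h1 _ h2.2 erefl) => eps e0.
by apply: curves_add => //; [exact: h1.1|exact: h2.1].
Qed.

Lemma ici_eq G F1 F2 l : (forall i, (i < size G)%N ->
    let c := nth (Curve set0 (fun=> 0) (fun=> 0)) G i in
    measurableR (dom c) /\ forall s, dom c s -> F1 (pos c s) = F2 (pos c s)) ->
  is_curve_integral G F1 l -> is_curve_integral G F2 l.
Proof.
move=> mG h1.
apply: (ici_transfer (r := fun=> 0) h1 _ (ccvg_cst 0)); last by rewrite addr0.
move=> eps e0; move: (h1.1 eps e0) => i1; clear h1; move: mG i1.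
elim: G => [_ _|c G ih] /=.
  by split => //; rewrite /curve_integral !big_nil addr0.
move=> mG /curve_integrable_cons[ic iG].
have [j1 j2] := ih (fun i hi => mG i.+1 hi) iG.
have [mc ec] := mG 0%N isT.
have eqv s : dom c s -> damped eps F1 (pos c s) * vel c s =
    damped eps F2 (pos c s) * vel c s.
  by move=> Ds; rewrite /damped -ec.
split.
  apply/curve_integrable_cons; split => //.
  exact: (cintegrable_eq mc eqv ic).
rewrite !curve_integral_cons j2 !addr0; congr (_ + _).
by apply/esym; exact: cintegral_eq.
Qed.

End CurveIntegralCalculus.

(** * The real axis as a contour *)

Section Line.
Context {R : realType}.
Local Notation mu := (@lebesgue_measure R).
Implicit Types (u : R -> R[i]) (F : R[i] -> R[i]).

Lemma half_line_split (rho : R) u : 0 <= rho -> cintegrable `[0, +oo[ u ->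
  cintegral `[0, +oo[ u = cintegral `[0, rho] u + cintegral `[rho, +oo[ u.
Proof.
move=> r0 iu.
have e : `[0, +oo[%classic = `[0, rho]%classic `|` `]rho, +oo[%classic :> set R.
  apply/seteqP; split => x; rewrite /= !in_itv /= !andbT.
    by move=> x0; case: (leP x rho) => h; [left|right]; rewrite ?x0.
  by case=> [/andP[]//|/ltW h]; exact: (le_trans r0 h).
have m1 : measurableR `[0, rho] by exact: measurable_itv.
have m2 : measurableR `]rho, +oo[ by exact: measurable_itv.
have iray : cintegrable `[rho, +oo[ u.
  apply: cintegrableS iu; [exact: measurable_itv|exact: measurable_itv|].
  by move=> x; rewrite /= !in_itv /= !andbT; exact: le_trans.
rewrite e cintegral_setU //; last 2 first.
- by rewrite -e.
- apply/disj_set2P; apply/seteqP; split => // x [].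
  by rewrite /= !in_itv /= andbT => /andP[_ h1 h2]; move: (le_lt_trans h1 h2); rewrite ltxx.
by rewrite cintegral_obnd.
Qed.

Lemma line_split u : cintegrable setT u ->
  [/\ cintegrable `[0, +oo[ u, cintegrable `[0, +oo[ (fun s => u (- s)) &
  cintegral setT u = cintegral `[0, +oo[ u + cintegral `[0, +oo[ (fun s => u (- s))].
Proof.
move=> iu.
have m1 : measurableR `[(0 : R), +oo[ by exact: measurable_itv.
have m2 : measurableR `]-oo, (0 : R)[ by exact: measurable_itv.
have n1 : (-1 : R) != 0 by rewrite oppr_eq0 oner_eq0.
have [iN _] := cintegral_scale n1 iu.
have ineg : cintegrable `[0, +oo[ (fun s => u (- s)).
  apply: (cintegrable_eq m1 _ (cintegrableS measurableT m1 (@subsetT _ _) iN)) => s _.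
  by rewrite mulN1r.
have ipos : cintegrable `[0, +oo[ u := cintegrableS measurableT m1 (@subsetT _ _) iu.
split => //.
have e : setT = `]-oo, 0[%classic `|` `[0, +oo[%classic :> set R.
  apply/seteqP; split => x //= _; rewrite !in_itv /= andbT.
  by case: (ltP x 0) => h; [left|right].
rewrite {1}e cintegral_setU //; last 2 first.
- by rewrite -e.
- apply/disj_set2P; apply/seteqP; split => // x [].
  by rewrite /= !in_itv /= andbT => h1 h2; move: (lt_le_trans h1 h2); rewrite ltxx.
rewrite addrC; congr (_ + _).
rewrite cintegral_mkcond.
have iext := cintegrable_mkcond m2 (cintegrableS measurableT m2 (@subsetT _ _) iu).
have [_ ->] := cintegral_scale n1 iext.
rewrite normrN normr1 mul1r -(cintegral_obnd ineg) [RHS]cintegral_mkcond.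
apply: cintegral_eq => x _; rewrite /extend0 mulN1r.
have -> : (- x \in `]-oo, 0[%classic) = (x \in `]0, +oo[%classic :> bool).
  by rewrite !mem_setE !in_itv /= oppr_lt0 andbT.
by [].
Qed.

Lemma line_join u : cintegrable `[0, +oo[ u -> cintegrable `[0, +oo[ (fun s => u (- s)) ->
  cintegrable setT u.
Proof.
move=> i1 i2.
have m1 : measurableR `[(0 : R), +oo[ by exact: measurable_itv.
have n1 : (-1 : R) != 0 by rewrite oppr_eq0 oner_eq0.
have m0 : measurableR `](0 : R), +oo[ by exact: measurable_itv.
have i2' : cintegrable `]0, +oo[ (fun s => u (- s)).
  apply: (cintegrableS m1 m0 _ i2) => x.
  by rewrite /= !in_itv /= !andbT => /ltW.
have [j2 _] := cintegral_scale n1 (cintegrable_mkcond m0 i2').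
have j1 := cintegrable_mkcond m1 i1.
apply: (cintegrable_eq measurableT _ (cintegrableD measurableT j1 j2)) => x _.
rewrite /extend0 !mem_setE !in_itv /= !andbT mulN1r opprK oppr_gt0.
by case: (ltP x 0) => h; rewrite ?add0r ?addr0.
Qed.

Definition seg (rho theta : R) : curve :=
  Curve `[0, rho] (polar^~ theta) (fun=> cexp (ii * theta%:C)).

Lemma polar0 (s : R) : polar s 0 = s%:C.
Proof. by rewrite /polar realC0 mulr0 cexp0 mulr1. Qed.

Lemma cexpi_pi : cexp (ii * (pi : R)%:C) = -1.
Proof.
apply: complex_ext; rewrite /cexp !reimE /=.
  by rewrite !(mul0r, mulr0, mul1r, add0r, subr0) expR0 cospi mul1r.
by rewrite !(mul0r, mulr0, mul1r, add0r, subr0, addr0) expR0 sinpi mul1r oppr0.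
Qed.

Lemma polar_pi (s : R) : polar s pi = - s%:C.
Proof. by rewrite /polar cexpi_pi mulrN1. Qed.

Lemma cexpi_2pi : cexp (ii * (2 * pi : R)%:C) = 1.
Proof.
by rewrite mulr_natl mulr2n realCD mulrDr cexpD cexpi_pi mulrN1 opprK.
Qed.

Lemma polar_2pi (s : R) : polar s (2 * pi) = s%:C.
Proof. by rewrite /polar cexpi_2pi mulr1. Qed.

(** The pieces near the origin are separated because the contours of [D] avoid it. *)
Definition cut_line (rho : R) : seq curve :=
  [:: seg rho 0; ray rho 0; opp_curve (seg rho pi); opp_curve (ray rho pi)].

Lemma cut_line_integral (rho : R) F : 0 <= rho -> curve_integrable real_line F ->
  curve_integrable (cut_line rho) F /\
  curve_integral (cut_line rho) F = curve_integral real_line F.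
Proof.
move=> r0 /curve_integrable_cons[/= il _].
have [ip ineg e] := line_split il.
have m1 : measurableR `[(0 : R), +oo[ by exact: measurable_itv.
have mS : measurableR `[0, rho] by exact: measurable_itv.
have mR' : measurableR `[rho, +oo[ by exact: measurable_itv.
have sS : (`[0, rho]%classic : set R) `<=` `[0, +oo[%classic.
  by move=> x; rewrite /= !in_itv /= andbT => /andP[].
have sR : (`[rho, +oo[%classic : set R) `<=` `[0, +oo[%classic.
  by move=> x; rewrite /= !in_itv /= !andbT; exact: le_trans.
have p0 s : F s%:C * 1 = F (polar s 0) * cexp (ii * (0 : R)%:C).
  by rewrite polar0 realC0 mulr0 cexp0.
have pp s : F (- s)%:C * 1 = F (polar s pi) * - cexp (ii * (pi : R)%:C).
  by rewrite polar_pi cexpi_pi opprK realCN.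
split.
  apply/curve_integrable_cons; split.
    exact: (cintegrable_eq mS (fun s _ => p0 s) (cintegrableS m1 mS sS ip)).
  apply/curve_integrable_cons; split.
    exact: (cintegrable_eq mR' (fun s _ => p0 s) (cintegrableS m1 mR' sR ip)).
  apply/curve_integrable_cons; split.
    exact: (cintegrable_eq mS (fun s _ => pp s) (cintegrableS m1 mS sS ineg)).
  apply/curve_integrable_cons; split; last exact: curve_integrable_nil.
  exact: (cintegrable_eq mR' (fun s _ => pp s) (cintegrableS m1 mR' sR ineg)).
rewrite /cut_line !curve_integral_cons /curve_integral ?big_cons !big_nil !addr0.
rewrite [RHS]e (half_line_split r0 ip) (half_line_split r0 ineg) !addrA.
congr (_ + _ + _ + _); apply/esym/cintegral_eq => s _;
  [exact: p0|exact: p0|exact: pp|exact: pp].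
Qed.

Lemma line_of_rays F : curve_integrable [:: ray 0 0] F -> curve_integrable [:: ray 0 pi] F ->
  curve_integrable real_line F /\
  curve_integral real_line F =
    curve_integral [:: ray 0 0] F - curve_integral [:: ray 0 pi] F.
Proof.
move=> /curve_integrable_cons[/= i1 _] /curve_integrable_cons[/= i2 _].
have m1 : measurableR `[(0 : R), +oo[ by exact: measurable_itv.
have j1 : cintegrable `[0, +oo[ (fun s : R => F s%:C * 1).
  by apply: (cintegrable_eq m1 _ i1) => s _; rewrite polar0 realC0 mulr0 cexp0.
have j2 : cintegrable `[0, +oo[ (fun s : R => F (- s)%:C * 1).
  apply: (cintegrable_eq m1 _ (cintegrableN m1 i2)) => s _.
  by rewrite polar_pi cexpi_pi mulrN opprK realCN.
have il := line_join j1 j2.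
split; first by apply/curve_integrable_cons; split => //; exact: curve_integrable_nil.
have [_ _ e] := line_split il.
rewrite !curve_integral1 [LHS]e; congr (_ + _).
  by apply: cintegral_eq => s _; rewrite /= polar0 realC0 mulr0 cexp0.
rewrite -(cintegralN m1 i2); apply: cintegral_eq => s _.
by rewrite polar_pi cexpi_pi mulrN opprK realCN.
Qed.

End Line.

(** * Deformation of the real axis to the boundary of D *)

Section Deformation.
Context {R : realType}.
Implicit Types (F G : R[i] -> R[i]).

(** The growth condition of Jordan's lemma: [exp (i eta k)] times anything of
    subexponential growth. *)
Definition grows (a b rho eta : R) F := forall d, 0 < d -> exists C : R,
  forall s theta, rho <= s -> a <= theta <= b ->
  normc (F (polar s theta)) <= C * expR (d * s - eta * (s * sin theta)).

Lemma growsM (a b rho e1 e2 : R) F G : grows a b rho e1 F -> grows a b rho e2 G ->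
  grows a b rho (e1 + e2) (fun k => F k * G k).
Proof.
move=> h1 h2 d d0; have d2 : 0 < d / 2 by rewrite divr_gt0.
have [C1 hC1] := h1 _ d2; have [C2 hC2] := h2 _ d2.
exists (C1 * C2) => s th rs hth; rewrite normcM.
apply: (@le_trans _ _ ((C1 * expR (d / 2 * s - e1 * (s * sin th))) *
   (C2 * expR (d / 2 * s - e2 * (s * sin th))))).
  by apply: ler_pM; [exact: normc_ge0|exact: normc_ge0|exact: hC1|exact: hC2].
rewrite mulrACA -expRD le_eqVlt; apply/orP; left; apply/eqP.
by congr (_ * expR _); field.
Qed.

Lemma growsD (a b rho eta : R) F G : grows a b rho eta F -> grows a b rho eta G ->
  grows a b rho eta (fun k => F k + G k).
Proof.
move=> h1 h2 d d0; have [C1 hC1] := h1 _ d0; have [C2 hC2] := h2 _ d0.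
exists (C1 + C2) => s th rs hth; rewrite (le_trans (normcD _ _)) // mulrDl.
by apply: lerD; [exact: hC1|exact: hC2].
Qed.

Lemma grows_bounded (a b rho C : R) F : 0 <= rho ->
  (forall s theta, rho <= s -> a <= theta <= b -> normc (F (polar s theta)) <= C) ->
  grows a b rho 0 F.
Proof.
move=> r0 h d d0; exists C => s th rs hth.
have C0 : 0 <= C := le_trans (normc_ge0 _) (h s th rs hth).
rewrite mul0r subr0 (le_trans (h s th rs hth)) // ler_peMr // -expR0 ler_expR.
by rewrite mulr_ge0 ?(ltW d0) // (le_trans r0).
Qed.

Lemma grows_id (a b rho : R) : 0 <= rho -> grows a b rho 0 (fun k => k).
Proof.
move=> r0 d d0; exists d^-1 => s th rs hth.
have s0 : 0 <= s := le_trans r0 rs.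
rewrite normc_polar // mul0r subr0 ler_pdivlMl //.
by rewrite (le_trans _ (expR_ge1Dx _)) // lerDr.
Qed.

Lemma grows_horner (a b rho : R) (p : {poly R[i]}) : 0 <= rho ->
  grows a b rho 0 (fun k => p.[k]).
Proof.
move=> r0; elim/poly_ind: p => [|p c ih].
  apply: (grows_bounded (C := 0)) => // s th _ _.
  by rewrite horner0 normc0E.
have hM := growsM ih (@grows_id a b rho r0); rewrite addr0 in hM.
have hc : grows a b rho 0 (fun=> c).
  by apply: (grows_bounded (C := normc c)).
move=> d d0; have [C hC] := growsD hM hc d0.
exists C => s th rs hth; rewrite hornerMXaddC; exact: hC.
Qed.

Lemma grows_cexp (a b rho eta : R) : 0 <= rho ->
  grows a b rho eta (fun k => cexp (ii * (eta%:C * k))).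
Proof.
move=> r0 d d0; exists 1 => s th rs hth.
rewrite mul1r normc_cexp ler_expR.
have -> : Re (ii * (eta%:C * polar s th)) = - (eta * (s * sin th)).
  rewrite ReM ReI ImI mul0r sub0r mul1r ImM ReC ImC mul0r addr0.
  by rewrite Im_polar.
by rewrite lerDr mulr_ge0 ?(ltW d0) // (le_trans r0).
Qed.

Lemma grows_eq (a b rho eta : R) F G :
  (forall s theta, rho <= s -> a <= theta <= b -> F (polar s theta) = G (polar s theta)) ->
  grows a b rho eta F -> grows a b rho eta G.
Proof.
move=> e h d d0; have [C hC] := h d d0; exists C => s th rs hth.
by rewrite -e //; exact: hC.
Qed.

Lemma grows_sub (a b rho rho' eta : R) F : rho' <= rho ->
  grows a b rho' eta F -> grows a b rho eta F.
Proof.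
move=> r h d d0; have [C hC] := h d d0; exists C => s th rs hth.
by apply: hC => //; exact: le_trans rs.
Qed.

Lemma sector_lo_hi j : sector_lo j <= sector_hi j :> R.
Proof.
rewrite /sector_lo /sector_hi ler_pM2r ?invr_gt0 // ler_wpM2r ?pi_ge0 // ler_nat.
exact: leq_pred.
Qed.

Lemma sector_width j : sector_hi j - sector_lo j < pi / 2 :> R.
Proof.
have p := @pi_gt0 R; rewrite /sector_lo /sector_hi.
case: j => [|j] /=; first by rewrite subrr divr_gt0.
by rewrite -natr1 -mulrBl -mulrBl addrAC subrr add0r; lra.
Qed.

(** The sectors of the half plane in which [k / kappa] lies above the real axis. *)
Definition above (kappa : R) (j : nat) :=
  if 0 < kappa then j \in [:: 1; 2; 3] else j \in [:: 4; 5; 6].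

Lemma sin_shift (x : R) : sin x = - sin (x - pi).
Proof. by rewrite -[in LHS](subrK pi x) sinDpi. Qed.

Lemma sin_above (kappa theta : R) j : kappa != 0 -> above kappa j ->
  sector_lo j <= theta <= sector_hi j -> 0 <= kappa^-1 * sin theta.
Proof.
move=> k0; have p := @pi_gt0 R; rewrite /above /sector_lo /sector_hi.
case: ifPn => kp.
  rewrite !inE => /or3P[] /eqP-> /= /andP[h1 h2];
  (apply: mulr_ge0; [by rewrite invr_ge0 ltW|apply: sin_ge0_pi; lra]).
have kn : kappa < 0 by rewrite lt_neqAle k0 leNgt.
rewrite !inE => /or3P[] /eqP-> /= /andP[h1 h2];
  (apply: mulr_le0; [by rewrite invr_le0 ltW|
   rewrite sin_shift oppr_le0; apply: sin_ge0_pi; lra]).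
Qed.

Lemma sin_above_end (kappa : R) j : kappa != 0 -> above kappa j ->
  0 < kappa^-1 * sin (sector_lo j) \/ 0 < kappa^-1 * sin (sector_hi j).
Proof.
move=> k0; have p := @pi_gt0 R; rewrite /above /sector_lo /sector_hi.
case: ifPn => kp.
  have pos (x : R) : 0 < x < pi -> 0 < kappa^-1 * sin x.
    by move=> h; apply: mulr_gt0; [rewrite invr_gt0|exact: sin_gt0_pi].
  rewrite !inE => /or3P[] /eqP-> /=;
    [right|right|left]; apply: pos; apply/andP; split; lra.
have kn : kappa < 0 by rewrite lt_neqAle k0 leNgt.
have pos (x : R) : 0 < x - pi < pi -> 0 < kappa^-1 * sin x.
  move=> h; rewrite nmulr_lgt0 ?invr_lt0 // sin_shift oppr_lt0.
  exact: sin_gt0_pi.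
rewrite !inE => /or3P[] /eqP-> /=;
  [right|right|left]; apply: pos; apply/andP; split; lra.
Qed.

Definition sector_set (rho : R) j : set R[i] :=
  [set k | exists s theta, [/\ rho <= s, sector_lo j <= theta <= sector_hi j &
     k = polar s theta]].

Lemma sector_rotation (S : set R[i]) F (rho y kappa : R) j : superp S F ->
  0 <= rho -> 0 < y -> kappa != 0 -> above kappa j -> sector_set rho j `<=` S ->
  grows (sector_lo j) (sector_hi j) rho (y / kappa) F ->
  exists la lb : R[i], [/\ abel [:: ray rho (sector_lo j)] F la,
    abel [:: ray rho (sector_hi j)] F lb,
    abel [:: arc rho (sector_lo j) (sector_hi j)] F (arcint F rho (sector_lo j) (sector_hi j)) &
    la = lb + arcint F rho (sector_lo j) (sector_hi j)].
Proof.
move=> sF r0 y0 k0 aj hS gF.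
have hS' s th : rho <= s -> sector_lo j <= th <= sector_hi j -> S (polar s th).
  by move=> h1 h2; apply: hS; exists s, th.
have yk x : y / kappa * x = y * (kappa^-1 * x) by rewrite mulrA.
have [||la [lb [h1 h2 h3]]] := sector_abel sF r0 (sector_lo_hi j) (sector_width j) hS' gF.
- by move=> th hth; rewrite yk mulr_ge0 ?(ltW y0) // (sin_above k0 aj hth).
- have [h|h] := sin_above_end k0 aj; [left|right];
  by rewrite yk mulr_gt0.
exists la, lb; split=> //.
by apply: (abel_arc sF r0) => th hth; exact: hS'.
Qed.

(** The arc of the boundary of the sector is what [sector_abel] leaves between its
    two rays. *)
Lemma sector_boundary_abel0 (S : set R[i]) F (rho y kappa : R) j : superp S F ->
  0 <= rho -> 0 < y -> kappa != 0 -> above kappa j -> sector_set rho j `<=` S ->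
  grows (sector_lo j) (sector_hi j) rho (y / kappa) F ->
  is_curve_integral (sector_boundary rho j) F 0.
Proof.
move=> sF r0 y0 k0 aj hS gF.
have [la [lb [h1 h2 h3 e]]] := sector_rotation sF r0 y0 k0 aj hS gF.
have mr : measurableR (dom (ray rho (sector_hi j))) by exact: measurable_itv.
have ma : measurableR (dom (arc rho (sector_lo j) (sector_hi j))) by exact: measurable_itv.
have := abel_cat (abel_opp1 mr h2) (abel_cat (abel_opp1 ma h3) h1).
rewrite e (_ : _ + (_ + _) = 0); last by ring.
exact: abel_is_curve_integral.
Qed.

Lemma seg_abel F (rho theta : R) : superp setT F -> 0 <= rho ->
  abel [:: seg rho theta] F (segint F 0 rho theta).
Proof.
move=> sF r0; apply: (abel_bounded (L := rho) (V := 1) sF r0 (cmeas_ray _ theta)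
  (cmeas_cst _ (cexp (ii * theta%:C)))) => s.
  by move=> /andP[s0 sr]; split=> //; rewrite normc_polar.
by rewrite normc_expi.
Qed.

Let arcint0 F a b : arcint F 0 a b = 0.
Proof.
rewrite /arcint (@cintegral_eq _ _ _ (fun=> 0)).
  by rewrite /cintegral /= /Rintegral integral0.
by move=> th _; rewrite /polar realC0 mul0r !mulr0.
Qed.

(** Cauchy's theorem in the part of the sector inside the disc: the inner arc has
    radius 0. *)
Lemma disc_sector F (rho : R) j : superp setT F -> 0 <= rho ->
  segint F 0 rho (sector_hi j) - segint F 0 rho (sector_lo j) =
  arcint F rho (sector_lo j) (sector_hi j).
Proof.
move=> sF r0.
by rewrite (superp_cauchy sF (lexx 0) r0 (sector_lo_hi j)) // arcint0 subr0.
Qed.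

Lemma sector_lo1 : sector_lo 1 = 0 :> R. Proof. by rewrite /sector_lo /=; field. Qed.
Lemma sector_hi3 : sector_hi 3 = pi :> R. Proof. by rewrite /sector_hi; field. Qed.
Lemma sector_lo4 : sector_lo 4 = pi :> R. Proof. by rewrite /sector_lo /=; field. Qed.
Lemma sector_hi6 : sector_hi 6 = 2 * pi :> R. Proof. by rewrite /sector_hi; field. Qed.

Lemma ray_2pi (rho : R) : ray rho (2 * pi) = ray rho 0.
Proof.
rewrite /ray; congr Curve.
  by apply/funext => s; rewrite polar_2pi polar0.
by apply/funext => s; rewrite cexpi_2pi realC0 mulr0 cexp0.
Qed.

Lemma segint_2pi F (rho : R) : segint F 0 rho (2 * pi) = segint F 0 rho 0.
Proof.
by apply: cintegral_eq => s _; rewrite polar_2pi polar0 cexpi_2pi realC0 mulr0 cexp0.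
Qed.

(** Above the real axis lie the sectors 1, 2, 3.  The rays that bound sector 2 can
    be turned into each other, so the real axis may be replaced by the
    boundaries of sectors 1 and 3; the discrepancies near the origin cancel by
    Cauchy's theorem in the disc.  The real axis and the new contour share the
    damping factor, so convergence on the former carries over. *)
Lemma deform_pos F (rho y kappa : R) l : superp setT F -> 0 <= rho -> 0 < y ->
  0 < kappa -> grows (sector_lo 2) (sector_hi 2) rho (y / kappa) F ->
  is_curve_integral real_line F l ->
  is_curve_integral (sector_boundary rho 1 ++ sector_boundary rho 3) F l.
Proof.
move=> sF r0 y0 k0 gF hl.
have kn0 : kappa != 0 by rewrite gt_eqF.
have a2 : above kappa 2 by rewrite /above k0.
have [la [lb [h1 h2 _ e2]]] := sector_rotation sF r0 y0 kn0 a2 (@subsetT _ _) gF.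
have arcT j := abel_arc (a := sector_lo j) (b := sector_hi j) sF r0 (fun th _ => I).
pose Dc c eps := cintegral (dom c) (fun s => damped eps F (pos c s) * vel c s).
have lim c m : abel [:: c] F m -> ccvg (Dc c) (0^'+) m.
  move=> /abel_ccvg; rewrite (_ : (fun eps => _) = Dc c) //.
  by apply/funext => eps; rewrite curve_integral1.
have intg c m : abel [:: c] F m -> forall eps, 0 < eps ->
    cintegrable (dom c) (fun s => damped eps F (pos c s) * vel c s).
  by move=> [h _] eps e0; have /curve_integrable_cons[] := h eps e0.
have negI c : measurableR (dom c) -> forall eps,
    cintegrable (dom c) (fun s => damped eps F (pos c s) * vel c s) ->
    cintegrable (dom (opp_curve c)) (fun s => damped eps F (pos (opp_curve c) s) *
      vel (opp_curve c) s) /\ Dc (opp_curve c) eps = - Dc c eps.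
  move=> mc eps ic.
  have eqv s : - (damped eps F (pos c s) * vel c s) =
    damped eps F (pos (opp_curve c) s) * vel (opp_curve c) s by rewrite /= mulrN.
  split; first by apply: (cintegrable_eq mc _ (cintegrableN mc ic)) => s _; exact: eqv.
  rewrite /Dc -(cintegralN mc ic); apply: cintegral_eq => s _.
  by rewrite eqv.
have mray th : measurableR (dom (ray rho th)) by exact: measurable_itv.
have marc a b : measurableR (dom (arc rho a b)) by exact: measurable_itv.
have mseg th : measurableR (dom (seg rho th)) by exact: measurable_itv.
(* [r] is what separates the damped integrals over the two contours; its limit [m]
   vanishes by Cauchy's theorem in sector 2 and in the disc. *)
pose r eps := - Dc (ray rho (sector_lo 2)) eps + Dc (ray rho (sector_hi 2)) eps
  - Dc (arc rho (sector_lo 1) (sector_hi 1)) eps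
  - Dc (arc rho (sector_lo 3) (sector_hi 3)) eps
  - Dc (seg rho 0) eps + Dc (seg rho pi) eps.
pose m := - la + lb - arcint F rho (sector_lo 1) (sector_hi 1)
  - arcint F rho (sector_lo 3) (sector_hi 3)
  - segint F 0 rho 0 + segint F 0 rho pi.
have m0 : m = 0.
  have d1 := disc_sector 1 sF r0; have d2 := disc_sector 2 sF r0.
  have d3 := disc_sector 3 sF r0; rewrite sector_lo1 in d1; rewrite sector_hi3 in d3.
  rewrite /m e2 sector_lo1 sector_hi3 -d1 -d2 -d3.
  rewrite -[sector_lo 2]/(sector_hi 1) -[sector_lo 3]/(sector_hi 2); ring.
apply: (ici_transfer (r := r) (m := m) hl); last by rewrite m0 addr0.
- move=> eps e0.
  have [ic ec] := cut_line_integral r0 (hl.1 eps e0).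
  move: (ic) => /curve_integrable_cons[is0 /curve_integrable_cons[ir0
    /curve_integrable_cons[isp /curve_integrable_cons[irp _]]]].
  have [j1 k1] := negI _ (mray (sector_lo 2)) eps (intg _ _ h1 eps e0).
  have j2 := intg _ _ h2 eps e0.
  have [j3 k3] := negI _ (marc _ _) eps (intg _ _ (arcT 1) eps e0).
  have [j4 k4] := negI _ (marc _ _) eps (intg _ _ (arcT 3) eps e0).
  have [_ k5] := negI _ (mseg pi) eps (intg _ _ (seg_abel pi sF r0) eps e0).
  rewrite sector_lo1 in j3 k3; rewrite sector_hi3 in j4 k4.
  rewrite /sector_boundary sector_hi3 sector_lo1; split.
    apply: curve_integrable_cat.
      apply/curve_integrable_cons; split; first exact: j1.
      apply/curve_integrable_cons; split; first exact: j3.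
      apply/curve_integrable_cons; split; last exact: curve_integrable_nil.
      exact: ir0.
    apply/curve_integrable_cons; split; first exact: irp.
    apply/curve_integrable_cons; split; first exact: j4.
    apply/curve_integrable_cons; split; last exact: curve_integrable_nil.
    exact: j2.
  rewrite -ec /curve_integral !big_cons !big_nil !addr0.
  rewrite -!/(Dc _ eps) k1 k5 /r -[sector_hi 1]/(sector_lo 2) -[sector_lo 3]/(sector_hi 2).
  rewrite -[sector_hi 1]/(sector_lo 2) in k3; rewrite -[sector_lo 3]/(sector_hi 2) in k4.
  rewrite sector_lo1 sector_hi3 k3 k4.
  move: (Dc _ eps) (Dc _ eps) (Dc _ eps) (Dc _ eps) (Dc _ eps) (Dc _ eps) (Dc _ eps) (Dc _ eps)
    => d1 d2 d3 d4 d5 d6 d7 d8; ring.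
- apply: ccvgD; last exact: lim (seg_abel _ sF r0).
  apply: ccvgB; last exact: lim (seg_abel _ sF r0).
  apply: ccvgB; last exact: lim (arcT 3).
  apply: ccvgB; last exact: lim (arcT 1).
  apply: ccvgD; last exact: lim h2.
  apply: ccvgN; exact: lim h1.
Qed.

(** The same deformation into the lower half plane, where sector 5 lies between
    sectors 4 and 6.  Here both halves of the real axis bound a sector into
    which the contour turns, so convergence on the axis is a conclusion. *)
Lemma deform_neg F (rho y kappa : R) : superp setT F -> 0 <= rho -> 0 < y ->
  kappa < 0 -> grows (sector_lo 4) (sector_hi 4) 0 (y / kappa) F ->
  grows (sector_lo 6) (sector_hi 6) 0 (y / kappa) F ->
  exists l, is_curve_integral real_line F (- l) /\
    is_curve_integral (sector_boundary rho 5) F l.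
Proof.
move=> sF r0 y0 k0 g4 g6.
have kn0 : kappa != 0 by rewrite lt_eqF.
have ab j : j \in [:: 4; 5; 6]%N -> above kappa j.
  by rewrite /above ltNge (ltW k0).
have [l4 [m4 [h4 h4' _ e4]]] := sector_rotation sF r0 y0 kn0 (ab 4%N isT) (@subsetT _ _)
  (grows_sub r0 g4).
have [l6 [m6 [h6 h6' _ e6]]] := sector_rotation sF r0 y0 kn0 (ab 6%N isT) (@subsetT _ _)
  (grows_sub r0 g6).
have [p4 [q4 [z4 _ _ _]]] := sector_rotation sF (lexx 0) y0 kn0 (ab 4%N isT) (@subsetT _ _) g4.
have [p6 [q6 [_ z6 _ _]]] := sector_rotation sF (lexx 0) y0 kn0 (ab 6%N isT) (@subsetT _ _) g6.
have arcT j := abel_arc (a := sector_lo j) (b := sector_hi j) sF r0 (fun th _ => I).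
rewrite sector_lo4 in h4 z4; rewrite sector_hi6 ray_2pi in h6'; rewrite sector_hi6 ray_2pi in z6.
have mray th : measurableR (dom (ray rho th)) by exact: measurable_itv.
have marc a b : measurableR (dom (arc rho a b)) by exact: measurable_itv.
have mseg th : measurableR (dom (seg rho th)) by exact: measurable_itv.
exists (- l6 + (- arcint F rho (sector_lo 5) (sector_hi 5) + m4)); split; last first.
  apply: abel_is_curve_integral.
  exact: (abel_cat (abel_opp1 (mray _) h6) (abel_cat (abel_opp1 (marc _ _) (arcT 5%N)) h4')).
have cut := abel_is_curve_integral (abel_cat (seg_abel 0 sF r0) (abel_cat h6'
  (abel_cat (abel_opp1 (mseg _) (seg_abel pi sF r0)) (abel_opp1 (mray _) h4)))).
apply: (ici_transfer (r := fun=> 0) cut _ (ccvg_cst 0)).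
  move=> eps e0; have [il _] := line_of_rays (z6.1 eps e0) (z4.1 eps e0).
  have [_ ec] := cut_line_integral r0 il.
  by split => //; rewrite addr0 -ec.
have d4 := disc_sector 4 sF r0; have d5 := disc_sector 5 sF r0.
have d6 := disc_sector 6 sF r0; rewrite sector_lo4 in d4 e4.
rewrite sector_hi6 segint_2pi in d6; rewrite sector_hi6 in e6.
rewrite addr0 e4 e6 -d4 -d5 -d6.
rewrite -[sector_lo 5]/(sector_hi 4) -[sector_lo 6]/(sector_hi 5); ring.
Qed.

End Deformation.

(** * Fourier inversion on a half line *)

Section PoissonInversion.
Context {R : realType}.
Local Notation mu := (@lebesgue_measure R).

Lemma cintegral_itv_oo (a b : R) (u : R -> R[i]) : cintegrable `[a, b] u ->
  cintegral `]a, b[ u = cintegral `[a, b] u.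
Proof.
move=> iu; have m1 : measurableR `[a, b] by exact: measurable_itv.
have m2 : measurableR `]a, b[ by exact: measurable_itv.
have m3 : measurableR `[a, b[ by exact: measurable_itv.
have s2 : (`]a, b[%classic : set R) `<=` `[a, b]%classic.
  by move=> x; rewrite /= !in_itv /= => /andP[/ltW -> /ltW ->].
have s3 : (`[a, b[%classic : set R) `<=` `[a, b]%classic.
  by move=> x; rewrite /= !in_itv /= => /andP[-> /ltW ->].
have [i1 i2] := cintegrableS m1 m2 s2 iu; have [j1 j2] := cintegrableS m1 m3 s3 iu.
by rewrite /cintegral !(Rintegral_itv_obnd_cbnd i1, Rintegral_itv_obnd_cbnd i2)
  !(Rintegral_itv_bndo_bndc j1, Rintegral_itv_bndo_bndc j2).
Qed.

Lemma atan_bound (x : R) : `|2 * atan x| <= pi.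
Proof.
have h1 := atan_gtNpi2 x; have h2 := atan_ltpi2 x.
by rewrite ler_norml; apply/andP; split; lra.
Qed.

Lemma cvg_div_at_right (a : R) (u : nat -> R) : 0 < a ->
  (forall n, 0 < u n) -> u n @[n --> \oo] --> (0 : R) -> a / u n @[n --> \oo] --> +oo.
Proof.
move=> a0 u0 uc; apply/cvgryPge => A.
have d0 : 0 < a / (`|A| + 1) by rewrite divr_gt0 // ltr_wpDl.
near=> n.
have h : `|u n| <= a / (`|A| + 1).
  by near: n; exact: (cvgr0_norm_le _ uc _ d0).
rewrite ler_pdivlMr //.
have A1 : 0 < `|A| + 1 by rewrite ltr_wpDl.
rewrite ler_pdivlMr // gtr0_norm // in h.
apply: le_trans h; rewrite mulrC ler_pM2l //.
by rewrite (le_trans (ler_norm _)) // lerDl.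
Unshelve. all: by end_near. Qed.

Lemma ccvg_near_eq (f g : R -> R[i]) l : (forall e, 0 < e -> f e = g e) ->
  ccvg f (0^'+) l -> ccvg g (0^'+) l.
Proof.
move=> fg [h1 h2].
have near_eq : \forall e \near 0^'+, f e = g e.
  by near=> e; apply: fg; near: e; exact: nbhs_right_gt.
split.
  by apply: cvg_trans h1; apply: near_eq_cvg; apply: filterS near_eq => e ->.
by apply: cvg_trans h2; apply: near_eq_cvg; apply: filterS near_eq => e ->.
Unshelve. all: by end_near. Qed.

(** The sign [c] tells on which side of [y] the set [D] lies: there
    [2 atan ((x - y) / eps)] tends to [c pi]. *)
Let atan_limit (D : set R) (g : R -> R[i]) (y c : R) : measurableR D ->
  cintegrable D g -> c * c = 1 -> (forall x, D x -> 0 < c * (x - y)) ->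
  ccvg (fun eps => cintegral D (fun x => (2 * atan ((x - y) / eps) - c * pi)%:C * g x))
    (0^'+) 0.
Proof.
move=> mD ig cc hD.
have signE (x e : R) : 2 * atan ((x - y) / e) - c * pi =
    c * (2 * atan (c * (x - y) / e) - pi).
  have : (c - 1) * (c + 1) = 0 by rewrite -subr_sqr expr2 cc expr1n subrr.
  move=> /eqP; rewrite mulf_eq0 => /orP[]; rewrite ?subr_eq0 ?addr_eq0 => /eqP ->.
    by rewrite !mul1r.
  by rewrite !mulN1r mulNr atanN; ring.
have real (h : R -> R) : mu.-integrable D (EFin \o h) ->
    Rintegral mu D (fun x => (2 * atan ((x - y) / e) - c * pi) * h x) @[e --> 0^'+] --> (0 : R).
  move=> ih; apply/cvg_at_rightP => u [u0 uc].
  rewrite -[X in _ --> X](_ : Rintegral mu D (fun=> 0) = 0); last first.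
    by rewrite /Rintegral integral0.
  have mh : measurable_fun (D : set (measurableTypeR R)) h.
    by apply/measurable_EFinP; exact: measurable_int ih.
  apply: (@Rintegral_dominated _ _ _ _ (fun x => (`|c| * (2 * pi)) * `|h x|)) => //.
  - move=> n; apply: measurable_funM => //.
    apply: (@measurable_funS _ _ _ _ setT) => //.
    apply: continuous_measurable_fun => x.
    apply: cvgB; last exact: cvg_cst.
    apply: cvgMr; apply: (continuous_comp (f := fun x => (x - y) / u n)).
      by apply: cvgMl; apply: cvgB; [exact: cvg_id|exact: cvg_cst].
    exact: continuous_atan.
  - move=> x Dx.
    have lim : c * (2 * atan (c * (x - y) / u n) - pi) @[n --> \oo] --> (0 : R).
      rewrite -[X in _ --> X](_ : c * (2 * (pi / 2) - pi) = 0); last by field.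
      apply: cvgMr; apply: cvgB; last exact: cvg_cst.
      apply: cvgMr.
      exact: (cvg_comp _ _ (cvg_div_at_right (hD x Dx) u0 uc) (@cvgy_atan R)).
    rewrite -[X in _ --> X](mul0r (h x)).
    rewrite (_ : (fun n : nat => _) = (fun n : nat =>
      (c * (2 * atan (c * (x - y) / u n) - pi)) * h x)); last first.
      by apply/funext => n; rewrite signE.
    exact: cvgMl.
  - have := integrableZl mD (`|c| * (2 * pi)) (integrable_norm ih).
    exact: eq_integrable.
  - move=> n x Dx; rewrite signE !normrM -mulrA -[leRHS]mulrA; apply: ler_wpM2l => //.
    apply: ler_wpM2r => //; rewrite (le_trans (ler_normB _ _)) //.
    rewrite [leRHS](_ : _ = pi + pi); last by ring.
    by rewrite lerD ?atan_bound // ger0_norm // pi_ge0.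
case: ig => i1 i2; split.
  rewrite (_ : (fun _ => _) = (fun e => Rintegral mu D
    (fun x => (2 * atan ((x - y) / e) - c * pi) * Re (g x)))).
    exact: real.
  apply/funext => e; apply: eq_Rintegral => x _.
  by rewrite ReM ReC ImC mul0r subr0.
rewrite (_ : (fun _ => _) = (fun e => Rintegral mu D
  (fun x => (2 * atan ((x - y) / e) - c * pi) * Im (g x)))).
  exact: real.
apply/funext => e; apply: eq_Rintegral => x _.
by rewrite ImM ReC ImC mul0r addr0.
Qed.

Variables (v v' : R -> R[i]) (M : R).
Hypothesis dv : forall y, cder v y (v' y).
Hypothesis dv' : forall y, exists d, cder v' y d.
Hypothesis vM : forall y, 0 <= y -> normc (v y) <= M * (1 + y ^+ 2)^-1.
Hypothesis v'M : forall y, 0 <= y -> normc (v' y) <= M * (1 + y ^+ 2)^-1.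

Let cv (i : interval R) : ccont_on [set` i] v.
Proof. by apply: cderiv_ccont_itv => x _; exists (v' x); exact: dv. Qed.
Let cv' (i : interval R) : ccont_on [set` i] v'.
Proof. by apply: cderiv_ccont_itv => x _; exact: dv'. Qed.

Let m0 : measurableR `[(0 : R), +oo[. Proof. exact: measurable_itv. Qed.

Let ibound : mu.-integrable `[0, +oo[ (EFin \o (fun y : R => M * (1 + y ^+ 2)^-1)).
Proof.
have := integrableZl m0 M integrable_invDsqr; exact: eq_integrable.
Qed.

Let i_v' : cintegrable `[0, +oo[ v'.
Proof.
apply: (cintegrable_dom m0 (ccont_on_cmeas m0 (cv' _)) ibound) => y.
by rewrite /= in_itv /= andbT; exact: v'M.
Qed.

Let v_harmonic (y : R) (n : nat) : 0 <= y ->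
  normc (v (y + n%:R)) <= `|M| * (n.+1%:R)^-1.
Proof.
move=> y0.
apply: (le_trans (vM _)); first by rewrite addr_ge0.
apply: (@le_trans _ _ (`|M| * (1 + (y + n%:R) ^+ 2)^-1)).
  by apply: ler_wpM2r; [rewrite invr_ge0 addr_ge0 ?sqr_ge0|exact: ler_norm].
apply: ler_wpM2l => //; rewrite lef_pV2 ?posrE ?ltr0n //; last first.
  by rewrite ltr_wpDr ?sqr_ge0.
rewrite -natr1 addrC lerD2l.
case: n => [|n]; first by rewrite sqr_ge0.
apply: (@le_trans _ _ (y + n.+1%:R)); first by rewrite lerDr.
rewrite expr2 ler_peMr ?addr_ge0 //.
by rewrite (@le_trans _ _ n.+1%:R) ?ler1n // lerDr.
Qed.

Definition poisson (eps u : R) : R := 2 * eps / (eps ^+ 2 + u ^+ 2).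

Let poisson_den (eps u : R) : 0 < eps -> 0 < eps ^+ 2 + u ^+ 2.
Proof. by move=> e0; rewrite ltr_wpDr ?sqr_ge0 // exprn_gt0. Qed.

Let derive_atan (eps y x : R) : 0 < eps ->
  is_derive x (1 : R) (fun x => 2 * atan ((x - y) / eps)) (poisson eps (x - y)).
Proof.
move=> e0.
have h : is_derive x (1 : R) (fun x => (x - y) / eps) eps^-1.
  apply: is_derive_ext (is_deriveZ eps^-1 (is_deriveB (is_derive_id x 1) (is_derive_cst y x 1))) => [s|].
    by rewrite /GRing.scale /= mulrC.
  by rewrite subr0 /GRing.scale /= mulr1.
apply: is_derive_ext (is_deriveZ 2 (is_derive1_comp (is_derive1_atan _) h)) => //.
rewrite /poisson /GRing.scale /=.
have e1 : eps != 0 by rewrite gt_eqF.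
have d0 : eps ^+ 2 + (x - y) ^+ 2 != 0 by rewrite gt_eqF // poisson_den.
have d1 : 1 + ((x - y) / eps) ^+ 2 != 0 by rewrite gt_eqF // ltr_wpDr ?sqr_ge0.
by field; rewrite e1 d0.
Qed.

Let cder_atan_mul (eps y c x : R) : 0 < eps ->
  cder (fun x => (2 * atan ((x - y) / eps) - c)%:C * v x) x
   ((poisson eps (x - y))%:C * v x + (2 * atan ((x - y) / eps) - c)%:C * v' x).
Proof.
move=> e0; apply: cderM; last exact: dv.
apply: cder_real; apply: is_derive_ext (is_deriveB (derive_atan y x e0) (is_derive_cst c x 1)) => //.
by rewrite subr0.
Qed.

Let poisson_meas (D : set R) (eps y : R) : 0 < eps ->
  measurable_fun (D : set (measurableTypeR R)) (fun x => poisson eps (x - y)).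
Proof.
move=> e0; apply: (@measurable_funS _ _ _ _ setT) => //.
apply: continuous_measurable_fun => x; apply: cvgMr.
apply: cvgV; first by rewrite gt_eqF // poisson_den.
apply: cvgD; first exact: cvg_cst.
apply: (@continuous_comp _ _ _ (fun x => x - y) (fun u => u ^+ 2)).
  by apply: cvgB; [exact: cvg_id|exact: cvg_cst].
exact: exprn_continuous.
Qed.

Let atan_meas (D : set R) (eps y c : R) :
  measurable_fun (D : set (measurableTypeR R)) (fun x => 2 * atan ((x - y) / eps) - c).
Proof.
apply: (@measurable_funS _ _ _ _ setT) => //.
apply: continuous_measurable_fun => x.
apply: cvgB; last exact: cvg_cst.
apply: cvgMr; apply: (continuous_comp (f := fun x => (x - y) / eps)).
  by apply: cvgMl; apply: cvgB; [exact: cvg_id|exact: cvg_cst].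
exact: continuous_atan.
Qed.

Let poisson_le (eps u : R) : 0 < eps -> `|poisson eps u| <= 2 / eps.
Proof.
move=> e0; have d0 := poisson_den u e0.
rewrite /poisson ger0_norm; last by rewrite divr_ge0 ?(ltW d0) // mulr_ge0 // ltW.
rewrite ler_pdivrMr // mulrDr -[leLHS]addr0 lerD //; last first.
  by rewrite mulr_ge0 ?sqr_ge0 // divr_ge0 // ltW.
by rewrite le_eqVlt; apply/orP; left; apply/eqP; field; rewrite gt_eqF.
Qed.

Lemma poisson_mul_integrable (y eps : R) : 0 < eps ->
  cintegrable `[0, +oo[ (fun x => (poisson eps (x - y))%:C * v x).
Proof.
move=> e0; have := integrableZl m0 (2 / eps) ibound => ib.
apply: (cintegrable_dom (g := fun x => 2 / eps * (M * (1 + x ^+ 2)^-1)) m0).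
- apply: cmeasM; last exact: (ccont_on_cmeas m0 (cv _)).
  by apply: cmeas_real; exact: poisson_meas.
- exact: eq_integrable ib.
- move=> x hx; have x0 : 0 <= x by move: hx; rewrite /= in_itv /= andbT.
  rewrite normcM normcC.
  apply: ler_pM; [exact: normr_ge0|exact: normc_ge0|exact: poisson_le|exact: vM].
Qed.

Let i_av (eps y c : R) :
  cintegrable `[0, +oo[ (fun x => (2 * atan ((x - y) / eps) - c)%:C * v' x).
Proof.
have := integrableZl m0 (pi + `|c|) ibound => ib.
apply: (cintegrable_dom (g := fun x => (pi + `|c|) * (M * (1 + x ^+ 2)^-1)) m0).
- apply: cmeasM; last exact: (ccont_on_cmeas m0 (cv' _)).
  by apply: cmeas_real; exact: atan_meas.
- exact: eq_integrable ib.
- move=> x hx; have x0 : 0 <= x by move: hx; rewrite /= in_itv /= andbT.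
  rewrite normcM normcC.
  apply: ler_pM; [exact: normr_ge0|exact: normc_ge0| |exact: v'M].
  by rewrite (le_trans (ler_normB _ _)) // lerD // atan_bound.
Qed.

(** The Poisson kernel is the derivative of [2 atan ((x - y) / eps)], which tends
    to [pi] times the sign of [x - y].  Integrating by parts on each side of
    [y], with the primitive that vanishes in the limit, leaves the boundary
    terms at [y]. *)
Lemma poisson_limit (y : R) : 0 < y ->
  ccvg (fun eps => cintegral `[0, +oo[ (fun x => (poisson eps (x - y))%:C * v x))
    (0^'+) ((2 * pi)%:C * v y).
Proof.
move=> y0.
have m1 : measurableR `[(0 : R), y] by exact: measurable_itv.
have m1' : measurableR `](0 : R), y[ by exact: measurable_itv.
have m2 : measurableR `[y, +oo[ by exact: measurable_itv.
have m2' : measurableR `]y, +oo[ by exact: measurable_itv.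
have s1 : (`[0, y]%classic : set R) `<=` `[0, +oo[%classic.
  by move=> x; rewrite /= !in_itv /= andbT => /andP[].
have s2 : (`[y, +oo[%classic : set R) `<=` `[0, +oo[%classic.
  by move=> x; rewrite /= !in_itv /= !andbT; apply: le_trans; exact: ltW.
have s1' : (`]0, y[%classic : set R) `<=` `[0, +oo[%classic.
  by move=> x; rewrite /= !in_itv /= andbT => /andP[/ltW].
have s2' : (`]y, +oo[%classic : set R) `<=` `[0, +oo[%classic.
  by move=> x; rewrite /= !in_itv /= !andbT => h; exact: ltW (lt_trans y0 h).
pose E1 eps := cintegral `]0, y[ (fun x => (2 * atan ((x - y) / eps) - (-1) * pi)%:C * v' x).
pose E2 eps := cintegral `]y, +oo[ (fun x => (2 * atan ((x - y) / eps) - 1 * pi)%:C * v' x).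
have l1 : ccvg E1 (0^'+) 0.
  apply: (atan_limit m1' (cintegrableS m0 m1' s1' i_v')); first by rewrite mulrNN mulr1.
  move=> x; rewrite /= in_itv /= => /andP[_ xy].
  by rewrite mulN1r opprB subr_gt0.
have l2 : ccvg E2 (0^'+) 0.
  apply: (atan_limit m2' (cintegrableS m0 m2' s2' i_v')); first by rewrite mulr1.
  by move=> x; rewrite /= in_itv /= andbT => xy; rewrite mul1r subr_gt0.
have l3 : ccvg (fun eps => (2 * atan (- y / eps) + pi)%:C * v 0) (0^'+) 0.
  rewrite -(mul0r (v 0)); apply: ccvgM; last exact: ccvg_cst.
  split => /=; last exact: cvg_cst.
  apply/cvg_at_rightP => u [u0 uc].
  rewrite (_ : (fun n : nat => _) = (fun n : nat => pi - 2 * atan (y / u n))); last first.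
    by apply/funext => n; rewrite mulNr atanN; ring.
  rewrite -[X in _ --> X](_ : pi - 2 * (pi / 2) = 0); last by field.
  apply: cvgB; first exact: cvg_cst.
  apply: cvgMr.
  exact: (cvg_comp _ _ (cvg_div_at_right y0 u0 uc) (@cvgy_atan R)).
have formula eps : 0 < eps ->
    cintegral `[0, +oo[ (fun x => (poisson eps (x - y))%:C * v x) =
    (2 * pi)%:C * v y - (2 * atan (- y / eps) + pi)%:C * v 0 - E1 eps - E2 eps.
  move=> e0; rewrite (half_line_split (ltW y0) (poisson_mul_integrable y e0)).
  have p1 := cintegrableS m0 m1 s1 (poisson_mul_integrable y e0).
  have p2 := cintegrableS m0 m2 s2 (poisson_mul_integrable y e0).
  have a1 := cintegrableS m0 m1 s1 (i_av eps y (-1 * pi)).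
  have a2 := cintegrableS m0 m2 s2 (i_av eps y (1 * pi)).
  have cc (i : interval R) c : ccont_on [set` i] (fun x =>
      (poisson eps (x - y))%:C * v x + (2 * atan ((x - y) / eps) - c)%:C * v' x).
    apply: cderiv_ccont_itv => x _.
    have [d hd] := dv' x.
    have dp : cder (fun x => (poisson eps (x - y))%:C) x
        (- (2 * eps) * (eps ^+ 2 + (x - y) ^+ 2) ^- 2 * (2 * (x - y)))%:C.
      apply: cder_real.
      have hd1 : is_derive x (1 : R) (fun x => eps ^+ 2 + (x - y) ^+ 2) (2 * (x - y)).
        have b := is_deriveB (is_derive_id x (1 : R)) (is_derive_cst y x (1 : R)).
        apply: is_derive_ext (is_deriveD (is_derive_cst (eps ^+ 2) x (1 : R)) (is_deriveM b b)) => [s|].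
          by rewrite /= expr2.
        by rewrite /GRing.scale /= subr0 add0r !mulr1 mulr_natl.
      have nz : eps ^+ 2 + (x - y) ^+ 2 != 0 by rewrite gt_eqF // poisson_den.
      have hV := @is_deriveV R (fun x => eps ^+ 2 + (x - y) ^+ 2) x _ _ nz hd1.
      apply: is_derive_ext (is_deriveM (is_derive_cst (2 * eps) x (1 : R)) hV) => //.
      by rewrite /GRing.scale /= mulr0 addr0 !mulNr mulrN mulrA.
    have da : cder (fun s => (2 * atan ((s - y) / eps) - c)%:C) x (poisson eps (x - y))%:C.
      apply: cder_real.
      apply: is_derive_ext (is_deriveB (derive_atan y x e0) (is_derive_cst c x 1)) => //.
      by rewrite subr0.
    eexists; apply: cderD.
      by apply: cderM; [exact: dp|exact: dv].
    by apply: cderM; [exact: da|exact: hd].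
  have cU (i : interval R) c : ccont_on [set` i] (fun x => (2 * atan ((x - y) / eps) - c)%:C * v x).
    by apply: cderiv_ccont_itv => x _; eexists; exact: (cder_atan_mul y c x e0).
  have f1 := cFTC (ltW y0) (cc `[0, y] (-1 * pi)) (cU _ (-1 * pi)) (fun x _ => cder_atan_mul y _ x e0).
  have lim0 : ccvg (fun n : nat => (2 * atan ((y + n%:R - y) / eps) - 1 * pi)%:C *
      v (y + n%:R)) \oo 0.
    apply: (ccvg0 (g := fun n : nat => (pi + `|1 * pi|) * (`|M| * (n.+1%:R)^-1))) => [n|].
      rewrite normcM normcC.
      apply: ler_pM; [exact: normr_ge0|exact: normc_ge0| |exact: v_harmonic (ltW y0)].
      by rewrite (le_trans (ler_normB _ _)) // lerD // atan_bound.
    rewrite -[X in _ --> X](mulr0 (pi + `|1 * pi|)); apply: cvgMr.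
    rewrite -[X in _ --> X](mulr0 `|M|); apply: cvgMr.
    exact: cvg_harmonic.
  have f2 := cFTCy (cintegrableD m2 p2 a2) (cc _ (1 * pi)) (cU _ (1 * pi))
    (fun x _ => cder_atan_mul y _ x e0) lim0.
  rewrite (cintegralD m1 p1 a1) in f1; rewrite (cintegralD m2 p2 a2) in f2.
  rewrite (canRL (addrK _) f1) (canRL (addrK _) f2).
  rewrite -(cintegral_itv_oo a1) -(cintegral_obnd a2) -/(E1 eps) -/(E2 eps).
  have -> : (y - y) / eps = 0 by rewrite subrr mul0r.
  have -> : (0 - y) / eps = - y / eps by rewrite sub0r.
  rewrite atan0 mulr0 mulN1r mul1r opprK !sub0r !add0r !realCD !realCN.
  rewrite realCM; ring.
apply: (ccvg_near_eq (fun eps e0 => esym (formula eps e0))).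
rewrite -[X in ccvg _ _ X]subr0 -[X in ccvg _ _ (X - 0)]subr0 -[X in ccvg _ _ (X - 0 - 0)]subr0.
apply: ccvgB l2; apply: ccvgB l1; apply: ccvgB l3; exact: ccvg_cst.
Qed.

End PoissonInversion.

Section FourierInversion.
Context {R : realType}.
Local Notation mu := (@lebesgue_measure R).

Definition half_fourier (v : R -> R[i]) (k : R[i]) : R[i] :=
  cintegral `]0, +oo[ (fun y => cexp (- (ii * k * y%:C)) * v y).

Let m0 : measurableR `[(0 : R), +oo[. Proof. exact: measurable_itv. Qed.
Let m0' : measurableR `](0 : R), +oo[. Proof. exact: measurable_itv. Qed.

Lemma cintegral_exp (c : R[i]) : Re c < 0 ->
  cintegrable `[0, +oo[ (fun s : R => cexp (s%:C * c)) /\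
  cintegral `[0, +oo[ (fun s : R => cexp (s%:C * c)) = - c^-1.
Proof.
move=> c0; have cn0 : c != 0.
  by apply/eqP => e; move: c0; rewrite e ltxx.
have d (s : R) : cder (fun s => cexp (s%:C * c)) s (cexp (s%:C * c) * c).
  apply: cder_cexp; apply: cder_ext (cderM (cder_id s) (cder_cst s c)) => //.
  by rewrite mul1r mulr0 addr0.
have cu (i : interval R) : ccont_on [set` i] (fun s : R => cexp (s%:C * c)).
  by apply: cderiv_ccont_itv => s _; eexists; exact: d.
have ns (s : R) : normc (cexp (s%:C * c)) = expR (- (- Re c) * s).
  by rewrite normc_cexp ReM ReC ImC mul0r subr0 opprK mulrC.
have cp : 0 < - Re c by rewrite oppr_gt0.
have ii1 : cintegrable `[0, +oo[ (fun s : R => cexp (s%:C * c)).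
  apply: (cintegrable_dom m0 (ccont_on_cmeas m0 (cu _)) (integrable_expR_decay 0 cp)) => s _.
  by rewrite ns.
split => //.
have dU (s : R) : cder (fun s => cexp (s%:C * c) * c^-1) s (cexp (s%:C * c)).
  apply: cder_ext (cderM (d s) (cder_cst s c^-1)) => //.
  by rewrite mulr0 addr0 -mulrA divff // mulr1.
have cU : ccont_on `[0, +oo[ (fun s : R => cexp (s%:C * c) * c^-1).
  by apply: cderiv_ccont_itv => s _; eexists; exact: dU.
rewrite (cFTCy (L := 0) ii1 (cu _) cU (fun s _ => dU s)).
  by rewrite sub0r realC0 mul0r cexp0 mul1r.
apply: (ccvg0 (g := fun n : nat => expR (- (- Re c) * (0 + n%:R)) * normc c^-1)) => [n|].
  by rewrite normcM ns.
rewrite -[X in _ --> X](mul0r (normc c^-1)); apply: cvgMl.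
exact: cvg_expR_decay.
Qed.

Let damp (eps s : R) : R[i] := (expR (- eps * `|s|))%:C.

Let poisson_kernel (eps a : R) : 0 < eps ->
  cintegrable setT (fun s : R => damp eps s * cexp (ii * s%:C * a%:C)) /\
  cintegral setT (fun s : R => damp eps s * cexp (ii * s%:C * a%:C)) =
    (poisson eps a)%:C.
Proof.
move=> e0.
pose c (b : R) := (- eps)%:C + ii * b%:C : R[i].
have rc b : Re (c b) = - eps by rewrite /c !reimE mul0r mulr0 subr0 addr0.
have rc0 b : Re (c b) < 0 by rewrite rc oppr_lt0.
have [i1 e1] := cintegral_exp (rc0 a); have [i2 e2] := cintegral_exp (rc0 (- a)).
have p1 s : (`[0, +oo[%classic : set R) s ->
    cexp (s%:C * c a) = damp eps s * cexp (ii * s%:C * a%:C).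
  move=> hs; have s0 : 0 <= s by move: hs; rewrite /= in_itv /= andbT.
  rewrite /damp ger0_norm // -cexpC -cexpD; congr cexp.
  by rewrite /c realCM; ring.
have p2 s : (`[0, +oo[%classic : set R) s ->
    cexp (s%:C * c (- a)) = damp eps (- s) * cexp (ii * (- s)%:C * a%:C).
  move=> hs; have s0 : 0 <= s by move: hs; rewrite /= in_itv /= andbT.
  rewrite /damp normrN ger0_norm // -cexpC -cexpD; congr cexp.
  by rewrite /c !realCN realCM realCN; ring.
have j1 := cintegrable_eq m0 p1 i1; have j2 := cintegrable_eq m0 p2 i2.
have jl := line_join j1 j2.
split => //; have [_ _ ->] := line_split jl.
rewrite -(cintegral_eq p1) -(cintegral_eq p2) e1 e2.
have d0 : eps ^+ 2 + a ^+ 2 != 0.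
  by rewrite gt_eqF // ltr_wpDr ?sqr_ge0 // exprn_gt0.
have cn b : c b != 0 by apply/eqP => h; have := rc0 b; rewrite h ltxx.
have prod : c a * c (- a) = (eps ^+ 2 + a ^+ 2)%:C.
  by rewrite /c realCD !realCX !realCN; ring: (@iiK R).
have sum : c a + c (- a) = - (2 * eps)%:C.
  by rewrite /c realCM !realCN; ring.
have e2eps : (2 * eps)%:C = - (c a + c (- a)) by rewrite sum opprK.
by rewrite /poisson realCM realCV -prod e2eps; field; rewrite !cn.
Qed.

Variables (v v' : R -> R[i]) (M : R).
Hypothesis dv : forall y, cder v y (v' y).
Hypothesis dv' : forall y, exists d, cder v' y d.
Hypothesis vM : forall y, 0 <= y -> normc (v y) <= M * (1 + y ^+ 2)^-1.
Hypothesis v'M : forall y, 0 <= y -> normc (v' y) <= M * (1 + y ^+ 2)^-1.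

(** By Fubini's theorem damping turns the inverse transform into a Poisson
    integral, to which [poisson_limit] applies. *)
Lemma half_fourier_inversion (y : R) : 0 < y ->
  is_curve_integral real_line (fun k => cexp (ii * k * y%:C) * half_fourier v k)
    ((2 * pi)%:C * v y).
Proof.
move=> y0; set F := (fun k => _).
have mv : cmeasR `]0, +oo[ v.
  by apply: ccont_on_cmeas m0' _; apply: cderiv_ccont_itv => x _; exists (v' x); exact: dv.
have ibound : mu.-integrable `[0, +oo[ (EFin \o (fun y : R => M * (1 + y ^+ 2)^-1)).
  by have := integrableZl m0 M integrable_invDsqr; exact: eq_integrable.
have sub : (`]0, +oo[%classic : set R) `<=` `[0, +oo[%classic.
  by move=> x; rewrite /= !in_itv /= !andbT => /ltW.
have ibound' := integrableS m0 m0' sub ibound.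
have xpos x : (`]0, +oo[%classic : set R) x -> 0 <= x.
  by rewrite /= in_itv /= andbT => /ltW.
have fub eps : 0 < eps -> cintegrable setT (fun s : R => damped eps F s%:C * 1) /\
    cintegral setT (fun s : R => damped eps F s%:C * 1) =
    cintegral `[0, +oo[ (fun x => (poisson eps (x - y))%:C * v x).
  move=> e0.
  have [id _] := poisson_kernel 0 e0.
  have idamp : mu.-integrable setT (EFin \o (fun s => expR (- eps * `|s|))).
    have [+ _] := id; apply: eq_integrable => // s _.
    by rewrite /comp /damp realC0 mulr0 cexp0 mulr1.
  pose K (z : measurableTypeR R * measurableTypeR R) : R[i] :=
    damp eps z.1 * cexp (ii * z.1%:C * y%:C) * (cexp (- (ii * z.1%:C * z.2%:C)) * v z.2).
  have mfst : cmeas (setT `*` (`](0 : R), +oo[%classic : set (measurableTypeR R)))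
      (fun z : measurableTypeR R * measurableTypeR R => (z.1%:C : R[i])).
    by apply: (cmeas_fst measurableT m0'); apply: cmeas_real; exact: measurable_id.
  have msnd : cmeas (setT `*` (`](0 : R), +oo[%classic : set (measurableTypeR R)))
      (fun z : measurableTypeR R * measurableTypeR R => (z.2%:C : R[i])).
    by apply: (cmeas_snd measurableT m0'); apply: cmeas_real; exact: measurable_id.
  have mK : cmeas (setT `*` (`](0 : R), +oo[%classic : set (measurableTypeR R))) K.
    apply: cmeasM; first apply: cmeasM.
    - apply: (cmeas_fst measurableT m0'); apply: cmeas_real.
      by apply/measurable_EFinP; exact: measurable_int idamp.
    - by apply: cmeas_cexp; apply: cmeasM; [exact: cmeasZ|exact: cmeas_cst].
    - apply: cmeasM; last exact: (cmeas_snd measurableT m0' mv).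
      by apply: cmeas_cexp; apply: cmeasN; apply: cmeasM; [exact: cmeasZ|].
  have Re0 (a b : R) : Re (ii * a%:C * b%:C) = 0.
    by rewrite !reimE !(mul0r, mulr0, subr0, addr0).
  have nK s x : normc (K (s, x)) = expR (- eps * `|s|) * normc (v x).
    have -> : K (s, x) = (expR (- eps * `|s|))%:C * cexp (ii * s%:C * y%:C) *
      (cexp (- (ii * s%:C * x%:C)) * v x) by [].
    rewrite normcM normcM (normcM (cexp _)) (normcC (expR _)) ger0_norm ?expR_ge0 //.
    by rewrite !normc_cexp ReN !Re0 oppr0 expR0 mulr1 mul1r.
  have Kb s x : setT s -> (`]0, +oo[%classic : set R) x ->
      normc (K (s, x)) <= expR (- eps * `|s|) * (M * (1 + x ^+ 2)^-1).
    move=> _ /xpos x0; rewrite nK; apply: ler_wpM2l; first exact: expR_ge0.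
    exact: vM.
  have [mF fubini] := cFubini measurableT m0' mK idamp ibound' Kb.
  have iV s : cintegrable `]0, +oo[ (fun x => cexp (- (ii * s%:C * x%:C)) * v x).
    apply: (cintegrable_dom m0' _ ibound') => [|x /xpos x0].
      apply: cmeasM; last exact: mv.
      apply: cmeas_cexp; apply: cmeasN; apply: cmeasZ.
      by apply: cmeas_real; exact: measurable_id.
    by rewrite normcM normc_cexp ReN Re0 oppr0 expR0 mul1r; exact: vM.
  have dE s : damped eps F s%:C = damp eps s * F s%:C by rewrite /damped (normcC s).
  have eF s : cintegral `]0, +oo[ (fun x => K (s, x)) = damped eps F s%:C * 1.
    rewrite mulr1 dE.
    have h := cintegralZ (damp eps s * cexp (ii * s%:C * y%:C)) m0' (iV s).
    apply: etrans h _; rewrite -mulrA; congr (_ * _).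
  have mF' : cmeasR setT (fun s : R => damped eps F s%:C * 1).
    by apply: cmeas_eq_on mF => s _; exact: eF.
  split.
    have := integrableZr measurableT (2 * Rintegral mu `]0, +oo[ (fun y => M * (1 + y ^+ 2)^-1)) idamp.
    move=> ib; apply: (cintegrable_dom measurableT mF' (g := fun s =>
      expR (- eps * `|s|) * (2 * Rintegral mu `]0, +oo[ (fun y => M * (1 + y ^+ 2)^-1)))).
      exact: eq_integrable ib.
    move=> s _; rewrite mulr1 dE normcM (normcC (expR _)) ger0_norm; last exact: expR_ge0.
    apply: ler_wpM2l; first exact: expR_ge0.
    rewrite /F normcM normc_cexp Re0 expR0 mul1r.
    apply: (normc_cintegral_le m0' (cintegrable_cmeas (iV s)) ibound') => x /xpos x0.
    rewrite normcM normc_cexp ReN Re0 oppr0 expR0 mul1r; exact: vM.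
  rewrite -(cintegral_eq (fun s _ => eF s)) fubini.
  have iv0 : cintegrable `[0, +oo[ (fun x => (poisson eps (x - y))%:C * v x).
    exact: (poisson_mul_integrable dv vM y e0).
  rewrite -(cintegral_obnd iv0); apply: cintegral_eq => x _.
  have [ik ek] := poisson_kernel (y - x) e0.
  have -> : poisson eps (x - y) = poisson eps (y - x).
    by rewrite /poisson -(sqrrN (x - y)) opprB.
  rewrite -ek [RHS]mulrC -(cintegralZ (v x) measurableT ik); apply: cintegral_eq => s _.
  have -> : K (s, x) = damp eps s * cexp (ii * s%:C * y%:C) *
    (cexp (- (ii * s%:C * x%:C)) * v x) by [].
  have -> : cexp (ii * s%:C * (y - x)%:C) =
    cexp (ii * s%:C * y%:C) * cexp (- (ii * s%:C * x%:C)) :> R[i].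
    by rewrite -cexpD realCB; congr cexp; ring.
  have assoc (A B C D : R[i]) : A * B * (C * D) = D * (A * (B * C)) by ring.
  exact: assoc.
split=> [eps e0|].
  apply/curve_integrable_cons; split; last exact: curve_integrable_nil.
  exact: (fub eps e0).1.
apply: ccvg_near_eq (poisson_limit dv dv' vM v'M y0) => eps e0.
by rewrite [RHS]curve_integral1; apply/esym; exact: (fub eps e0).2.
Qed.

End FourierInversion.

(** * The equation on a half line *)

Section TimeDependence.
Context {R : realType}.
Local Notation mu := (@lebesgue_measure R).

Lemma cder_of_remainder (u : R -> R[i]) (t0 : R) d :
  (forall e, 0 < e -> \forall t \near nbhs t0,
     normc (u t - u t0 - (t - t0)%:C * d) <= e * `|t - t0|) -> cder u t0 d.
Proof.
move=> h.
have real_part (f : R -> R) (a : R) : (forall e, 0 < e -> \forall t \near nbhs t0,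
     `|f t - f t0 - (t - t0) * a| <= e * `|t - t0|) -> is_derive t0 (1 : R) f a.
  move=> hf; have lim : (fun x => x^-1 *: ((f \o shift t0) (x *: (1 : R)) - f t0)) @ 0^' --> a.
    apply/cvgrPdist_le => e e0.
    have := hf e e0 => /nbhs_ballP[d' d0 hd].
    near=> x.
    have x0 : x != 0 by near: x; exact: nbhs_dnbhs_neq.
    have xd : ball t0 d' (x + t0).
      rewrite /ball /= opprD addrCA subrr addr0 normrN.
      by near: x; apply: dnbhs0_lt.
    have := hd _ xd; rewrite addrK /= /GRing.scale /= mulr1 => hx.
    rewrite -(ler_pM2r (x := `|x|)) ?normr_gt0 // -normrM.
    rewrite -normrN -mulNr opprB mulrBl mulrAC mulVf // mul1r [a * x]mulrC.
    exact: hx.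
  apply: DeriveDef; last exact: (cvg_lim _ lim).
  by apply/cvg_ex; exists a.
split; apply: real_part => e e0; have := h e e0; apply: filterS => t ht.
  apply: le_trans ht; have := Re_le_normc (u t - u t0 - (t - t0)%:C * d).
  by rewrite !reimE mul0r subr0.
apply: le_trans ht; have := Im_le_normc (u t - u t0 - (t - t0)%:C * d).
by rewrite !reimE mul0r addr0.
Unshelve. all: end_near. Qed.

(** The mean value theorem for the real and imaginary parts separately, whence the
    factor 2. *)
Lemma remainder_le (u u' : R -> R[i]) (t0 : R) d (e delta : R) :
  (forall t, `|t - t0| < delta -> cder u t (u' t)) ->
  (forall t, `|t - t0| < delta -> normc (u' t - d) <= e) ->
  forall t, `|t - t0| < delta ->
    normc (u t - u t0 - (t - t0)%:C * d) <= 2 * e * `|t - t0|.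
Proof.
move=> du ub t ht.
have real_part (f f' : R -> R) (a : R) :
    (forall s, `|s - t0| < delta -> is_derive s (1 : R) f (f' s)) ->
    (forall s, `|s - t0| < delta -> `|f' s - a| <= e) ->
    `|f t - f t0 - (t - t0) * a| <= e * `|t - t0|.
  move=> df fb.
  have in_ball lo hi s : `|lo - t0| < delta -> `|hi - t0| < delta -> lo <= s <= hi ->
      `|s - t0| < delta.
    rewrite !ltr_norml => /andP[a1 a2] /andP[b1 b2] /andP[c1 c2]; apply/andP; lra.
  have t00 : `|t0 - t0| < delta by rewrite subrr normr0 (le_lt_trans _ ht).
  have mvt lo hi : lo <= hi -> `|lo - t0| < delta -> `|hi - t0| < delta ->
      exists2 c, `|c - t0| < delta & f hi - f lo = f' c * (hi - lo).
    move=> lohi hlo hhi.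
    have inb s : s \in `[lo, hi] -> `|s - t0| < delta.
      by rewrite in_itv => /= hs; exact: in_ball hlo hhi hs.
    have [s sI||c cI ->] := @MVT_segment _ f f' lo hi lohi.
    - by apply: df; apply: inb; exact: subset_itv_oo_cc sI.
    - by apply: derivable_within_continuous => x xi; have [] := df x (inb x xi).
    - by exists c => //; exact: inb.
  have [le|lt] := leP t0 t.
    have [c hc ->] := mvt t0 t le t00 ht.
    by rewrite -mulrC -mulrBr normrM mulrC ler_wpM2r // fb.
  have [c hc e1] := mvt t t0 (ltW lt) ht t00.
  have -> : f t - f t0 - (t - t0) * a = (f' c - a) * (t - t0).
    by rewrite mulrBl -[f t - f t0]opprB e1; ring.
  by rewrite normrM ler_wpM2r // fb.
rewrite (le_trans (normc_le_ReIm _)) // -mulrA mulr2n mulrDl mul1r.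
apply: lerD.
  have := @real_part (fun s => Re (u s)) (fun s => Re (u' s)) (Re d)
    (fun s hs => (du s hs).1).
  rewrite !reimE mul0r subr0; apply => s hs.
  apply: le_trans (ub s hs).
  by have := Re_le_normc (u' s - d); rewrite !reimE.
have := @real_part (fun s => Im (u s)) (fun s => Im (u' s)) (Im d)
  (fun s hs => (du s hs).2).
rewrite !reimE mul0r addr0; apply => s hs.
apply: le_trans (ub s hs).
by have := Im_le_normc (u' s - d); rewrite !reimE.
Qed.

End TimeDependence.

Section ContinuousOn.
Context {R : realType}.
Implicit Types (D : set R) (u v : R -> R[i]).

Lemma ccont_onD D u v : ccont_on D u -> ccont_on D v -> ccont_on D (fun s => u s + v s).
Proof.
move=> [u1 u2] [v1 v2]; split=> s.
  rewrite (_ : (fun _ => _) = (fun s => Re (u s) + Re (v s))).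
    by apply: cvgD; [exact: u1|exact: v1].
  by apply/funext => x; rewrite ReD.
rewrite (_ : (fun _ => _) = (fun s => Im (u s) + Im (v s))).
  by apply: cvgD; [exact: u2|exact: v2].
by apply/funext => x; rewrite ImD.
Qed.

Lemma ccont_onM D u v : ccont_on D u -> ccont_on D v -> ccont_on D (fun s => u s * v s).
Proof.
move=> [u1 u2] [v1 v2]; split=> s.
  rewrite (_ : (fun _ => _) = (fun s => Re (u s) * Re (v s) - Im (u s) * Im (v s))).
    by apply: cvgB; apply: cvgM; [exact: u1|exact: v1|exact: u2|exact: v2].
  by apply/funext => x; rewrite ReM.
rewrite (_ : (fun _ => _) = (fun s => Re (u s) * Im (v s) + Im (u s) * Re (v s))).
  by apply: cvgD; apply: cvgM; [exact: u1|exact: v2|exact: u2|exact: v1].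
by apply/funext => x; rewrite ImM.
Qed.

Lemma ccont_on_cst D c : ccont_on D (fun=> c).
Proof. by split=> s; exact: cvg_cst. Qed.

Lemma ccont_onZ D c u : ccont_on D u -> ccont_on D (fun s => c * u s).
Proof. exact: ccont_onM (ccont_on_cst D c). Qed.

Lemma ccont_onB D u v : ccont_on D u -> ccont_on D v -> ccont_on D (fun s => u s - v s).
Proof.
move=> hu /(ccont_onZ (-1)) hv.
rewrite (_ : (fun s => u s - v s) = (fun s => u s + -1 * v s)); first exact: ccont_onD.
by apply/funext => s; rewrite mulN1r.
Qed.

End ContinuousOn.

Section HalfData.
Context {R : realType}.
Local Notation mu := (@lebesgue_measure R).

(** [w n t y] is the [n]-th [y]-derivative of the solution at time [t].  The three
    regularity fields are what differentiation under the integral sign, passage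
    to the boundary values and integrability of the transforms require. *)
Record half_data (kappa T : R) (w : nat -> R -> R -> R[i]) : Prop := {
  hd_der : forall n (t y : R), 0 <= t <= T -> cder (w n t) y (w n.+1 t y);
  hd_bound : forall n (t : R), 0 <= t <= T ->
    exists M, forall y, normc (w n t y) <= M * (1 + y ^+ 2)^-1;
  hd_cont : forall n (t0 : R), 0 <= t0 <= T -> 0 < t0 \/ (n <= 2)%N -> forall e, 0 < e ->
    \forall t \near within `[0, T] (nbhs t0), forall y, 0 < y ->
      normc (w n t y - w n t0 y) <= e * (1 + y ^+ 2)^-1;
  hd_pde : forall t y : R, 0 < t < T -> 0 < y ->
    cder (fun t => w 0 t y) t (kappa%:C ^+ 3 * w 3 t y) }.

Let m0 : measurableR `[(0 : R), +oo[. Proof. exact: measurable_itv. Qed.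
Let m0' : measurableR `](0 : R), +oo[. Proof. exact: measurable_itv. Qed.

Lemma normc_half_kernel k (y : R) : Im k <= 0 -> 0 <= y ->
  normc (cexp (- (ii * k * y%:C))) <= 1.
Proof.
move=> k0 y0; rewrite normc_cexp -[X in _ <= X]expR0 ler_expR.
rewrite !reimE !(mul0r, mulr0, mul1r, subr0, add0r, addr0, sub0r) mulNr opprK.
exact: mulr_le0_ge0.
Qed.

Lemma cmeas_half_kernel k (D : set R) : cmeasR D (fun y => cexp (- (ii * k * y%:C))).
Proof.
apply: cmeas_cexp; apply: cmeasN; apply: cmeasZ.
by apply: cmeas_real; exact: measurable_id.
Qed.

Let integrable_decay (c : R) :
  mu.-integrable `]0, +oo[ (EFin \o (fun y : R => c * (1 + y ^+ 2)^-1)).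
Proof.
have sub : (`]0, +oo[%classic : set R) `<=` `[0, +oo[%classic.
  by move=> x; rewrite /= !in_itv /= !andbT => /ltW.
apply: (integrableS m0 m0' sub).
by have := integrableZl m0 c integrable_invDsqr; exact: eq_integrable.
Qed.

Lemma integrable_decay_cbnd (c : R) :
  mu.-integrable `[0, +oo[ (EFin \o (fun y : R => c * (1 + y ^+ 2)^-1)).
Proof. by have := integrableZl m0 c integrable_invDsqr; exact: eq_integrable. Qed.

Let J : R := 2 * Rintegral mu `]0, +oo[ (fun y => (1 + y ^+ 2)^-1).

Let J_ge0 : 0 <= J.
Proof.
apply: mulr_ge0 => //; apply: Rintegral_ge0 => y _.
by rewrite invr_ge0 addr_ge0 // sqr_ge0.
Qed.

Lemma half_kernel_integrable (v : R -> R[i]) k (c : R) : Im k <= 0 -> cmeasR `]0, +oo[ v ->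
  (forall y, 0 < y -> normc (v y) <= c * (1 + y ^+ 2)^-1) ->
  cintegrable `]0, +oo[ (fun y => cexp (- (ii * k * y%:C)) * v y).
Proof.
move=> k0 mv vc; apply: (cintegrable_dom m0' _ (integrable_decay c)) => [|y hy].
  by apply: cmeasM; [exact: cmeas_half_kernel|exact: mv].
have y0 : 0 < y by move: hy; rewrite /= in_itv /= andbT.
rewrite normcM (le_trans _ (vc y y0)) // ler_piMl ?normc_ge0 //.
exact: normc_half_kernel k0 (ltW y0).
Qed.

Lemma half_fourier_le (v : R -> R[i]) k (c : R) : Im k <= 0 -> cmeasR `]0, +oo[ v ->
  (forall y, 0 < y -> normc (v y) <= c * (1 + y ^+ 2)^-1) ->
  normc (half_fourier v k) <= c * J.
Proof.
move=> k0 mv vc; have -> : c * J = 2 * Rintegral mu `]0, +oo[ (fun y => c * (1 + y ^+ 2)^-1).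
  rewrite RintegralZl; [by rewrite mulrCA|exact: m0'|].
  have := integrable_decay 1; apply: eq_integrable => // y _.
  by rewrite /= mul1r.
apply: (normc_cintegral_le m0' _ (integrable_decay c)) => [|y hy].
  by apply: cmeasM; [exact: cmeas_half_kernel|exact: mv].
have y0 : 0 < y by move: hy; rewrite /= in_itv /= andbT.
rewrite normcM (le_trans _ (vc y y0)) // ler_piMl ?normc_ge0 //.
exact: normc_half_kernel k0 (ltW y0).
Qed.

Variables (kappa T : R) (w : nat -> R -> R -> R[i]).
Hypothesis H : half_data kappa T w.

Lemma hd_ccont n t (i : interval R) : 0 <= t <= T -> ccont_on [set` i] (w n t).
Proof.
by move=> ht; apply: cderiv_ccont_itv => y _; exists (w n.+1 t y); exact: (hd_der H n y ht).
Qed.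

Lemma hd_cmeas n t : 0 <= t <= T -> cmeasR `]0, +oo[ (w n t).
Proof. by move=> ht; apply: ccont_on_cmeas m0' _; exact: hd_ccont. Qed.

Lemma hd_integrable n t k : 0 <= t <= T -> Im k <= 0 ->
  cintegrable `]0, +oo[ (fun y => cexp (- (ii * k * y%:C)) * w n t y).
Proof.
move=> ht k0; have [M hM] := hd_bound H n ht.
exact: (half_kernel_integrable k0 (hd_cmeas n ht) (fun y _ => hM y)).
Qed.

Lemma invDsqr_cvg (M : R) : (fun n : nat => M * (1 + n%:R ^+ 2)^-1 : R) @ \oo --> 0.
Proof.
rewrite -[X in _ --> X](mulr0 M); apply: cvgMr.
apply/cvgrPdist_le => e e0; near=> n.
rewrite sub0r normrN ger0_norm; last by rewrite invr_ge0 addr_ge0 // sqr_ge0.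
have h : e^-1 <= n%:R by near: n; exact: nbhs_infty_ger.
have e1 : 0 < e^-1 by rewrite invr_gt0.
rewrite -[leRHS]invrK lef_pV2; [|by rewrite posrE; exact: ltr_wpDr (sqr_ge0 _) ltr01|by rewrite posrE].
by apply: le_trans h _; nra.
Unshelve. all: end_near. Qed.

Lemma half_fourier_deriv n t k : 0 <= t <= T -> Im k <= 0 ->
  half_fourier (w n.+1 t) k = - w n t 0 + ii * k * half_fourier (w n t) k.
Proof.
move=> ht k0; pose E y : R[i] := cexp (- (ii * k * y%:C)).
have dE y : cder E y (E y * - (ii * k)).
  apply: cder_cexp; apply: cderN; apply: cder_ext (cderZ (ii * k) (cder_id y)) => //.
  exact: mulr1.
have dEw y : cder (fun y => E y * w n t y) y (- (ii * k) * (E y * w n t y) + E y * w n.+1 t y).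
  apply: cder_ext (cderM (dE y) (hd_der H n y ht)) => //.
  by congr (_ + _); rewrite mulrAC mulrC.
have i0 := hd_integrable n ht k0; have i1 := hd_integrable n.+1 ht k0.
have [M hM] := hd_bound H n ht.
have cE m (i : interval R) : ccont_on [set` i] (fun y => E y * w m t y).
  apply: cderiv_ccont_itv => y _; eexists.
  by apply: cderM; [exact: dE|exact: (hd_der H m y ht)].
have ci (m : nat) : cintegrable `[0, +oo[ (fun y => E y * w m t y).
  have [M' hM'] := hd_bound H m ht.
  apply: (cintegrable_dom m0 (ccont_on_cmeas m0 (cE m _)) (integrable_decay_cbnd M')) => y hy.
  have y0 : 0 <= y by move: hy; rewrite /= in_itv /= andbT.
  rewrite normcM (le_trans _ (hM' y)) // ler_piMl ?normc_ge0 //.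
  exact: normc_half_kernel k0 y0.
have f := cFTCy (L := 0) (cintegrableD m0 (cintegrableZ (- (ii * k)) m0 (ci n)) (ci n.+1)) _ (cE n _)
  (fun y _ => dEw y).
have {f} := f.
rewrite (cintegralD m0 (cintegrableZ (- (ii * k)) m0 (ci n)) (ci n.+1)) (cintegralZ _ m0 (ci n)).
rewrite -(cintegral_obnd (ci n)) -(cintegral_obnd (ci n.+1)).
rewrite -/(half_fourier (w n t) k) -/(half_fourier (w n.+1 t) k) => f.
apply: (addrI (- (ii * k) * half_fourier (w n t) k)); rewrite f.
- rewrite sub0r /E mulr0 oppr0 cexp0 mul1r mulNr [in RHS]addrCA addNr addr0 //.
- apply: cderiv_ccont_itv => y _; eexists.
  apply: cderD; first by apply: cderZ; exact: dEw.
  by apply: cderM; [exact: dE|exact: (hd_der H n.+1 y ht)].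
- apply: (ccvg0 (g := fun n : nat => M * (1 + n%:R ^+ 2)^-1)) => [j|]; last exact: invDsqr_cvg.
  rewrite add0r normcM (le_trans _ (hM _)) // ler_piMl ?normc_ge0 //.
  exact: normc_half_kernel k0 (ler0n _ _).
Qed.

(** Three integrations by parts; [(i k)^3 = - i k^3]. *)
Lemma half_fourier_deriv3 t k : 0 <= t <= T -> Im k <= 0 ->
  half_fourier (w 3 t) k =
    - (w 2 t 0 + ii * k * w 1 t 0 - k ^+ 2 * w 0 t 0) - ii * k ^+ 3 * half_fourier (w 0 t) k.
Proof.
move=> ht k0; rewrite !half_fourier_deriv //.
have -> : w 2 t 0 + ii * k * w 1 t 0 - k ^+ 2 * w 0 t 0 =
  w 2 t 0 + ii * k * w 1 t 0 + (ii * ii) * k ^+ 2 * w 0 t 0 by rewrite iiK mulN1r mulNr.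
have -> : ii * k ^+ 3 * half_fourier (w 0 t) k =
  - (ii * ii) * ii * k ^+ 3 * half_fourier (w 0 t) k by rewrite iiK opprK mul1r.
ring.
Qed.

Let half_fourierB (t s : R) n k : 0 <= t <= T -> 0 <= s <= T -> Im k <= 0 ->
  half_fourier (w n t) k - half_fourier (w n s) k =
  half_fourier (fun y => w n t y - w n s y) k.
Proof.
move=> ht hs k0; rewrite /half_fourier -(cintegralB m0' (hd_integrable n ht k0) (hd_integrable n hs k0)).
by apply: cintegral_eq => y _; rewrite mulrBr.
Qed.

(** By the equation and the mean value theorem the increments of [w 0 t y] are
    linear up to an error that is small uniformly against [(1 + y^2)^-1], hence
    after integration in [y]. *)
Lemma half_fourier_der_t (t0 : R) k : 0 < t0 < T -> Im k <= 0 ->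
  cder (fun t => half_fourier (w 0 t) k) t0 (kappa%:C ^+ 3 * half_fourier (w 3 t0) k).
Proof.
move=> ht0 k0; apply: cder_of_remainder => e e0.
have le0 s : 0 < s < T -> 0 <= s <= T by move=> /andP[/ltW-> /ltW].
have t0p : 0 < t0 by case/andP: ht0.
pose c := `|kappa| ^+ 3; have c0 : 0 <= c by exact: exprn_ge0.
pose e' := e / (2 * c * J + 1).
have den : 0 < 2 * c * J + 1 by apply: ltr_wpDl ltr01; apply: mulr_ge0 J_ge0; apply: mulr_ge0 c0.
have e'0 : 0 < e' by rewrite divr_gt0.
have := hd_cont H (le0 _ ht0) (or_introl t0p : _ \/ (3 <= 2)%N) e'0.
rewrite near_withinE => hc.
have hin : \forall t \near nbhs t0, 0 < t < T.
  have := @near_in_itvoo R 0 T t0; rewrite in_itv => /(_ ht0).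
  by apply: filterS => t; rewrite in_itv.
have nearI (P Q : set R) : nbhs t0 P -> nbhs t0 Q -> nbhs t0 (P `&` Q).
  by move=> hP hQ; exact: filterI.
have [delta d0 hd] := (nbhs_ballP t0 _).1 (nearI _ _ hc hin).
have near_t t : `|t - t0| < delta -> 0 < t < T /\ forall y, 0 < y ->
    normc (w 3 t y - w 3 t0 y) <= e' * (1 + y ^+ 2)^-1.
  move=> ht; have [|h1 h2] := hd t; first by rewrite /ball /= distrC.
  by split => //; apply: h1; rewrite /= in_itv; exact: le0.
apply/nbhs_ballP; exists delta => // t; rewrite /ball /= distrC => ht.
have [htT _] := near_t t ht.
have bound y : 0 < y -> normc (w 0 t y - w 0 t0 y - (t - t0)%:C * (kappa%:C ^+ 3 * w 3 t0 y)) <=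
    2 * c * e' * `|t - t0| * (1 + y ^+ 2)^-1.
  move=> y0; have := remainder_le (u := fun s => w 0 s y) (u' := fun s => kappa%:C ^+ 3 * w 3 s y)
    (d := kappa%:C ^+ 3 * w 3 t0 y) (e := c * e' * (1 + y ^+ 2)^-1) _ _ ht.
  have -> : 2 * c * e' * `|t - t0| * (1 + y ^+ 2)^-1 = 2 * (c * e' * (1 + y ^+ 2)^-1) * `|t - t0|.
    by ring.
  apply => s hs; have [hsT hsb] := near_t s hs; first exact: hd_pde H s y hsT y0.
  rewrite -mulrBr normcM normcX normcC -mulrA ler_wpM2l //.
  exact: hsb.
have ht' := le0 _ htT; have ht0' := le0 _ ht0.
have mw m s : 0 <= s <= T -> cmeasR `]0, +oo[ (w m s) by move=> hs; exact: hd_cmeas.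
have mrem : cmeasR `]0, +oo[ (fun y => w 0 t y - w 0 t0 y - (t - t0)%:C * (kappa%:C ^+ 3 * w 3 t0 y)).
  apply: cmeasB; first by apply: cmeasB; exact: mw.
  by apply: cmeasZ; apply: cmeasZ; exact: mw.
have := half_fourier_le k0 mrem bound.
have -> : half_fourier (fun y => w 0 t y - w 0 t0 y - (t - t0)%:C * (kappa%:C ^+ 3 * w 3 t0 y)) k =
    half_fourier (w 0 t) k - half_fourier (w 0 t0) k
    - (t - t0)%:C * (kappa%:C ^+ 3 * half_fourier (w 3 t0) k).
  pose E y : R[i] := cexp (- (ii * k * y%:C)).
  have i1 := hd_integrable 0 ht' k0; have i2 := hd_integrable 0 ht0' k0.
  have i3 := hd_integrable 3 ht0' k0.
  rewrite /half_fourier mulrA -(cintegralZ _ m0' i3) -(cintegralB m0' i1 i2).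
  rewrite -(cintegralB m0' (cintegrableB m0' i1 i2) (cintegrableZ _ m0' i3)).
  apply: cintegral_eq => y _; rewrite -/(E y); move: (E y) (w 0 t y) (w 0 t0 y) (w 3 t0 y) => A B C D.
  by ring.
move=> h; apply: le_trans h _.
have -> : 2 * c * e' * `|t - t0| * J = (2 * c * J) * e' * `|t - t0| by ring.
apply: ler_wpM2r; first exact: normr_ge0.
rewrite /e' mulrCA ger_pMr // ler_pdivrMr // mul1r lerDl //.
Qed.

Lemma half_fourier_cont_t k : Im k <= 0 ->
  ccont_on `[0, T] (fun t => half_fourier (w 0 t) k).
Proof.
move=> k0.
have key t0 : (`[0, T]%classic : set R) t0 -> forall e, 0 < e ->
    \forall t \near within `[0, T] (nbhs t0),
      normc (half_fourier (w 0 t0) k - half_fourier (w 0 t) k) <= e.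
  move=> ht0' e e0; have ht0 : 0 <= t0 <= T by move: ht0'; rewrite /= in_itv.
  pose e' := e / (J + 1); have den : 0 < J + 1 by exact: ltr_wpDl J_ge0 ltr01.
  have e'0 : 0 < e' by rewrite divr_gt0.
  have := hd_cont H ht0 (or_intror isT : _ \/ (0 <= 2)%N) e'0.
  rewrite !near_withinE; apply: filterS => t ht tT.
  have tT' : 0 <= t <= T by move: tT; rewrite /= in_itv.
  rewrite -normcNE opprB half_fourierB //.
  apply: le_trans (half_fourier_le k0 _ (ht tT)) _.
    by apply: cmeasB; exact: hd_cmeas.
  rewrite /e' mulrAC ler_pdivrMr //; apply: ler_wpM2l; first exact: ltW.
  by rewrite lerDl.
split; apply/subspace_continuousP => t0 ht0; apply/cvgrPdist_le => e e0;
  have := key t0 ht0 e e0; apply: filterS => t; apply: le_trans.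
  by have := Re_le_normc (half_fourier (w 0 t0) k - half_fourier (w 0 t) k); rewrite !reimE.
by have := Im_le_normc (half_fourier (w 0 t0) k - half_fourier (w 0 t) k); rewrite !reimE.
Qed.

Lemma hd_at_right n t : 0 <= t <= T -> ccvg (w n t) 0^'+ (w n t 0).
Proof.
move=> ht; have [[d1 _] [d2 _]] := hd_der H n 0 ht.
split; apply: cvg_at_right_filter; apply: differentiable_continuous; exact/derivable1_diffP.
Qed.

(** The seminorm estimates on [y > 0] pass to the limit at [y = 0]. *)
Lemma trace_cont n : (n <= 2)%N -> ccont_on `[0, T] (fun t => w n t 0).
Proof.
move=> n2.
have key t0 : (`[0, T]%classic : set R) t0 -> forall e, 0 < e ->
    \forall t \near within `[0, T] (nbhs t0), normc (w n t0 0 - w n t 0) <= 2 * e.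
  move=> ht0' e e0; have ht0 : 0 <= t0 <= T by move: ht0'; rewrite /= in_itv.
  have := hd_cont H ht0 (or_intror n2) e0.
  rewrite !near_withinE; apply: filterS => t ht tT.
  have tT' : 0 <= t <= T by move: tT; rewrite /= in_itv.
  have [l1 l2] := ccvgB (hd_at_right n ht0) (hd_at_right n tT').
  have small y : 0 < y -> normc (w n t0 y - w n t y) <= e.
    move=> y0; rewrite -normcNE opprB; apply: le_trans (ht tT y y0) _.
    apply: ler_piMr; first exact: ltW.
    by rewrite invf_le1 ?lerDl ?sqr_ge0 // ltr_wpDr ?sqr_ge0.
  rewrite (le_trans (normc_le_ReIm _)) // mulr2n mulrDl mul1r; apply: lerD.
    apply: (ler_cvg_to (cvg_norm l1) (cvg_cst e)).
    near=> y; apply: le_trans (small y _); first exact: Re_le_normc.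
    by near: y; exact: nbhs_right_gt.
  apply: (ler_cvg_to (cvg_norm l2) (cvg_cst e)).
  near=> y; apply: le_trans (small y _); first exact: Im_le_normc.
  by near: y; exact: nbhs_right_gt.
split; apply/subspace_continuousP => t0 ht0; apply/cvgrPdist_le => e e0;
  have e2 : 0 < e / 2 by rewrite divr_gt0.
  have := key t0 ht0 _ e2; apply: filterS => t h; apply: le_trans (le_trans h _).
    by have := Re_le_normc (w n t0 0 - w n t 0); rewrite !reimE.
  by rewrite mulrC divfK.
have := key t0 ht0 _ e2; apply: filterS => t h; apply: le_trans (le_trans h _).
  by have := Im_le_normc (w n t0 0 - w n t 0); rewrite !reimE.
by rewrite mulrC divfK.
Unshelve. all: end_near. Qed.

(** The [t]-derivative of the left-hand side is a boundary term: the volume term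
    of [half_fourier_deriv3] cancels against that of the exponential. *)
Lemma global_relation t k : 0 <= t <= T -> Im k <= 0 ->
  cexp (ii * kappa%:C ^+ 3 * k ^+ 3 * t%:C) * half_fourier (w 0 t) k =
  half_fourier (w 0 0) k - kappa%:C ^+ 3 * cintegral `[0, t] (fun s =>
    cexp (ii * kappa%:C ^+ 3 * k ^+ 3 * s%:C) *
    (w 2 s 0 + ii * k * w 1 s 0 - k ^+ 2 * w 0 s 0)).
Proof.
move=> ht k0; have /andP[t0 tT] := ht.
pose z := ii * kappa%:C ^+ 3 * k ^+ 3 : R[i].
pose b s := w 2 s 0 + ii * k * w 1 s 0 - k ^+ 2 * w 0 s 0.
pose E s : R[i] := cexp (z * s%:C).
have dE s : cder E s (E s * z).
  apply: cder_cexp; apply: cder_ext (cderZ z (cder_id s)) => //.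
  exact: mulr1.
have cE (i : interval R) : ccont_on [set` i] E.
  by apply: cderiv_ccont_itv => s _; eexists; exact: dE.
have sub : `[0, t]%classic `<=` (`[0, T]%classic : set R).
  by move=> s; rewrite /= !in_itv /= => /andP[-> /le_trans]; apply.
have ct n : (n <= 2)%N -> ccont_on `[0, t] (fun t => w n t 0).
  by move=> n2; apply: ccont_onS sub _; exact: trace_cont.
have cu : ccont_on `[0, t] (fun s => E s * b s).
  apply: ccont_onM (cE _) _; apply: ccont_onB; last by apply: ccont_onZ; exact: ct.
  by apply: ccont_onD; [exact: ct|apply: ccont_onZ; exact: ct].
rewrite -/z -/(E t).
have iu := cintegrable_cont cu.
have cU : ccont_on `[0, t] (fun s => E s * half_fourier (w 0 s) k).
  by apply: ccont_onM (cE _) _; apply: ccont_onS sub _; exact: half_fourier_cont_t.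
have dU s : 0 < s < t -> cder (fun s => E s * half_fourier (w 0 s) k) s
    (- kappa%:C ^+ 3 * (E s * b s)).
  move=> /andP[s0 st]; have hs : 0 < s < T by rewrite s0 (lt_le_trans st).
  apply: cder_ext (cderM (dE s) (half_fourier_der_t hs k0)) => //.
  rewrite half_fourier_deriv3 //; last by case/andP: hs => /ltW-> /ltW->.
  rewrite -/(b s); move: (E s) (b s) (half_fourier (w 0 s) k) => A B C.
  by rewrite /z; ring.
have f := cFTC t0 (ccont_onZ (- kappa%:C ^+ 3) cu) cU dU.
rewrite (cintegralZ _ _ iu) in f; last exact: measurable_itv.
have E0 : E 0 = 1 by rewrite /E realC0 mulr0 cexp0.
by rewrite -[in RHS]mulNr f E0 mul1r addrC subrK.
Qed.

End HalfData.

(** * Oscillatory integrals on the real axis *)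

Section RealLine.
Context {R : realType}.
Implicit Types (F : R[i] -> R[i]) (l : R[i]).

Lemma at_right_scale (b : R) : 0 < b -> (fun eps : R => eps * b) @ 0^'+ --> 0^'+.
Proof.
move=> b0 P; rewrite /at_right => /nbhs_ballP[d d0 hP].
apply/nbhs_ballP; exists (d / b); first exact: divr_gt0.
move=> x; rewrite /ball /= sub0r normrN => hx x0; apply: hP; last exact: mulr_gt0.
by rewrite /ball /= sub0r normrN normrM (gtr0_norm b0) -ltr_pdivlMr.
Qed.

(** The change of variable turns the damping rate [eps] into [eps / |c|], which
    tends to 0 as well. *)
Lemma ici_scale (c : R) F l : c != 0 -> is_curve_integral real_line F l ->
  is_curve_integral real_line (fun k => F (c%:C * k)) ((`|c|^-1)%:C * l).
Proof.
move=> c0 [i1 h]; have nc0 : 0 < `|c| by rewrite normr_gt0.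
have key eps : 0 < eps -> curve_integrable real_line (damped eps (fun k => F (c%:C * k))) /\
    (`|c|^-1)%:C * curve_integral real_line (damped (eps * `|c|^-1) F) =
    curve_integral real_line (damped eps (fun k => F (c%:C * k))).
  move=> e0; have e'0 : 0 < eps * `|c|^-1 by rewrite mulr_gt0 ?invr_gt0.
  have [i0 _] := (curve_integrable_cons _ _ _).1 (i1 _ e'0).
  have [i2 e2] := cintegral_scale c0 i0.
  have eqv (s : R) : damped (eps * `|c|^-1) F (c * s)%:C * 1 =
      damped eps (fun k => F (c%:C * k)) s%:C * 1.
    rewrite !mulr1 /damped realCM; congr ((expR _)%:C * _).
    by rewrite -realCM !normcC normrM !mulNr mulrA mulfVK // gt_eqF.
  split.
    apply/curve_integrable_cons; split; last exact: curve_integrable_nil.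
    exact: (cintegrable_eq measurableT (fun s _ => eqv s) i2).
  rewrite !curve_integral1 e2 mulrA -realCM mulVf ?gt_eqF // mul1r.
  by apply: cintegral_eq => s _; exact: eqv.
split=> [eps e0|]; first exact: (key eps e0).1.
apply: ccvg_near_eq (fun eps e0 => (key eps e0).2) _.
apply: ccvgM; first exact: ccvg_cst.
have lim : (fun eps : R => eps * `|c|^-1) @ 0^'+ --> 0^'+ by apply: at_right_scale; rewrite invr_gt0.
by split; [exact: (cvg_comp _ _ lim h.1)|exact: (cvg_comp _ _ lim h.2)].
Qed.

Lemma ici_Z c F l : is_curve_integral real_line F l ->
  is_curve_integral real_line (fun k => c * F k) (c * l).
Proof.
move=> [i1 h]; have swap eps (k : R[i]) :
    c * (damped eps F k * 1) = damped eps (fun k => c * F k) k * 1.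
  by rewrite !mulr1 mulrCA.
have key eps (e0 : 0 < eps) : curve_integrable real_line (damped eps (fun k => c * F k)) /\
    c * curve_integral real_line (damped eps F) =
    curve_integral real_line (damped eps (fun k => c * F k)).
  have [i0 _] := (curve_integrable_cons _ _ _).1 (i1 _ e0).
  split.
    apply/curve_integrable_cons; split; last exact: curve_integrable_nil.
    exact: (cintegrable_eq measurableT (fun s _ => swap eps s%:C) (cintegrableZ c measurableT i0)).
  rewrite !curve_integral1 -(cintegralZ c measurableT i0).
  by apply: cintegral_eq => s _; exact: swap.
split=> [eps e0|]; first exact: (key eps e0).1.
apply: ccvg_near_eq (fun eps e0 => (key eps e0).2) _.
by apply: ccvgM; [exact: ccvg_cst|].
Qed.

Lemma realC_neq0 (a : R) : a != 0 -> a%:C != 0 :> R[i].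
Proof. by move=> a0; apply/eqP => h; move/eqP: a0; apply; rewrite -[a]ReC h Re0. Qed.

Lemma ici_line_of_rays F l l' : abel [:: ray 0 0] F l -> abel [:: ray 0 pi] F l' ->
  is_curve_integral real_line F (l - l').
Proof.
move=> h h'; have key eps (e0 : 0 < eps) := line_of_rays (h.1 eps e0) (h'.1 eps e0).
split=> [eps e0|]; first exact: (key eps e0).1.
apply: ccvg_near_eq (fun eps e0 => esym (key eps e0).2) _.
by apply: ccvgB; exact: abel_ccvg.
Qed.

Lemma sin_le_id (x : R) : 0 <= x -> sin x <= x.
Proof.
move=> x0; have [|c cI e] := @MVT_segment R sin cos 0 x x0.
  by apply: continuous_subspaceT; exact: continuous_sin.
by move: e; rewrite sin0 !subr0 => ->; apply: ler_piMl => //; exact: cos_le1.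
Qed.

Lemma Im_cube (s theta : R) :
  Im (polar s theta ^+ 3) = s ^+ 3 * (sin theta * (3 - 4 * sin theta ^+ 2)).
Proof.
have im3 (z : R[i]) : Im (z ^+ 3) = 3 * Re z ^+ 2 * Im z - Im z ^+ 3.
  by rewrite !exprS expr0 mulr1 !reimE; ring.
rewrite im3 Re_polar Im_polar.
have e : cos theta ^+ 2 = 1 - sin theta ^+ 2 by rewrite cos2sin2.
rewrite (_ : _ - _ = s ^+ 3 * (sin theta * (3 * cos theta ^+ 2 - sin theta ^+ 2))); last by ring.
by rewrite e; ring.
Qed.

(** On the real axis the cubic exponential only oscillates, but below it, near the
    axis, it decays faster than the linear exponential grows; so both halves of
    the axis may be turned downwards. *)
Lemma lower_cubic_decay (S : set R[i]) F (y A C : R) : superp S F -> 0 < y -> 0 < A ->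
  (forall k, Im k <= 0 -> S k) ->
  (forall k, Im k <= 0 -> normc (F k) <= C * expR (- (y * Im k) + A * Im (k ^+ 3))) ->
  exists l, is_curve_integral real_line F l.
Proof.
move=> sF y0 A0 hS hF.
have C0 : 0 <= C.
  have := hF 0; rewrite Im0 => /(_ (lexx _)) h.
  by have := le_trans (normc_ge0 _) h; rewrite pmulr_lge0 // expR_gt0.
(* [C1] bounds the linear term as long as the cubic one does not beat it. *)
pose C1 := (y + 1) * (1 + (y + 1) / A).
have y1 : 0 < y + 1 by rewrite ltr_wpDl // ltW.
have cubic s : 0 <= s -> (y + 1) * s <= C1 + A * s ^+ 3.
  move=> s0; have q0 : 0 < (y + 1) / A by rewrite divr_gt0.
  have [le|lt] := leP s (1 + (y + 1) / A).
    apply: (@le_trans _ _ C1); first by rewrite /C1 ler_wpM2l // ltW.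
    by rewrite lerDl mulr_ge0 ?(ltW A0) // exprn_ge0.
  have h1 : y + 1 <= A * s by rewrite mulrC -ler_pdivrMr //; lra.
  have s1 : 1 <= s by lra.
  have C10 : 0 <= C1 by rewrite mulr_ge0 ?(ltW y1) //; lra.
  apply: (@le_trans _ _ (A * s ^+ 3)); last by rewrite lerDr.
  rewrite (_ : A * s ^+ 3 = (A * s) * s ^+ 2); last by ring.
  by apply: ler_pM; [exact: ltW|exact: s0|exact: h1|rewrite expr2 ler_peMl].
have growth a b : (forall theta, a <= theta <= b -> 0 <= - sin theta <= 1 / 2) ->
  forall d, 0 < d -> exists C : R, forall s theta, 0 <= s -> a <= theta <= b ->
    normc (F (polar s theta)) <= C * expR (d * s - (-1) * (s * sin theta)).
  move=> hs d d0; exists (C * expR C1) => s th s0 hth.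
  have /andP[z0 z1] := hs th hth; set z := - sin th in z0 z1.
  have sE : sin th = - z by rewrite /z opprK.
  have hIm : Im (polar s th) <= 0 by rewrite Im_polar sE mulrN oppr_le0 mulr_ge0.
  apply: (le_trans (hF _ hIm)); rewrite -mulrA ler_wpM2l // -expRD ler_expR.
  rewrite Im_cube Im_polar sE sqrrN.
  have p1 : 0 <= z * (A * s ^+ 3 * (2 - 4 * z ^+ 2)).
    rewrite mulr_ge0 // mulr_ge0 ?mulr_ge0 ?(ltW A0) ?exprn_ge0 //; nra.
  have p2 : 0 <= z * (C1 + A * s ^+ 3 - (y + 1) * s) by rewrite mulr_ge0 // subr_ge0 cubic.
  have p3 : 0 <= d * s by rewrite mulr_ge0 // ltW.
  have C10 : 0 <= C1 by rewrite mulr_ge0 ?(ltW y1) // addr_ge0 // divr_ge0 ?ltW.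
  have p4 : 0 <= (1 - z) * C1 by rewrite mulr_ge0 //; lra.
  rewrite -subr_ge0.
  rewrite (_ : _ - _ = z * (A * s ^+ 3 * (2 - 4 * z ^+ 2)) +
    z * (C1 + A * s ^+ 3 - (y + 1) * s) + d * s + (1 - z) * C1); last by ring.
  by rewrite !addr_ge0.
have p2 := @pi_ge2 R.
have hsin (x : R) : 0 <= x <= 1 / 2 -> 0 <= sin x <= 1 / 2.
  move=> /andP[x0 x1]; apply/andP; split; first by apply: sin_ge0_pi; rewrite x0 /=; lra.
  exact: le_trans (sin_le_id x0) x1.
have s1 (th : R) : - (1 / 2) <= th <= 0 -> 0 <= - sin th <= 1 / 2.
  move=> h; rewrite -sinN; apply: hsin; lra.
have s2 (th : R) : pi <= th <= pi + 1 / 2 -> 0 <= - sin th <= 1 / 2.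
  move=> h; rewrite -[th](subrK pi) sinDpi opprK; apply: hsin; lra.
have hS' a b : (forall theta, a <= theta <= b -> 0 <= - sin theta <= 1 / 2) ->
    forall s th, 0 <= s -> a <= th <= b -> S (polar s th).
  move=> hs s th s0 /hs/andP[h _]; apply: hS.
  by rewrite Im_polar -[sin th]opprK mulrN oppr_le0 mulr_ge0.
have pos (x : R) : 0 < x < pi -> 0 < -1 * sin (- x).
  by move=> h; rewrite sinN mulrN mulN1r opprK sin_gt0_pi.
have w1 : (0 : R) - - (1 / 2) < pi / 2 by lra.
have w2 : (pi : R) + 1 / 2 - pi < pi / 2 by lra.
have n1 : - (1 / 2) <= (0 : R) by lra.
have n2 : pi <= (pi : R) + 1 / 2 by lra.
have h12 : 0 < (1 / 2 : R) < pi by lra.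
have [||_ [l [_ hl _]]] := sector_abel sF (lexx 0) n1 w1 (hS' _ _ s1) (growth _ _ s1).
- by move=> th /s1/andP[h _]; rewrite mulN1r.
- left; exact: pos.
have [||l' [_ [hl' _ _]]] := sector_abel sF (lexx 0) n2 w2 (hS' _ _ s2) (growth _ _ s2).
- by move=> th /s2/andP[h _]; rewrite mulN1r.
- right; have := pos _ h12; rewrite sinN [pi + _]addrC sinDpi; exact.
by exists (l - l'); exact: ici_line_of_rays.
Qed.

End RealLine.

(** * Boundary terms *)

Section BoundaryTerms.
Context {R : realType}.
Local Notation mu := (@lebesgue_measure R).
Implicit Types (D : set R) (u : R -> R[i]) (b : nat -> R -> R[i]).

Lemma grows_transform D (tau : R -> R) (p : R[i] -> R[i]) u (a c rho : R) :
  measurableR D -> measurable_fun (D : set (measurableTypeR R)) tau -> cintegrable D u ->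
  0 <= rho ->
  (forall s theta, rho <= s -> a <= theta <= c -> forall x, D x ->
     tau x * Re (p (polar s theta)) <= 0) ->
  grows a c rho 0 (fun k => cintegral D (fun x => cexp ((tau x)%:C * p k) * u x)).
Proof.
move=> mD mtau iu r0 h.
apply: (grows_bounded (C := 2 * Rintegral mu D (fun x => normc (u x)))) => // s th rs hth.
apply: (normc_cintegral_le mD _ (cintegrable_normc mD iu)) => [|x Dx].
  exact: (cmeasM (cmeas_cexp (cmeasM (cmeas_real mtau) (cmeas_cst _ _))) (cintegrable_cmeas iu)).
rewrite normcM normc_cexp ler_piMl ?normc_ge0 // -[leRHS]expR0 ler_expR.
rewrite ReM ReC ImC mul0r subr0; exact: h.
Qed.

(** The factor [exp (- i k^3 t)] is put inside the integral: it is the difference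
    [s - t] whose sign decides in which sectors the integrand decays. *)
Definition time_transform D u (t : R) (k : R[i]) : R[i] :=
  cintegral D (fun s => cexp ((s - t)%:C * (ii * k ^+ 3)) * u s).

Definition boundary_term (kappa : R) D b (t y : R) (k : R[i]) : R[i] :=
  cexp (ii * (k / kappa%:C) * y%:C) *
  (kappa%:C ^+ 2 * time_transform D (b 2) t k + ii * k * kappa%:C * time_transform D (b 1) t k
   - k ^+ 2 * time_transform D (b 0) t k).

Lemma measurable_shift D (t : R) : measurable_fun (D : set (measurableTypeR R)) (fun s => s - t).
Proof.
apply: measurable_funTS; apply: continuous_measurable_fun => s.
by apply: cvgB; [exact: cvg_id|exact: cvg_cst].
Qed.

Lemma superp_time_transform (S : set R[i]) D u (t B : R) : measurableR D -> cintegrable D u -> 0 <= B ->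
  (forall s, D s -> `|s - t| <= B) -> superp S (time_transform D u t).
Proof.
move=> mD iu B0 hB.
have ep : elem S (fun k => ii * k ^+ 3) by apply: elemZ; apply: elemX; exact: elem_id.
apply: (eq_ind (fun k => 1 * time_transform D u t k) (superp S)); last first.
  by apply/funext => k; rewrite mul1r.
apply: (Superp (elem_cst _ 1) ep mD (measurable_shift t) iu) => L.
exists (B * L ^+ 3) => k _ kL s Ds.
have nb : `|Re (ii * k ^+ 3)| <= L ^+ 3.
  apply: le_trans (Re_le_normc _) _; rewrite normcM normcI mul1r normcX.
  by apply: lerXn2r => //; rewrite nnegrE ?normc_ge0 // (le_trans (normc_ge0 k)).
apply: le_trans (ler_norm _) _; rewrite normrM.
by apply: ler_pM => //; exact: hB.
Qed.

Lemma superp_boundary_term (S : set R[i]) (kappa : R) D b (t y B : R) :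
  measurableR D -> (forall n, (n <= 2)%N -> cintegrable D (b n)) -> 0 <= B ->
  (forall s, D s -> `|s - t| <= B) -> superp S (boundary_term kappa D b t y).
Proof.
move=> mD ib B0 hB; have st n (n2 : (n <= 2)%N) := superp_time_transform S mD (ib n n2) B0 hB.
apply: superp_mul.
  apply: elem_cexp; apply: elemM (elem_cst _ _); apply: elemZ.
  exact: elemM (elem_id _) (elem_cst _ _).
apply: superpD.
  apply: superpD; first exact: (superp_mul (elem_cst _ _) (st 2%N isT)).
  apply: (superp_mul _ (st 1%N isT)).
  exact: elemM (elemZ _ (elem_id _)) (elem_cst _ _).
apply: (eq_ind (fun k => - k ^+ 2 * time_transform D (b 0) t k) (superp S)); last first.
  by apply/funext => k; rewrite mulNr.
apply: (superp_mul _ (st 0%N isT)); apply: elemN; apply: elemX; exact: elem_id.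
Qed.

Lemma sin_half_turn n (x : R) : n%:R * pi <= x <= n.+1%:R * pi -> 0 <= (-1) ^+ n * sin x.
Proof.
elim: n x => [|n ih] x; first by rewrite mul0r !mul1r => h; exact: sin_ge0_pi.
move=> h; rewrite exprS sin_shift mulN1r mulrNN; apply: ih.
by move: h; rewrite -!natr1 !mulrDl !mul1r lerBrDr lerBlDr.
Qed.

Lemma polar_cube (s theta : R) : polar s theta ^+ 3 = polar (s ^+ 3) (3 * theta).
Proof.
rewrite /polar exprMn -realCX; congr (_ * _); rewrite -cexpM_nat; congr cexp.
by rewrite realCM; ring.
Qed.

(** In the sectors of odd index [exp (i k^3 s)] decays as [s] grows, in those of
    even index as [s] decreases. *)
Lemma Re_cube_sector n (s theta : R) : 0 <= s ->
  sector_lo n.+1 <= theta <= sector_hi n.+1 ->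
  (-1) ^+ n * Re (ii * polar s theta ^+ 3) <= 0.
Proof.
move=> s0 h; rewrite ReM ReI ImI mul0r sub0r mul1r polar_cube Im_polar mulrN oppr_le0.
rewrite mulrCA mulr_ge0 ?exprn_ge0 //; apply: sin_half_turn.
move: h; rewrite /sector_lo /sector_hi /=; lra.
Qed.

(** The parity of the sector matches the sign of [s - t], so the time transforms are
    bounded there. *)
Lemma grows_boundary_term (kappa : R) D b (t y rho : R) n :
  measurableR D -> (forall n, (n <= 2)%N -> cintegrable D (b n)) -> 0 <= rho ->
  (forall s, D s -> 0 <= (-1) ^+ n * (s - t)) ->
  grows (sector_lo n.+1) (sector_hi n.+1) rho (y / kappa) (boundary_term kappa D b t y).
Proof.
move=> mD ib r0 hD; rewrite -[y / kappa]addr0; apply: growsM.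
  apply: grows_eq (grows_cexp _ _ _ r0) => s th _ _; congr cexp.
  by rewrite realCM realCV; ring.
have gt m : (m <= 2)%N -> grows (sector_lo n.+1) (sector_hi n.+1) rho 0 (time_transform D (b m) t).
  move=> m2; apply: (grows_transform mD (measurable_shift t) (ib m m2) r0).
  move=> s th rs hth x Dx; have h1 := Re_cube_sector (le_trans r0 rs) hth.
  have -> : (x - t) * Re (ii * polar s th ^+ 3) =
    ((-1) ^+ n * (x - t)) * ((-1) ^+ n * Re (ii * polar s th ^+ 3)).
    by rewrite mulrACA -expr2 sqrr_sign mul1r.
  by apply: mulr_ge0_le0 => //; exact: hD.
have gk c : grows (sector_lo n.+1) (sector_hi n.+1) rho 0 (fun k : R[i] => c * k).
  apply: grows_eq (grows_horner _ _ (c *: 'X) r0) => s th _ _.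
  by rewrite hornerZ hornerX.
have gM F G : grows (sector_lo n.+1) (sector_hi n.+1) rho 0 F ->
    grows (sector_lo n.+1) (sector_hi n.+1) rho 0 G ->
    grows (sector_lo n.+1) (sector_hi n.+1) rho 0 (fun k => F k * G k).
  by move=> h1 h2; rewrite -[X in grows _ _ _ X]addr0; exact: growsM.
have gp (q : {poly R[i]}) m : (m <= 2)%N ->
    grows (sector_lo n.+1) (sector_hi n.+1) rho 0 (fun k => q.[k] * time_transform D (b m) t k).
  by move=> m2; apply: gM; [exact: grows_horner|exact: gt].
have g2 := gp ((kappa%:C ^+ 2)%:P) 2%N isT.
have g1 := gp ((ii * kappa%:C) *: 'X) 1%N isT.
have g0 := gp (- 'X^2) 0%N isT.
apply: grows_eq (growsD (growsD g2 g1) g0) => s th _ _.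
rewrite hornerC hornerZ hornerX hornerN hornerXn mulNr.
by congr (_ + _ * _ - _); ring.
Qed.

Lemma boundary_term_setU (kappa : R) D E b (t y : R) k : measurableR D -> measurableR E ->
  [disjoint D & E] -> (forall n, (n <= 2)%N -> cintegrable (D `|` E) (b n)) ->
  (exists2 B, 0 <= B & forall s, (D `|` E) s -> `|s - t| <= B) ->
  boundary_term kappa (D `|` E) b t y k = boundary_term kappa D b t y k + boundary_term kappa E b t y k.
Proof.
move=> mD mE DE ib [B B0 hB].
have mDE : measurableR (D `|` E) by exact: measurableU.
have ti n : (n <= 2)%N -> time_transform (D `|` E) (b n) t k = time_transform D (b n) t k + time_transform E (b n) t k.
  move=> n2; apply: cintegral_setU mD mE _ DE.
  have mu_b := ib n n2; pose c := `|Re (ii * k ^+ 3)|.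
  apply: (cintegrable_dom (g := fun s => expR (B * c) * normc (b n s)) mDE).
  - exact: (cmeasM (cmeas_cexp (cmeasM (cmeas_real (measurable_shift t)) (cmeas_cst _ _)))
      (cintegrable_cmeas mu_b)).
  - have := integrableZl mDE (expR (B * c)) (cintegrable_normc mDE mu_b).
    by apply: eq_integrable.
  - move=> s hs; rewrite normcM normc_cexp ler_wpM2r ?normc_ge0 // ler_expR.
    rewrite ReM ReC ImC mul0r subr0; apply: le_trans (ler_norm _) _; rewrite normrM.
    by apply: ler_wpM2r; [exact: normr_ge0|exact: hB].
rewrite /boundary_term !ti // -mulrDr; congr (_ * _); ring.
Qed.

End BoundaryTerms.

(** * The representation formula on a half line *)

Section HalfRepresentation.
Context {R : realType}.
Local Notation mu := (@lebesgue_measure R).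
Variables (kappa T : R) (w : nat -> R -> R -> R[i]).
Hypothesis H : half_data kappa T w.
Hypothesis kappa0 : kappa != 0.

Definition traces n (s : R) : R[i] := w n s 0.

Definition upper_sectors : seq nat := if kappa < 0 then [:: 5]%N else [:: 1; 3]%N.

Definition upper_contour (rho : R) : seq curve :=
  flatten [seq sector_boundary rho r | r <- upper_sectors].

Lemma traces_integrable n t : (n <= 2)%N -> 0 <= t <= T -> cintegrable `[0, t] (traces n).
Proof.
move=> n2 /andP[t0 tT]; apply: cintegrable_cont; apply: ccont_onS (trace_cont H n2).
by move=> s; rewrite /= !in_itv /= => /andP[-> /le_trans]; apply.
Qed.

Lemma superp_half_fourier (S : set R[i]) t a : 0 <= t <= T ->
  (forall k, S k -> Im (a * k) <= 0) ->
  superp S (fun k => half_fourier (w 0 t) (a * k)).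
Proof.
move=> ht hS; have m0 : measurableR `](0 : R), +oo[ by exact: measurable_itv.
have ep : elem S (fun k : R[i] => - (ii * (a * k))).
  by apply: elemN; apply: elemZ; apply: elemZ; exact: elem_id.
have iw : cintegrable `]0, +oo[ (w 0 t).
  have i0 : Im (0 : R[i]) <= 0 by [].
  apply: cintegrable_eq m0 _ (hd_integrable H 0 ht i0) => s _.
  by rewrite mulr0 mul0r oppr0 cexp0 mul1r.
apply: (eq_ind (fun k => 1 * cintegral `]0, +oo[ (fun y => cexp (y%:C * - (ii * (a * k))) * w 0 t y))
  (superp S)); last first.
  apply/funext => k; rewrite mul1r; apply: cintegral_eq => y _; congr (cexp _ * _).
  by rewrite mulrN mulrC.
apply: (Superp (elem_cst _ 1) ep m0 (@measurable_id _ _ _) iw) => L; exists 0 => k Sk _ y hy.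
have y0 : 0 < y by move: hy; rewrite /= in_itv /= andbT.
have -> : Re (- (ii * (a * k))) = Im (a * k) by rewrite ReN [Re (ii * _)]ReM ReI ImI mul0r mul1r sub0r opprK.
exact: mulr_ge0_le0 (ltW y0) (hS k Sk).
Qed.

Lemma half_fourier_bounded t : 0 <= t <= T ->
  exists C, forall k, Im k <= 0 -> normc (half_fourier (w 0 t) k) <= C.
Proof.
move=> ht; have [M hM] := hd_bound H 0 ht; eexists => k k0.
exact: half_fourier_le k0 (hd_cmeas H 0 ht) (fun y _ => hM y).
Qed.

(** The [global_relation] times the inverse of its exponential and the inversion
    kernel.  The boundary term is taken at [kappa k], where [kappa^3 k^3] becomes
    the cube of the variable. *)
Lemma integrand_split t y k : 0 <= t <= T -> Im k <= 0 ->
  cexp (ii * k * y%:C) * half_fourier (w 0 t) k =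
  cexp (ii * k * y%:C - ii * kappa%:C ^+ 3 * k ^+ 3 * t%:C) * half_fourier (w 0 0) k
  - kappa%:C * boundary_term kappa `[0, t] traces t y (kappa%:C * k).
Proof.
move=> ht k0; pose z := ii * kappa%:C ^+ 3 * k ^+ 3 : R[i].
have mI : measurableR `[0, t] by exact: measurable_itv.
have nk : kappa%:C != 0 :> R[i] by exact: realC_neq0.
pose e s : R[i] := cexp (z * s%:C).
have iA n : (n <= 2)%N -> cintegrable `[0, t] (fun s => e s * traces n s).
  move=> n2; have /andP[t0 tT] := ht; apply: cintegrable_cont; apply: ccont_onM.
    apply: cderiv_ccont_itv => s _; eexists; apply: cder_cexp; apply: cderZ; exact: cder_id.
  apply: ccont_onS (trace_cont H n2).
  by move=> s; rewrite /= !in_itv /= => /andP[-> /le_trans]; apply.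
have tE n : (n <= 2)%N -> time_transform `[0, t] (traces n) t (kappa%:C * k) =
    cexp (- (z * t%:C)) * cintegral `[0, t] (fun s => e s * traces n s).
  move=> n2; rewrite -(cintegralZ _ mI (iA n n2)); apply: cintegral_eq => s _.
  rewrite [RHS]mulrA /e -cexpD; congr (cexp _ * _); rewrite /z realCB; ring.
have g := global_relation H ht k0; rewrite -/z in g.
have gE : cintegral `[0, t] (fun s => cexp (z * s%:C) *
    (w 2 s 0 + ii * k * w 1 s 0 - k ^+ 2 * w 0 s 0)) =
    cintegral `[0, t] (fun s => e s * traces 2 s) + ii * k * cintegral `[0, t] (fun s => e s * traces 1 s)
    - k ^+ 2 * cintegral `[0, t] (fun s => e s * traces 0 s).
  have i2 := iA 2%N isT; have i1 := iA 1%N isT; have i0 := iA 0%N isT.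
  rewrite -(cintegralZ _ mI i1) -(cintegralZ _ mI i0).
  rewrite -(cintegralD mI i2 (cintegrableZ _ mI i1)).
  rewrite -(cintegralB mI (cintegrableD mI i2 (cintegrableZ _ mI i1)) (cintegrableZ _ mI i0)).
  apply: cintegral_eq => s _; rewrite -/(e s) /traces.
  by move: (e s) (w 2 s 0) (w 1 s 0) (w 0 s 0) => A B C D; ring.
rewrite gE in g; rewrite /boundary_term !tE //.
have -> : kappa%:C * k / kappa%:C = k by rewrite mulrAC divff // mul1r.
rewrite cexpD.
rewrite -/(e t) in g; move: g.
have et : e t * cexp (- (z * t%:C)) = 1 by rewrite /e -cexpD subrr cexp0.
move: et; move: (cexp (- (z * t%:C))) (e t) (half_fourier (w 0 t) k) (half_fourier (w 0 0) k)
  (cintegral _ _) (cintegral _ _) (cintegral _ _) (cexp (ii * k * y%:C)) => e' et V V0 A2 A1 A0 Ey.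
move=> ee g.
have -> : V = e' * (et * V) by rewrite mulrA [e' * _]mulrC ee mul1r.
by rewrite g; ring.
Qed.

(** The case distinction is about which of the two integrals is known to converge
    before the other. *)
Theorem half_representation t y rho : 0 < t < T -> 0 < y -> 0 <= rho ->
  exists l0 l : R[i], [/\
    is_curve_integral real_line (fun k =>
      cexp (ii * k * y%:C - ii * kappa%:C ^+ 3 * k ^+ 3 * t%:C) * half_fourier (w 0 0) k) l0,
    is_curve_integral (upper_contour rho) (boundary_term kappa `[0, t] traces t y) l &
    (2 * pi)%:C * w 0 t y = l0 - l].
Proof.
move=> /andP[t0 tT] y0 r0.
have ht : 0 <= t <= T by rewrite !ltW.
have h0 : 0 <= (0 : R) <= T by rewrite lexx (ltW (lt_trans t0 tT)).
pose B := boundary_term kappa `[0, t] traces t y.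
pose F0 k := cexp (ii * k * y%:C - ii * kappa%:C ^+ 3 * k ^+ 3 * t%:C) * half_fourier (w 0 0) k.
rewrite -/F0 -/B.
have mI : measurableR `[0, t] by exact: measurable_itv.
have tb s : (`[0, t]%classic : set R) s -> `|s - t| <= t.
  by rewrite /= in_itv /= => /andP[s0 st]; rewrite ler0_norm ?subr_le0 // opprB lerBlDr lerDl.
have ib n (n2 : (n <= 2)%N) := traces_integrable n2 ht.
have sB := superp_boundary_term setT kappa y mI ib (ltW t0) tb.
have gB n rho' : 0 <= rho' -> odd n ->
    grows (sector_lo n.+1) (sector_hi n.+1) rho' (y / kappa) B.
  move=> r' on; apply: (grows_boundary_term kappa y mI ib r') => s.
  rewrite /= in_itv /= => /andP[_ st].
  by rewrite -signr_odd on mulN1r oppr_ge0 subr_le0.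
have [M0 hM0] := hd_bound H 0 ht; have [M1 hM1] := hd_bound H 1 ht.
pose M := Num.max M0 M1.
have bd n x : (n < 2)%N -> normc (w n t x) <= M * (1 + x ^+ 2)^-1.
  have i0 : 0 <= (1 + x ^+ 2)^-1 :> R by rewrite invr_ge0 addr_ge0 // sqr_ge0.
  case: n => [|[|//]] _.
    by apply: le_trans (hM0 x) _; rewrite ler_wpM2r // le_max lexx.
  by apply: le_trans (hM1 x) _; rewrite ler_wpM2r // le_max lexx orbT.
have inv := half_fourier_inversion (fun x => hd_der H 0 x ht)
  (fun x => ex_intro _ _ (hd_der H 1 x ht)) (fun x _ => bd 0%N x isT) (fun x _ => bd 1%N x isT) y0.
have mline : measurable_curves [:: Curve setT (fun s : R => s%:C) (fun=> 1)].
  by case=> [|i] //= _; exact: measurableT.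
have on_line F G l : (forall k, Im k = 0 -> F k = G k) -> is_curve_integral real_line F l ->
    is_curve_integral real_line G l.
  move=> e; apply: ici_eq => -[|i] //= _; split=> [|s _]; first exact: measurableT.
  exact: e.
have split_line k : Im k = 0 -> cexp (ii * k * y%:C) * half_fourier (w 0 t) k =
    F0 k + -1 * (kappa%:C * B (kappa%:C * k)).
  by move=> k0; rewrite mulN1r; apply: integrand_split; rewrite ?k0.
have ick : forall l c, is_curve_integral real_line B l ->
    c = kappa * `|kappa|^-1 ->
    is_curve_integral real_line (fun k => kappa%:C * B (kappa%:C * k)) (c%:C * l).
  move=> l c hl ->; rewrite realCM -mulrA.
  exact: ici_Z (ici_scale kappa0 hl).
have [kp|kn] := ltP 0 kappa.
  (* The initial data integral converges first, and the boundary term follows. *)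
  have [l0 hl0] : exists l, is_curve_integral real_line F0 l.
    have A0 : 0 < kappa ^+ 3 * t by rewrite mulr_gt0 // exprn_gt0.
    have [C hC] := half_fourier_bounded h0.
    apply: (@lower_cubic_decay _ [set k | Im k <= 0] F0 y (kappa ^+ 3 * t) C) => //.
      have s1 : superp [set k | Im k <= 0] (half_fourier (w 0 0)).
        apply: (eq_ind (fun k => half_fourier (w 0 0) (1 * k)) (superp _)); last first.
          by apply/funext => k; rewrite mul1r.
        by apply: superp_half_fourier h0 _ => k; rewrite mul1r.
      apply: superp_mul s1; apply: elem_cexp; apply: elemB; apply: elemM (elem_cst _ _).
        by apply: elemZ; exact: elem_id.
      by apply: elemZ; apply: elemX; exact: elem_id.
    move=> k k0; rewrite normcM mulrC normc_cexp; apply: ler_pM.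
    - exact: normc_ge0.
    - exact: expR_ge0.
    - exact: hC.
    - rewrite ler_expR -realCX le_eqVlt; apply/orP; left; apply/eqP.
      move: (k ^+ 3) => q; rewrite !reimE; ring.
  have hkB : is_curve_integral real_line (fun k => kappa%:C * B (kappa%:C * k))
      (l0 - (2 * pi)%:C * w 0 t y).
    have h := ici_D mline hl0 (ici_Z (-1) inv).
    rewrite mulN1r in h; apply: on_line h => k k0.
    by rewrite (split_line k k0) !mulN1r opprB addrC subrK.
  have hB : is_curve_integral real_line B (l0 - (2 * pi)%:C * w 0 t y).
    have k'0 : kappa^-1 != 0 by rewrite invr_eq0.
    have k'p : 0 < kappa^-1 by rewrite invr_gt0.
    have h := ici_Z (kappa^-1%:C) (ici_scale k'0 hkB).
    rewrite mulrA -realCM (gtr0_norm k'p) (divff k'0) mul1r in h.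
    have k1 : kappa^-1%:C * kappa%:C = 1 :> R[i] by rewrite -realCM mulVf.
    have k2 k : kappa%:C * (kappa^-1%:C * k) = k by rewrite mulrA [X in X * k]mulrC k1 mul1r.
    by apply: on_line h => k _; rewrite k2 [LHS]mulrA k1 mul1r.
  exists l0; exists (l0 - (2 * pi)%:C * w 0 t y); split; [exact: hl0| |].
    have -> : upper_contour rho = sector_boundary rho 1 ++ sector_boundary rho 3.
      by rewrite /upper_contour /upper_sectors ltNge (ltW kp).
    exact: (deform_pos sB r0 y0 kp (gB 1%N rho r0 isT) hB).
  by rewrite opprB addrC subrK.
(* The boundary term converges first; [kappa / |kappa| = -1] undoes the sign of
   [deform_neg]. *)
have kn' : kappa < 0 by rewrite lt_neqAle kappa0 kn.
have [l [hl hl']] := deform_neg sB r0 y0 kn' (gB 3%N 0 (lexx _) isT) (gB 5%N 0 (lexx _) isT).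
exists ((2 * pi)%:C * w 0 t y + l), l; split; last by rewrite addrK.
  have c1 : -1 = kappa * `|kappa|^-1.
    by rewrite ltr0_norm // invrN mulrN divff.
  have h := ici_D mline inv (ick _ _ hl c1).
  rewrite realCN mulN1r opprK in h; apply: on_line h => k k0.
  by rewrite (split_line k k0) mulN1r subrK.
have -> : upper_contour rho = sector_boundary rho 5.
  by rewrite /upper_contour /upper_sectors kn'.
exact: hl'.
Qed.

End HalfRepresentation.

(** * Solutions as rescaled half-line data *)

Section HalfSolutions.
Context {R : realType}.
Implicit Types (u phi : R -> R[i]) (s : side).

(** Both half lines are treated as the right one, through [x = dir s * y]. *)
Definition dir s : R := pick_side s (-1) 1.

Lemma dir_halfline s (y : R) : halfline s (dir s * y) <-> 0 < y.
Proof.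
by case: s; rewrite /= in_itv /= ?andbT ?mul1r // mulN1r oppr_lt0.
Qed.

Lemma dirK s : dir s * dir s = 1.
Proof. by case: s; rewrite /dir /= ?mulN1r ?opprK ?mul1r. Qed.

Lemma dirX_cube s : dir s ^+ 3 = dir s.
Proof. by rewrite !exprS expr0 mulr1 dirK mulr1. Qed.

Lemma normr_dir s : `|dir s| = 1.
Proof. by case: s; rewrite /dir /= ?normrN normr1. Qed.

Lemma halfline_nbhs s (x : R) : halfline s x -> nbhs x (halfline s).
Proof. by case: s => h; apply: open_nbhs_nbhs; split => //; exact: interval_open. Qed.

(** Half lines are open, so derivatives inside them are determined by the values
    there. *)
Lemma derive1n_local s (f g : R -> R) n : (forall x, halfline s x -> f x = g x) ->
  forall x, halfline s x -> derive1n n f x = derive1n n g x.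
Proof.
move=> fg; elim: n => [|n ih] x hx; first exact: fg.
rewrite !derive1nS !derive1E; apply: near_eq_derive.
by apply: filterS (halfline_nbhs hx) => y; exact: ih.
Qed.

Lemma cderiv_local s u v n : (forall x, halfline s x -> u x = v x) ->
  forall x, halfline s x -> cderiv n u x = cderiv n v x.
Proof.
move=> uv x hx; rewrite /cderiv; congr (_ +i* _)%C;
  by apply: derive1n_local hx => y hy; rewrite uv.
Qed.

Lemma cder_cderiv phi n x : schwartz phi -> cder (cderiv n phi) x (cderiv n.+1 phi x).
Proof.
move=> [[d1 _] [d2 _]]; split; rewrite /cderiv derive1nS derive1nS.
  by apply: DeriveDef; [exact: d1|rewrite -derive1E].
by apply: DeriveDef; [exact: d2|rewrite -derive1E].
Qed.

Lemma cderiv_bound phi n : schwartz phi ->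
  exists M, forall x, normc (cderiv n phi x) <= M * (1 + x ^+ 2)^-1.
Proof.
move=> [[_ b1] [_ b2]].
have [M1 h1] := b1 0%N n; have [M2 h2] := b1 2%N n.
have [M3 h3] := b2 0%N n; have [M4 h4] := b2 2%N n.
exists (M1 + M2 + (M3 + M4)) => x.
have x0 : 0 < 1 + x ^+ 2 by rewrite ltr_pwDl // sqr_ge0.
rewrite ler_pdivlMr // (le_trans _ (lerD (lerD (h1 x) (h2 x)) (lerD (h3 x) (h4 x)))) //.
rewrite !expr0 !mul1r !(normrM (x ^+ 2)) (ger0_norm (sqr_ge0 x)).
apply: (@le_trans _ _ ((`|Re (cderiv n phi x)| + `|Im (cderiv n phi x)|) * (1 + x ^+ 2))).
  by rewrite ler_wpM2r ?(ltW x0) // normc_le_ReIm.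
rewrite le_eqVlt; apply/orP; left; apply/eqP; rewrite /cderiv /=; ring.
Qed.

(** The derivatives of a Schwartz extension are continuous at the interface. *)
Lemma trace_local s u phi n : schwartz phi -> (forall x, halfline s x -> u x = phi x) ->
  trace s n u = cderiv n phi 0.
Proof.
move=> sphi uphi; have [[e1 _] [e2 _]] := cder_cderiv n 0 sphi.
have loc := cderiv_local n uphi.
have c1 := differentiable_continuous ((derivable1_diffP _ _).1 e1).
have c2 := differentiable_continuous ((derivable1_diffP _ _).1 e2).
have lim_of (F : set_system R) (f g : R -> R) (l : R) : ProperFilter F ->
    (\forall x \near F, f x = g x) -> g @ F --> l -> lim (f @ F) = l.
  move=> PF fg gl; apply: cvg_lim => //; apply: cvg_trans gl.
  by apply: near_eq_cvg; apply: filterS fg => x ->.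
case: s uphi loc => uphi loc; rewrite /trace /clim; apply: complex_ext => /=.
- apply: (lim_of _ _ (fun x => Re (cderiv n phi x))); last exact: cvg_at_left_filter c1.
  near=> x; rewrite -loc //= in_itv /=; near: x; exact: nbhs_left_lt.
- apply: (lim_of _ _ (fun x => Im (cderiv n phi x))); last exact: cvg_at_left_filter c2.
  near=> x; rewrite -loc //= in_itv /=; near: x; exact: nbhs_left_lt.
- apply: (lim_of _ _ (fun x => Re (cderiv n phi x))); last exact: cvg_at_right_filter c1.
  near=> x; rewrite -loc //= in_itv /= andbT; near: x; exact: nbhs_right_gt.
- apply: (lim_of _ _ (fun x => Im (cderiv n phi x))); last exact: cvg_at_right_filter c2.
  near=> x; rewrite -loc //= in_itv /= andbT; near: x; exact: nbhs_right_gt.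
Unshelve. all: end_near. Qed.

(** Derivatives are taken on a Schwartz extension, so that they make sense up to
    and across the interface. *)
Lemma half_data_of_solution s (sigma T : R) q0 q : half_solution s sigma T q0 q ->
  exists w, [/\ half_data (dir s * sigma) T w,
    forall t y, 0 <= t <= T -> 0 < y -> w 0 t y = q (dir s * y) t &
    forall n t, 0 <= t <= T -> w n t 0 = (dir s)%:C ^+ n * trace s n (q^~ t)].
Proof.
move=> hs.
have ex (t : R) : exists p : R -> R[i], 0 <= t <= T ->
    schwartz p /\ forall x, halfline s x -> q x t = p x.
  case: (boolP (0 <= t <= T)) => [ht|_]; last by exists (fun=> 0).
  by have [p sp hp] := hs_schwartz hs ht; exists p.
have [phi hphi] := choice ex.
pose w n t y : R[i] := (dir s)%:C ^+ n * cderiv n (phi t) (dir s * y).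
have qphi n t x : 0 <= t <= T -> halfline s x -> cderiv n (q^~ t) x = cderiv n (phi t) x.
  by move=> ht; apply: cderiv_local => z hz; have [_ h] := hphi t ht; exact: h.
have w0 t y : w 0%N t y = phi t (dir s * y).
  by rewrite /w expr0 mul1r /cderiv /=; case: (phi t _).
have n1 n : normc ((dir s)%:C ^+ n) = 1 by rewrite normcX normcC normr_dir expr1n.
exists w; split; last 2 first.
- move=> t y ht y0; have [_ ->] := hphi t ht; first exact: w0.
  exact/dir_halfline.
- move=> n t ht; have [sp hp] := hphi t ht.
  by rewrite (trace_local n sp hp) /w mulr0.
split.
- move=> n t y ht; have [sp _] := hphi t ht.
  have dg : is_derive y (1 : R) (fun y => dir s * y) (dir s).
    by apply: is_derive_ext (is_deriveZ (dir s) (is_derive_id y (1 : R))) => //; exact: mulr1.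
  apply: cder_ext (cderZ ((dir s)%:C ^+ n) (cder_comp_real (cder_cderiv n (dir s * y) sp) dg)) => //.
  by rewrite /w exprSr mulrA.
- move=> n t ht; have [sp _] := hphi t ht; have [M hM] := cderiv_bound n sp.
  exists M => y; rewrite /w normcM n1 mul1r (le_trans (hM _)) //.
  by rewrite exprMn expr2 dirK mul1r.
- move=> n t0 ht0 hn e e0.
  have e2 : 0 < e / 2 by rewrite divr_gt0.
  have h0 := hs_continuous hs 0 ht0 hn e2; have h2 := hs_continuous hs 2 ht0 hn e2.
  move: h0 h2; rewrite !near_withinE => h0 h2.
  apply: filterS2 h0 h2 => t a0 a2 tT y y0.
  have ht : 0 <= t <= T by move: tT; rewrite /= in_itv.
  have hy : halfline s (dir s * y) by exact/dir_halfline.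
  have := a0 tT _ hy; have := a2 tT _ hy; rewrite !qphi //.
  rewrite expr0 mul1r -realCX normcM normcC exprMn expr2 dirK mul1r (ger0_norm (sqr_ge0 y)).
  rewrite /w -mulrBr normcM n1 mul1r => b2 b0.
  have p : 0 < 1 + y ^+ 2 by rewrite ltr_pwDl // sqr_ge0.
  rewrite ler_pdivlMr // mulrDr mulr1 [_ * y ^+ 2]mulrC [leRHS]splitr.
  exact: lerD b0 b2.
- move=> t y ht y0; have /andP[t0 tT] := ht.
  have ht1 : 0 < t <= T by rewrite t0 ltW.
  have ht2 : 0 <= t <= T by rewrite !ltW.
  have hy : halfline s (dir s * y) by exact/dir_halfline.
  have [l1 l2] := hs_pde hs hy ht1.
  have -> : (dir s * sigma)%:C ^+ 3 * w 3%N t y = sigma%:C ^+ 3 * cderiv 3 (q^~ t) (dir s * y).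
    have d6 : (dir s)%:C ^+ 3 * (dir s)%:C ^+ 3 = 1 :> R[i].
      by rewrite -realCX dirX_cube -realCM dirK.
    by rewrite qphi // /w realCM exprMn mulrACA d6 mul1r.
  set d := sigma%:C ^+ 3 * _ in l1 l2 *.
  apply: cder_of_remainder => e e0; have e2 : 0 < e / 2 by rewrite divr_gt0.
  move/cvgrPdist_le: l1 => /(_ _ e2); move/cvgrPdist_le: l2 => /(_ _ e2).
  rewrite !near_withinE => l2 l1.
  have inT : \forall t' \near nbhs t, 0 <= t' <= T.
    have := @near_in_itvoo R 0 T t; rewrite in_itv => /(_ ht).
    by apply: filterS => t'; rewrite in_itv => /andP[/ltW-> /ltW->].
  apply: filterS2 inT (filterI l1 l2) => t' t'T [].
  have [->|nt] := eqVneq t' t.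
    by move=> _ _; rewrite !subrr realC0 mul0r subrr normc0E normr0 mulr0.
  have t't : 0 < `|t' - t| by rewrite normr_gt0 subr_eq0.
  have tin : (`[0, T]%classic : set R) t' by rewrite /= in_itv.
  move=> /(_ isT tin) a1 /(_ isT tin) a2.
  have [_ p1] := hphi t' t'T; have [_ p2] := hphi t ht2.
  rewrite !w0 -p1 // -p2 //.
  have tn : (t' - t)%:C != 0 :> R[i] by apply: realC_neq0; rewrite -normr_gt0.
  set z := q _ t' - q _ t in a1 a2 *.
  have -> : z - (t' - t)%:C * d = - ((t' - t)%:C * (d - (t' - t)^-1%:C * z)).
    have cancel : (t' - t)%:C * (t' - t)^-1%:C = 1 :> R[i].
      by rewrite -realCM mulfV // -normr_gt0.
    by rewrite [in RHS]mulrBr opprB [in RHS](mulrA (t' - t)%:C (t' - t)^-1%:C) cancel mul1r.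
  rewrite normcNE normcM normcC mulrC; apply: ler_wpM2r; first exact: normr_ge0.
  apply: le_trans (normc_le_ReIm _) _; rewrite [leRHS]splitr.
  by apply: lerD; rewrite !reimE; [move: a1|move: a2]; rewrite !reimE.
Qed.

End HalfSolutions.

(** * The representation formula on one side of the interface *)

Section OneSide.
Context {R : realType}.
Local Notation mu := (@lebesgue_measure R).

Lemma fourier_half s (u v : R -> R[i]) k : (forall y, 0 < y -> v y = u (dir s * y)) ->
  cintegrable `]0, +oo[ (fun y => cexp (- (ii * ((dir s)%:C * k) * y%:C)) * v y) ->
  fourier s u k = half_fourier v ((dir s)%:C * k).
Proof.
move=> uv iv; have m0 : measurableR `](0 : R), +oo[ by exact: measurable_itv.
have pos y : (`]0, +oo[%classic : set R) y -> 0 < y by rewrite /= in_itv /= andbT.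
case: s uv iv => uv iv; last first.
  rewrite /fourier /half_fourier /= realC1 mul1r; apply: cintegral_eq => y /pos y0.
  by rewrite uv // mul1r.
have iT := cintegrable_mkcond m0 iv.
have n1 : -1 != 0 :> R by rewrite oppr_eq0 oner_eq0.
have [_ e] := cintegral_scale n1 iT.
rewrite /fourier /half_fourier [RHS]cintegral_mkcond e normrN1 realC1 mul1r [LHS]cintegral_mkcond.
apply: cintegral_eq => x _; rewrite /extend0 mulN1r.
have mE : (- x \in (`]0, +oo[%classic : set R)) = (x \in (`]-oo, 0[%classic : set R)).
  by apply/idP/idP; rewrite !inE /= !in_itv /= ?andbT oppr_gt0.
rewrite mE /=; case: ifPn => // hx.
have x0 : 0 < - x by move: hx; rewrite inE /= in_itv /= oppr_gt0.
rewrite uv // /dir /= mulN1r opprK; congr (cexp (- _) * _).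
by rewrite !realCN realC1; ring.
Qed.

Definition trace_transform s (T : R) (q : R -> R -> R[i]) n (k : R[i]) : R[i] :=
  cintegral `[0, T] (fun tau => cexp (ii * k ^+ 3 * tau%:C) * trace s n (q^~ tau)).

Lemma measurable_sector_boundaries (rho : R) rs :
  measurable_curves (flatten [seq sector_boundary rho r | r <- rs]).
Proof.
elim: rs => [|r rs ih] [|[|[|i]]] //= hi; try exact: measurable_itv.
exact: ih.
Qed.

Lemma ici_sectors (rho : R) rs F :
  (forall r, r \in rs -> is_curve_integral (sector_boundary rho r) F 0) ->
  is_curve_integral (flatten [seq sector_boundary rho r | r <- rs]) F 0.
Proof.
elim: rs => [|r rs ih] h; first exact: abel_is_curve_integral (abel_nil F).
have h1 : is_curve_integral (sector_boundary rho r) F 0 by apply: h; rewrite mem_head.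
have h2 := ici_cat h1 (ih (fun r' hr' => h r' (mem_behead (s := r :: rs) hr'))).
by rewrite addr0 in h2.
Qed.

(** On the left the orientation is reversed; this is the sign [dir s]. *)
Lemma ici_Gamma s (sigma rho : R) F l :
  is_curve_integral (flatten [seq sector_boundary rho r | r <- sectors_of s sigma]) F l ->
  is_curve_integral (Gamma s sigma rho) F ((dir s)%:C * l).
Proof.
case: s => h; last by rewrite /dir /= realC1 mul1r.
have -> : Gamma Lft sigma rho =
    map opp_curve (flatten [seq sector_boundary rho r | r <- sectors_of Lft sigma]).
  by rewrite /Gamma map_flatten -map_comp.
rewrite /dir /= realCN realC1 mulN1r; apply: ici_opp h.
exact: measurable_sector_boundaries.
Qed.

Lemma cder_shift (t tau : R) : cder (fun tau => (tau - t)%:C) tau 1.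
Proof.
apply: cder_real; apply: is_derive_ext (is_deriveB (is_derive_id tau (1 : R)) (is_derive_cst t tau (1 : R))) => //.
exact: subr0.
Qed.

(** In the sectors of [D] the part [t < s <= T] of the boundary term decays, so it
    has zero integral along their boundary and may be added.  The functions [Z]
    stand for approximate transforms, whose error contributes nothing either. *)
Lemma half_formula s (sigma T rho : R) q0 q (Z : nat -> R[i] -> R[i]) (x t : R) :
  half_solution s sigma T q0 q -> sigma != 0 -> 0 <= rho -> halfline s x -> 0 < t < T ->
  is_curve_integral (flatten [seq sector_boundary rho r | r <- sectors_of s sigma])
    (fun k => cexp (ii * (k / sigma%:C) * x%:C - ii * k ^+ 3 * t%:C) *
      (sigma%:C ^+ 2 * (Z 2%N k - trace_transform s T q 2 k) + ii * k * sigma%:C * (Z 1%N k - trace_transform s T q 1 k)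
       - k ^+ 2 * (Z 0%N k - trace_transform s T q 0 k))) 0 ->
  exists I0 I1 : R[i],
    [/\ is_curve_integral real_line (fun k =>
          cexp (ii * k * x%:C - ii * sigma%:C ^+ 3 * k ^+ 3 * t%:C) * fourier s q0 k) I0,
        is_curve_integral (Gamma s sigma rho) (fun k =>
          cexp (ii * (k / sigma%:C) * x%:C - ii * k ^+ 3 * t%:C) *
          (sigma%:C ^+ 2 * Z 2%N k + ii * k * sigma%:C * Z 1%N k - k ^+ 2 * Z 0%N k)) I1 &
        q x t = (2 * pi)^-1%:C * I0 - (dir s)%:C * ((2 * pi)^-1%:C * I1)].
Proof.
move=> hs s0 r0 hx ht herr; have /andP[t0 tT] := ht.
have [w [H w0 wtr]] := half_data_of_solution hs.
pose kappa := dir s * sigma; pose y := dir s * x.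
have dn0 : (dir s : R) != 0 by rewrite -normr_gt0 normr_dir.
have k0 : kappa != 0 by rewrite mulf_neq0.
have xE : x = dir s * y by rewrite mulrA dirK mul1r.
have y0 : 0 < y by apply/(dir_halfline s); rewrite -xE.
have dC : (dir s)%:C * (dir s)%:C = 1 :> R[i] by rewrite -realCM dirK.
have le0T t' : 0 < t' < T -> 0 <= t' <= T by move=> /andP[/ltW-> /ltW->].
have h00 : 0 <= (0 : R) <= T by rewrite lexx ltW // (lt_trans t0).
have hTT : 0 <= T <= T by rewrite lexx ltW // (lt_trans t0).
have [l0 [l [h0 hl e]]] := half_representation H k0 ht y0 r0.
have sectE : upper_sectors kappa = sectors_of s sigma.
  by rewrite /upper_sectors /sectors_of /kappa /dir; case: (s); rewrite /= ?mul1r // mulN1r oppr_lt0.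
have wq : w 0%N t y = q x t by rewrite w0 ?le0T // -xE.
pose G := flatten [seq sector_boundary rho r | r <- sectors_of s sigma].
have mG : measurable_curves G by exact: measurable_sector_boundaries.
have GE : upper_contour kappa rho = G by rewrite /upper_contour sectE.
rewrite GE in hl.
pose D2 := (`]t, T]%classic : set R).
have mD1 : measurableR `[0, t] by exact: measurable_itv.
have mD2 : measurableR D2 by exact: measurable_itv.
have DU : `[0, t]%classic `|` D2 = `[0, T]%classic.
  by rewrite -itv_bndbnd_setU // bnd_simp ltW.
have ib n : (n <= 2)%N -> cintegrable `[0, T] (traces w n).
  by move=> n2; exact: (traces_integrable H n2 hTT).
have ib2 n : (n <= 2)%N -> cintegrable D2 (traces w n).
  move=> n2; apply: cintegrableS (ib n n2); [exact: measurable_itv|exact: mD2|].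
  by rewrite -DU => z hz; right.
have bT z : (`[0, T]%classic : set R) z -> `|z - t| <= T.
  by rewrite /= in_itv /= => /andP[z0 zT]; rewrite ler_norml; apply/andP; split; lra.
have T0 : 0 <= T by exact: ltW (lt_trans t0 tT).
have tail : is_curve_integral G (boundary_term kappa D2 (traces w) t y) 0.
  apply: ici_sectors => r; rewrite -sectE => hr.
  have ab : above kappa r.
    move: hr; rewrite /above /upper_sectors; case: ltgtP k0 => // _ _.
      by rewrite !inE => /eqP->.
    by rewrite !inE => /orP[] /eqP->.
  have [n rn n_even] : exists2 n, r = n.+1 & odd n = false.
    move: hr; rewrite /upper_sectors; case: ifP => _; rewrite !inE.
      by move=> /eqP->; exists 4%N.
    by move=> /orP[] /eqP->; [exists 0%N|exists 2%N].
  rewrite {}rn in ab *.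
  have dD2 z : D2 z -> 0 <= z - t by rewrite /D2 /= in_itv /= subr_ge0 => /andP[/ltW].
  have bD2 z : D2 z -> `|z - t| <= T by move=> hz; apply: bT; rewrite -DU; right.
  apply: (sector_boundary_abel0 (S := setT) (superp_boundary_term _ _ _ mD2 ib2 T0 bD2) r0 y0 k0 ab) => //.
  apply: (grows_boundary_term kappa y mD2 ib2 r0) => z hz.
  by rewrite -signr_odd n_even mul1r dD2.
have bE k : boundary_term kappa `[0, T] (traces w) t y k =
    cexp (ii * (k / sigma%:C) * x%:C - ii * k ^+ 3 * t%:C) *
      (sigma%:C ^+ 2 * trace_transform s T q 2 k + ii * k * sigma%:C * trace_transform s T q 1 k
       - k ^+ 2 * trace_transform s T q 0 k).
  have mT : measurableR `[0, T] by exact: measurable_itv.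
  have tE n : (n <= 2)%N -> (dir s)%:C ^+ n * trace_transform s T q n k =
      cexp (ii * k ^+ 3 * t%:C) * time_transform `[0, T] (traces w n) t k.
    move=> n2.
    have it (f g : R -> R[i]) : (forall tau, cder f tau (g tau)) ->
        cintegrable `[0, T] (fun tau => cexp (f tau) * traces w n tau).
      move=> df; apply: cintegrable_cont; apply: ccont_onM (trace_cont H n2).
      by apply: cderiv_ccont_itv => z _; eexists; apply: cder_cexp; exact: df.
    have i1 := it _ _ (fun tau => cderZ (ii * k ^+ 3) (cder_id tau)).
    have i2 := it _ _ (fun tau => cderM (cder_shift t tau) (cder_cst tau (ii * k ^+ 3))).
    have trE z : (`[0, T]%classic : set R) z -> trace s n (q^~ z) = (dir s)%:C ^+ n * traces w n z.
      rewrite /= in_itv => hz; rewrite /traces wtr // mulrA -exprMn.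
      by rewrite dC expr1n mul1r.
    have -> : trace_transform s T q n k = (dir s)%:C ^+ n *
        cintegral `[0, T] (fun tau => cexp (ii * k ^+ 3 * tau%:C) * traces w n tau).
      rewrite -(cintegralZ _ mT i1); apply: cintegral_eq => z hz.
      by rewrite trE // mulrCA.
    rewrite mulrA -exprMn dC expr1n mul1r /time_transform -(cintegralZ _ mT i2).
    apply: cintegral_eq => z hz; rewrite [RHS]mulrA -cexpD; congr (cexp _ * _).
    by rewrite realCB; ring.
  have e2 := tE 2%N isT; have e1 := tE 1%N isT; have e0 := tE 0%N isT.
  have ee : cexp (- (ii * k ^+ 3 * t%:C)) * cexp (ii * k ^+ 3 * t%:C) = 1 :> R[i].
    by rewrite -cexpD addNr cexp0.
  have xk : ii * (k / kappa%:C) * y%:C = ii * (k / sigma%:C) * x%:C.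
    have sn := realC_neq0 s0; have dn := realC_neq0 dn0.
    by rewrite /kappa /y !realCM; field; rewrite sn dn.
  rewrite /boundary_term xk cexpD /kappa realCM.
  rewrite expr0 mul1r in e0; rewrite expr1 in e1.
  move: e2 e1 e0 ee; move: (cexp (- (ii * k ^+ 3 * t%:C))) (cexp (ii * k ^+ 3 * t%:C)) => e' E1.
  move: (cexp (ii * (k / sigma%:C) * x%:C)) => E2.
  move: (time_transform _ (traces w 2) t k) (time_transform _ (traces w 1) t k) (time_transform _ (traces w 0) t k)
    (trace_transform s T q 2 k) (trace_transform s T q 1 k) (trace_transform s T q 0 k) => u2 u1 u0 z2 z1 z0 a2 a1 a0 ee.
  have g2 : u2 = e' * ((dir s)%:C ^+ 2 * z2) by rewrite a2 mulrA ee mul1r.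
  have g1 : u1 = e' * ((dir s)%:C * z1) by rewrite a1 mulrA ee mul1r.
  have g0 : u0 = e' * z0 by rewrite a0 mulrA ee mul1r.
  rewrite -[RHS]mulrA; congr (_ * _); rewrite g2 g1 g0 exprMn (expr2 (dir s)%:C) dC !mul1r.
  have -> : ii * k * ((dir s)%:C * sigma%:C) * (e' * ((dir s)%:C * z1)) =
     (dir s)%:C * (dir s)%:C * (ii * k * sigma%:C * (e' * z1)) by ring.
  by rewrite dC mul1r; ring.
have lin (e1 a b c z2 z1 z0 y2 y1 y' : R[i]) : e1 * (a * y2 + b * y1 - c * y') +
    e1 * (a * (z2 - y2) + b * (z1 - y1) - c * (z0 - y')) = e1 * (a * z2 + b * z1 - c * z0).
  by ring.
have total : is_curve_integral G (fun k =>
    cexp (ii * (k / sigma%:C) * x%:C - ii * k ^+ 3 * t%:C) *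
    (sigma%:C ^+ 2 * Z 2%N k + ii * k * sigma%:C * Z 1%N k - k ^+ 2 * Z 0%N k)) l.
  have := ici_D mG (ici_D mG hl tail) herr; rewrite !addr0.
  apply: ici_eq => i hi; split; first exact: mG.
  move=> z _; move: (pos _ z) => k.
  have U := @boundary_term_setU _ kappa `[0, t] D2 (traces w) t y k mD1 mD2.
  rewrite DU in U; rewrite -U; first last.
  - by exists T => // z'; exact: bT.
  - exact: ib.
  - apply/disj_setPS => z' []; rewrite /D2 /= !in_itv /= => /andP[_ h1] /andP[h2 _].
    by move: (lt_le_trans h2 h1); rewrite ltxx.
  rewrite bE; exact: lin.
have line0 : is_curve_integral real_line (fun k =>
    cexp (ii * k * x%:C - ii * sigma%:C ^+ 3 * k ^+ 3 * t%:C) * fourier s q0 k) l0.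
  have := ici_scale dn0 h0; rewrite normr_dir invr1 realC1 mul1r.
  apply: ici_eq => -[|i] //= _; split; first exact: measurableT.
  move=> z _; set k : R[i] := z%:C.
  have Imk : Im ((dir s)%:C * k) <= 0 by rewrite /k -realCM ImC.
  rewrite (fourier_half (v := w 0%N 0) _ (hd_integrable H 0 h00 Imk)); last first.
    move=> y' y'0; rewrite w0 //; apply: (hs_initial hs).
    exact/dir_halfline.
  congr (cexp _ * _).
  have d3 : (dir s)%:C ^+ 3 = (dir s)%:C :> R[i] by rewrite -realCX dirX_cube.
  rewrite (realCM (dir s) sigma) (exprMn 3 (dir s)%:C sigma%:C) (exprMn 3 (dir s)%:C k) d3 /y (realCM (dir s) x).
  have -> : ii * ((dir s)%:C * k) * ((dir s)%:C * x%:C) =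
    (dir s)%:C * (dir s)%:C * (ii * k * x%:C) by ring.
  have -> : ii * ((dir s)%:C * sigma%:C ^+ 3) * ((dir s)%:C * k ^+ 3) * t%:C =
    (dir s)%:C * (dir s)%:C * (ii * sigma%:C ^+ 3 * k ^+ 3 * t%:C) by ring.
  by rewrite dC !mul1r.
exists l0, ((dir s)%:C * l); split; first exact: line0.
  exact: ici_Gamma total.
rewrite -wq; have p0 : (2 * pi)%:C != 0 :> R[i].
  by apply: realC_neq0; rewrite mulf_neq0 // gt_eqF // pi_gt0.
have pV : (2 * pi)^-1%:C = (2 * pi)%:C^-1 :> R[i] by rewrite realCV.
have -> : (dir s)%:C * ((2 * pi)^-1%:C * ((dir s)%:C * l)) =
  (dir s)%:C * (dir s)%:C * ((2 * pi)^-1%:C * l) by ring.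
by rewrite dC mul1r -mulrBr -e pV mulrA mulVf // mul1r.
Qed.

End OneSide.

(** * Geometry of the sectors *)

Section SectorGeometry.
Context {R : realType}.

Lemma cnbhsP (z : R[i]) (A : set (R[i])^o) :
  nbhs (z : (R[i])^o) A <-> exists2 e : R, 0 < e & forall k, normc (z - k) < e -> A k.
Proof.
split=> [/nbhs_ballP[e e0 h]|[e e0 h]].
  have [e1 e2] : e = (Re e)%:C /\ 0 < Re e.
    by move: e0; case: (e) => a b /=; rewrite ltcE /= => /andP[/eqP-> ->].
  exists (Re e) => // k hk; apply: h; rewrite /ball /= normc_norm e1 ltcR //.
apply/nbhs_ballP; exists e%:C; first by rewrite /= ltcR.
move=> k; rewrite /ball /= normc_norm ltcR; exact: h.
Qed.

(** Points of the closed sector are approached by moving outwards and towards the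
    bisector. *)
Lemma sector_set_closure (rho : R) r : 0 <= rho ->
  sector_set rho r.+1 `<=` closure (Dsec rho r.+1).
Proof.
move=> r0 k [s [th [rs /andP[h1 h2] ->]]] A /cnbhsP[e e0 hA].
have p := @pi_gt0 R; have s0 := le_trans r0 rs.
(* The argument moves by the fraction [eta] of its distance to the bisector; [W]
   converts this into a displacement. *)
pose mid : R := (sector_lo r.+1 + sector_hi r.+1) / 2.
have lohi : sector_lo r.+1 < sector_hi r.+1 :> R.
  by rewrite /sector_lo /sector_hi /= ltr_pM2r ?invr_gt0 // ltr_pM2r // ltr_nat.
pose W := s * (2 * `|mid - th|) + 1.
have W0 : 0 < W by rewrite ltr_wpDl // !mulr_ge0.
pose eta := Num.min (1 / 2) (e / (2 * W)).
have eta0 : 0 < eta by rewrite lt_min !divr_gt0 // mulr_gt0.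
have eta1 : eta <= 1 / 2 by rewrite ge_min lexx.
have eta2 : eta * W <= e / 2.
  have : eta <= e / (2 * W) by rewrite ge_min lexx orbT.
  by rewrite ler_pdivlMr ?mulr_gt0 // => h; lra.
pose th' := th + eta * (mid - th).
exists (polar (s + e / 4) th'); split.
  exists (s + e / 4), th'; split => //; first by rewrite ltr_pwDr ?divr_gt0 // (le_lt_trans rs).
  have m1 : sector_lo r.+1 < mid by rewrite /mid; lra.
  have m2 : mid < sector_hi r.+1 by rewrite /mid; lra.
  apply/andP; split; rewrite /th'; nra.
apply: hA.
have -> : polar s th - polar (s + e / 4) th' =
    s%:C * (cexp (ii * th%:C) * (1 - cexp (ii * (eta * (mid - th))%:C))) - (e / 4)%:C * cexp (ii * th'%:C).
  rewrite /polar realCD mulrDl opprD addrA; congr (_ - _).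
  by rewrite mulrBr mulr1 -cexpD mulrBr /th' realCD mulrDr.
apply: le_lt_trans (normcB _ _) _.
rewrite (normcM s%:C) (normcM (cexp (ii * th%:C))) (normcM (e / 4)%:C) !normc_expi !normcC mul1r mulr1 (ger0_norm s0) (gtr0_norm (divr_gt0 e0 _)) //.
have : normc (1 - cexp (ii * (eta * (mid - th))%:C)) <= 2 * (eta * `|mid - th|).
  rewrite -normcNE opprB; apply: le_trans (normc_cexp_sub1 _) _.
    by rewrite !reimE !(mul0r, mulr0, subr0).
  by rewrite normcM normcI mul1r normcC normrM (gtr0_norm eta0).
move=> h; have := ler_wpM2l s0 h => h'.
have e2 : s * (2 * (eta * `|mid - th|)) = eta * (W - 1) by rewrite /W; ring.
move: h'; rewrite e2 => h'; lra.
Qed.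

(** Each linear factor stays away from zero, its root having a positive distance
    to the closed set. *)
Lemma poly_lower_bound (p : {poly R[i]}) (A : set (R[i])^o) :
  (forall k, closure A k -> p.[k] != 0) ->
  exists2 c : R, 0 < c & forall k, closure A k -> c <= normc p.[k].
Proof.
move=> hp; have [p0|p0] := eqVneq p 0.
  by exists 1 => // k /hp; rewrite p0 horner0 eqxx.
have [rs prs] := closed_field_poly_normal p.
have factor z : ~ closure A z ->
    exists2 c : R, 0 < c & forall k, closure A k -> c <= normc (k - z).
  move=> nz; have : nbhs (z : (R[i])^o) (~` closure A).
    apply: open_nbhs_nbhs; split; first exact/closed_openC/closed_closure.
    exact: nz.
  move=> /cnbhsP[e e0 h]; exists e => [|k hk]; first exact: e0.
  by rewrite leNgt; apply/negP => hlt; apply: h hk; rewrite -normcNE opprB.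
have : forall z, z \in rs -> ~ closure A z.
  move=> z hz hc; have := hp z hc; rewrite prs hornerZ horner_prod.
  by rewrite (big_rem z) //= hornerXsubC subrr mul0r mulr0 eqxx.
have lc0 : 0 < normc (lead_coef p).
  by rewrite lt_neqAle normc_ge0 eq_sym normc_eq0 lead_coef_eq0 p0.
rewrite prs => hrs.
suff [c c0 hc] : exists2 c : R, 0 < c &
    forall k, closure A k -> c <= normc (\prod_(z <- rs) ('X - z%:P)).[k].
  exists (normc (lead_coef p) * c) => [|k hk]; first exact: mulr_gt0.
  by rewrite hornerZ normcM ler_wpM2l ?(ltW lc0) // hc.
elim: rs {prs} hrs => [|z rs ih] hrs.
  by exists 1 => // k _; rewrite big_nil hornerC normc1E.
have [c1 c10 h1] := factor z (hrs z (mem_head _ _)).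
have [|c2 c20 h2] := ih; first by move=> z' hz'; apply: hrs; rewrite in_cons hz' orbT.
exists (c1 * c2) => [|k hk]; first exact: mulr_gt0.
rewrite big_cons hornerM hornerXsubC normcM.
by apply: ler_pM; [exact: ltW|exact: ltW|exact: h1|exact: h2].
Qed.

Lemma realC_nat n : n%:R%:C = n%:R :> R[i].
Proof. by elim: n => [|n ih]; rewrite ?realC0 // -!natr1 realCD ih. Qed.

Lemma alphaX_polar n (s theta : R) :
  alpha ^+ n * polar s theta = polar s (theta + n%:R * (2 * pi / 3)).
Proof.
rewrite /alpha -cexpM_nat /polar mulrCA -cexpD; congr (_ * cexp _).
by rewrite -mulr_natl realCD (realCM n%:R) realC_nat; ring.
Qed.

Lemma alphaX3 n : (alpha ^+ n) ^+ 3 = 1 :> R[i].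
Proof.
rewrite -exprM mulnC exprM /alpha -cexpM_nat.
have -> : ii * (2 * pi / 3)%:C *+ 3 = ii * (2 * pi)%:C :> R[i].
  by rewrite -mulrnAr -[_ *+ 3]mulr_natl -realC_nat -realCM; congr (_ * _%:C); field.
by rewrite cexpi_2pi expr1n.
Qed.

(** Multiplication by [alpha ^ n] moves the sector of index [r.+1] onto the one of
    index [r + 2 n + 1], and three consecutive sectors make up a half plane. *)
Lemma Im_rotated (kappa s theta : R) r n m : 0 <= s ->
  sector_lo r.+1 <= theta <= sector_hi r.+1 -> (3 * m <= r + 2 * n < 3 * m + 3)%N ->
  (-1) ^+ m * kappa < 0 -> Im (alpha ^+ n * polar s theta / kappa%:C) <= 0.
Proof.
move=> s0 /andP[h1 h2] /andP[n1 n2] mk.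
have p := @pi_gt0 R; rewrite alphaX_polar -realCV mulrC ImM ReC ImC mul0r addr0 Im_polar.
set x := theta + _.
have hx : 0 <= (-1) ^+ m * sin x.
  apply: sin_half_turn.
  have a1 : (3 * m)%N%:R <= (r + 2 * n)%N%:R :> R by rewrite ler_nat.
  have a2 : (r + 2 * n)%N.+1%:R <= (3 * m + 3)%N%:R :> R by rewrite ler_nat.
  move: a1 a2; rewrite -natr1 (natrD _ r) (natrD _ (3 * m)%N) !(natrM _ 3) (natrM _ 2) => a1 a2.
  move: h1 h2; rewrite /sector_lo /sector_hi /x -(natr1 r) -(natr1 m) /= => h1 h2.
  have b1 := ler_wpM2r (ltW p) a1; have b2 := ler_wpM2r (ltW p) a2.
  apply/andP; split; lra.
have -> : kappa^-1 * (s * sin x) = ((-1) ^+ m * kappa)^-1 * (s * ((-1) ^+ m * sin x)).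
  rewrite invfM -exprVn invrN1.
  have -> : (-1) ^+ m * kappa^-1 * (s * ((-1) ^+ m * sin x)) =
    ((-1) ^+ m * (-1) ^+ m) * (kappa^-1 * (s * sin x)) by ring.
  by rewrite -expr2 sqrr_sign mul1r.
by rewrite mulr_le0_ge0 // ?invr_le0 ?(ltW mk) // mulr_ge0.
Qed.

End SectorGeometry.

(** * Terms at the final time *)

Section ErrorTerms.
Context {R : realType}.
Variables (rho : R) (n : nat).
Hypothesis rho0 : 0 <= rho.
Hypothesis n_even : odd n = false.
Let S := @sector_set R rho n.+1.

Lemma sector_boundary_points i z :
  (i < size (sector_boundary rho n.+1))%N ->
  let c := nth (Curve set0 (fun=> 0) (fun=> 0)) (sector_boundary rho n.+1) i in
  dom c z -> S (pos c z).
Proof.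
have lh := @sector_lo_hi R n.+1.
case: i => [|[|[|i]]] //= _; rewrite in_itv /= ?andbT => hz.
- by exists z, (sector_hi n.+1); rewrite lexx lh.
- by exists rho, z.
- by exists z, (sector_lo n.+1); rewrite lexx lh.
Qed.

Lemma ici_eq_sector F G l : (forall k, S k -> F k = G k) ->
  is_curve_integral (sector_boundary rho n.+1) F l ->
  is_curve_integral (sector_boundary rho n.+1) G l.
Proof.
move=> e; apply: ici_eq => i hi; split; last first.
  by move=> z hz; apply: e; exact: sector_boundary_points hi hz.
by case: i hi => [|[|[|i]]] //= _; exact: measurable_itv.
Qed.

Variables (kappa T : R) (w : nat -> R -> R -> R[i]).
Hypothesis H : half_data kappa T w.
Hypothesis T0 : 0 <= T.

(** One summand of the error made by leaving out the unknown terms of the linear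
    system: the transform at the final time, times a rational function without
    poles in the sector and the exponential that propagates from the final time
    back to [t]. *)
Definition error_term (x sigma t : R) (Q d : {poly R[i]}) (a k : R[i]) : R[i] :=
  cexp (ii * (k / sigma%:C) * x%:C - ii * k ^+ 3 * t%:C) *
  (Q.[k] * d.[k]^-1 * (cexp (ii * k ^+ 3 * T%:C) * half_fourier (w 0 T) (a * k))).

Variables (x sigma t : R) (Q d : {poly R[i]}) (a : R[i]) (c : R).
Hypothesis c0 : 0 < c.
Hypothesis dc : forall k, S k -> c <= normc d.[k].
Hypothesis Sa : forall k, S k -> Im (a * k) <= 0.
Hypothesis tT : t <= T.

Let hT : 0 <= T <= T. Proof. by rewrite T0 lexx. Qed.

Lemma superp_error_term : superp S (error_term x sigma t Q d a).
Proof.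
have e3 : elem S (fun k : R[i] => ii * k ^+ 3) by apply: elemZ; apply: elemX; exact: elem_id.
apply: superp_mul.
  apply: elem_cexp; apply: elemB.
    by apply: elemM (elem_cst _ _); apply: elemZ; exact: elemM (elem_id _) (elem_cst _ _).
  exact: elemM e3 (elem_cst _ _).
apply: superp_mul; first exact: elemM (elem_horner _ Q) (elemV c0 dc (elem_horner _ d)).
apply: superp_mul; first by apply: elem_cexp; exact: elemM e3 (elem_cst _ _).
exact: (superp_half_fourier H hT Sa).
Qed.

Lemma grows_error_term :
  grows (sector_lo n.+1) (sector_hi n.+1) rho (x / sigma) (error_term x sigma t Q d a).
Proof.
have inS s th : rho <= s -> sector_lo n.+1 <= th <= sector_hi n.+1 -> S (polar s th).
  by move=> h1 h2; exists s, th.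
have gQ := grows_horner (sector_lo n.+1) (sector_hi n.+1) Q rho0.
have gd : grows (sector_lo n.+1) (sector_hi n.+1) rho 0 (fun k => d.[k]^-1).
  apply: (grows_bounded (C := c^-1) rho0) => s th hs hth.
  have dk := dc (inS s th hs hth); have nd : d.[polar s th] != 0.
    by rewrite -normc_eq0 gt_eqF // (lt_le_trans c0).
  by rewrite normcVE lef_pV2 ?posrE // (lt_le_trans c0).
have [C hC] := half_fourier_bounded H hT.
have gV : grows (sector_lo n.+1) (sector_hi n.+1) rho 0 (fun k => half_fourier (w 0 T) (a * k)).
  apply: (grows_bounded (C := C) rho0) => s th hs hth.
  by apply: hC; apply: Sa; exact: inS.
have gE : grows (sector_lo n.+1) (sector_hi n.+1) rho 0
    (fun k => cexp (ii * k ^+ 3 * (T - t)%:C)).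
  apply: (grows_bounded (C := 1) rho0) => s th hs hth.
  have := Re_cube_sector (le_trans rho0 hs) hth; rewrite -signr_odd n_even mul1r => h.
  rewrite normc_cexp -[leRHS]expR0 ler_expR ReM ReC ImC mulr0 subr0.
  by apply: mulr_le0_ge0 h _; rewrite subr_ge0.
have gX := grows_cexp (sector_lo n.+1) (sector_hi n.+1) (x / sigma) rho0.
have := growsM gX (growsM gE (growsM (growsM gQ gd) gV)); rewrite !addr0.
apply: grows_eq => s th _ _; rewrite /error_term; set k := polar s th.
have -> : ii * k ^+ 3 * (T - t)%:C = - (ii * k ^+ 3 * t%:C) + ii * k ^+ 3 * T%:C.
  by rewrite realCB; ring.
have -> : ii * ((x / sigma)%:C * k) = ii * (k / sigma%:C) * x%:C.
  by rewrite realCM realCV; ring.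
rewrite !cexpD; move: (cexp _) (cexp _) (cexp _) (half_fourier _ _) (d.[k]^-1) => e1 e2 e3 V D.
by ring.
Qed.

(** [exp (i k^3 (T - t))] is bounded in the sectors of [D] because [t <= T], and
    [exp (i k x / sigma)] supplies the decay. *)
Lemma error_term_ici0 kappa' y : 0 < y -> kappa' != 0 -> above kappa' n.+1 ->
  y / kappa' = x / sigma ->
  is_curve_integral (sector_boundary rho n.+1) (error_term x sigma t Q d a) 0.
Proof.
move=> y0 k0 ab e.
apply: (sector_boundary_abel0 superp_error_term rho0 y0 k0 ab (@subset_refl _ _)).
by rewrite e; exact: grows_error_term.
Qed.

End ErrorTerms.

Lemma ici_sum {R : realType} (G : seq curve) (J : Type) (s : seq J)
    (F : J -> R[i] -> R[i]) : measurable_curves G ->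
  is_curve_integral G (fun=> 0) 0 ->
  (forall j, is_curve_integral G (F j) 0) ->
  is_curve_integral G (fun k => \sum_(j <- s) F j k) 0.
Proof.
move=> mG h0 hF; elim: s => [|j s ih].
  by apply: (eq_ind (fun=> 0) (fun F => is_curve_integral G F 0) h0);
    apply/funext => k; rewrite big_nil.
have := ici_D mG (hF j) ih; rewrite addr0 => h.
by apply: (eq_ind _ (fun F => is_curve_integral G F 0) h); apply/funext => k; rewrite big_cons.
Qed.

Lemma ici_zero {R : realType} (G : seq (@curve R)) : measurable_curves G ->
  is_curve_integral G (fun=> 0) 0.
Proof.
move=> mG; have z c eps (s : R) : damped eps (fun=> 0) (pos c s) * vel c s = 0 :> R[i].
  by rewrite /damped mulr0 mul0r.
have ci0 eps : curve_integral G (damped eps (fun=> 0)) = 0.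
  rewrite /curve_integral big1 // => c _.
  rewrite (cintegral_eq (v := fun=> 0)) => [|x _]; last exact: z.
  by rewrite /cintegral /Rintegral !integral0.
split=> [eps _ i hi|].
  apply: (cintegrable_eq (mG i hi) (u := fun=> 0)) => [x _|]; first exact: esym (z _ eps x).
  exact: cintegrable0 (mG i hi).
have -> : (fun eps => curve_integral G (fun k => (expR (- eps * normc k))%:C * (0 : R[i]))) =
    (fun=> 0) by apply/funext => eps; exact: ci0.
exact: ccvg_cst.
Qed.

(** * The linear system *)

Section LinearSystem.
Context {R : realType}.

Lemma castmx_mulmx (U : pzRingType) m m' n p (e : m = m') (M : 'M[U]_(m, n)) (X : 'M[U]_(n, p)) :
  castmx (e, erefl) M *m X = castmx (e, erefl) (M *m X).
Proof. by case: _ / e; rewrite !castmx_id. Qed.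

Lemma castmx_add (U : pzRingType) m m' n (e : m = m') (M N : 'M[U]_(m, n)) :
  castmx (e, erefl) (M + N) = castmx (e, erefl) M + castmx (e, erefl) N.
Proof. by case: _ / e; rewrite !castmx_id. Qed.

(** Polynomial entries make the determinant and the cofactors polynomials too,
    uniformly in [k]. *)
Lemma system_matrix_poly c (sigma1 sigma2 : R) beta r :
  exists P : 'M[{poly R[i]}]_(3 + 3), forall k,
    @system_matrix _ c sigma1 sigma2 beta r k = map_mx (horner_eval k) P.
Proof.
have rel s sigma (gamma : R[i]) j :
    exists p : {poly R[i]}, forall k, relation_row s sigma gamma k 0 j = p.[k].
  pose w (n : 'I_3) : {poly R[i]} := ((ii * gamma) *: 'X) ^+ (2 - n) * (sigma%:C ^+ n.+1)%:P.
  have wE (n : 'I_3) k : (w n).[k] = (ii * gamma * k) ^+ (2 - n) * sigma%:C ^+ n.+1.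
    by rewrite /w hornerM horner_exp hornerZ hornerX hornerC.
  case: s; case: (split_ordP j) => n ->.
  - by exists (w n) => k; rewrite row_mxEl mxE wE.
  - by exists 0 => k; rewrite row_mxEr mxE horner0.
  - by exists 0 => k; rewrite row_mxEl mxE horner0.
  - by exists (- w n) => k; rewrite row_mxEr !mxE hornerN wE.
have ex i j : exists p : {poly R[i]}, forall k,
    @system_matrix _ c sigma1 sigma2 beta r k i j = p.[k].
  rewrite /system_matrix; set i' := cast_ord (esym (nconds_relations c)) i.
  have [i0 ei|i0 ei] := split_ordP i'.
    by exists (beta i0 j)%:P => k; rewrite castmxE -/i' ei col_mxEu cast_ord_id hornerC.
  case e : (relation_of c r i0) => [s p].
  have [q hq] := rel s (pick_side s sigma1 sigma2) (alpha ^+ p) j.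
  by exists q => k; rewrite castmxE -/i' ei col_mxEd cast_ord_id mxE e -hq.
have [P hP] := choice (fun ij : 'I_(3 + 3) * 'I_(3 + 3) => ex ij.1 ij.2).
exists (\matrix_(i, j) P (i, j)) => k; apply/matrixP => i j.
by rewrite !mxE (hP (i, j)).
Qed.

Lemma solve_poly n (P : 'M[{poly R[i]}]_n) k (X W : 'cV[R[i]]_n) :
  (\det P).[k] != 0 -> map_mx (horner_eval k) P *m X = W ->
  forall i, X i 0 = \sum_j (\adj P i j).[k] * (\det P).[k]^-1 * W j 0.
Proof.
move=> d0 e i.
have h : (\det P).[k] *: X = map_mx (horner_eval k) (\adj P) *m W.
  rewrite -e mulmxA -map_mxM mul_adj_mx map_scalar_mx /= mul_scalar_mx.
  by [].
have -> : X i 0 = (\det P).[k]^-1 * ((\det P).[k] *: X) i 0 by rewrite mxE mulrA mulVf // mul1r.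
rewrite h mxE mulr_sumr; apply: eq_bigr => j _.
by rewrite !mxE /horner_eval mulrA [_^-1 * _]mulrC.
Qed.

End LinearSystem.

Lemma sum_ord3 {U : nmodType} (u : nat -> U) : \sum_(n < 3) u n = u 0%N + u 1%N + u 2%N.
Proof. by rewrite !big_ord_recl big_ord0 addr0 addrA. Qed.

Lemma relation_algebra {U : realType} (D S g k a2 a1 a0 : U[i]) : D * D = 1 -> S != 0 ->
  (ii * g * k) ^+ 2 * S * a0 + ii * g * k * S ^+ 2 * a1 + S ^+ 3 * a2 =
  D * ((D * S) ^+ 3 *
    (a2 + ii * (D * (g * k / S)) * D * a1 - (D * (g * k / S)) ^+ 2 * a0)).
Proof.
move=> dd s0.
have -> : D * ((D * S) ^+ 3 *
    (a2 + ii * (D * (g * k / S)) * D * a1 - (D * (g * k / S)) ^+ 2 * a0)) =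
  (D * D) ^+ 2 * (S ^+ 3 * a2) + (D * D) ^+ 3 * (ii * g * k * S ^+ 2 * a1)
  - (D * D) ^+ 3 * (g ^+ 2 * k ^+ 2 * S * a0) by field.
rewrite dd !expr1n !mul1r.
have -> : (ii * g * k) ^+ 2 = (ii * ii) * (g ^+ 2 * k ^+ 2) :> U[i] by ring.
by rewrite iiK; ring.
Qed.

Section TrueTransforms.
Context {R : realType}.
Variables (s : side) (sigma T : R) (q0 : R -> R[i]) (q : R -> R -> R[i]).
Hypothesis hs : half_solution s sigma T q0 q.
Hypothesis sigma0 : sigma != 0.
Hypothesis T0 : 0 <= T.

Lemma trace_initial n : trace s n q0 = trace s n (q^~ 0).
Proof.
have h0 : 0 <= (0 : R) <= T by rewrite lexx T0.
have [phi sphi hphi] := hs_schwartz hs h0.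
rewrite (trace_local n sphi hphi); apply: (trace_local n sphi) => x hx.
by rewrite -(hs_initial hs hx); exact: hphi.
Qed.

Lemma trace_transform_integrable n k : (n <= 2)%N ->
  cintegrable `[0, T] (fun tau => cexp (ii * k ^+ 3 * tau%:C) * trace s n (q^~ tau)).
Proof.
move=> n2; have [w [H _ wtr]] := half_data_of_solution hs.
have mT : measurableR `[0, T] by exact: measurable_itv.
have dn : (dir s)%:C != 0 :> R[i].
  by apply: realC_neq0; rewrite -normr_gt0 normr_dir.
have i1 : cintegrable `[0, T] (fun tau => ((dir s)%:C ^+ n)^-1 *
    (cexp (ii * k ^+ 3 * tau%:C) * w n tau 0)).
  apply: cintegrableZ mT _; apply: cintegrable_cont; apply: ccont_onM (trace_cont H n2).
  by apply: cderiv_ccont_itv => z _; eexists; apply: cder_cexp; apply: cderZ; exact: cder_id.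
apply: (cintegrable_eq mT _ i1) => tau htau.
have ht : 0 <= tau <= T by move: htau; rewrite /= in_itv.
by rewrite wtr // mulrCA; congr (_ * _); rewrite mulrA mulVf ?mul1r // expf_neq0.
Qed.

(** The global relation at [gamma k / kappa]: the cube removes [gamma], and the
    powers of [dir s] that rescale the traces recombine with those of [kappa]. *)
Lemma relation_true w gamma k : half_data (dir s * sigma) T w ->
  (forall t y, 0 <= t <= T -> 0 < y -> w 0%N t y = q (dir s * y) t) ->
  (forall n t, 0 <= t <= T -> w n t 0 = (dir s)%:C ^+ n * trace s n (q^~ t)) ->
  gamma ^+ 3 = 1 -> Im (gamma * k / (dir s * sigma)%:C) <= 0 ->
  \sum_(n < 3) (ii * gamma * k) ^+ (2 - n) * sigma%:C ^+ n.+1 * trace_transform s T q n k =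
  (dir s)%:C * (fourier s q0 (gamma * k / sigma%:C) -
    cexp (ii * k ^+ 3 * T%:C) * half_fourier (w 0%N T) (gamma * k / (dir s * sigma)%:C)).
Proof.
move=> H w0 wtr g3 hIm.
have hTT : 0 <= T <= T by rewrite T0 lexx.
have h0 : 0 <= (0 : R) <= T by rewrite lexx T0.
have mT : measurableR `[0, T] by exact: measurable_itv.
have sn := realC_neq0 sigma0.
have dd : (dir s)%:C * (dir s)%:C = 1 :> R[i] by rewrite -realCM dirK.
have dn : (dir s)%:C != 0 :> R[i].
  by apply: realC_neq0; rewrite -normr_gt0 normr_dir.
have kE : gamma * k / (dir s * sigma)%:C = (dir s)%:C * (gamma * k / sigma%:C).
  have dV : (dir s)%:C^-1 = (dir s)%:C :> R[i].
    by apply: (mulfI dn); rewrite mulfV // dd.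
  by rewrite realCM invfM dV; ring.
have fE : fourier s q0 (gamma * k / sigma%:C) =
    half_fourier (w 0%N 0) (gamma * k / (dir s * sigma)%:C).
  rewrite kE; apply: fourier_half.
    move=> y y0; rewrite w0 //; apply: (hs_initial hs); exact/dir_halfline.
  by rewrite -kE; exact: (hd_integrable H 0 h0 hIm).
have g := global_relation H hTT hIm.
have z3 : ii * (dir s * sigma)%:C ^+ 3 * (gamma * k / (dir s * sigma)%:C) ^+ 3 = ii * k ^+ 3.
  have Kn : (dir s * sigma)%:C != 0 :> R[i] by rewrite realCM mulf_neq0.
  rewrite -[in RHS](mul1r (k ^+ 3)) -g3; move: (dir s * sigma)%:C Kn => K Kn.
  by field.
rewrite z3 in g; rewrite fE.
pose A n := trace_transform s T q n k.
pose b s' := cexp (ii * k ^+ 3 * s'%:C) : R[i].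
set k' := gamma * k / _ in g hIm kE *.
have gE : cintegral `[0, T] (fun s' => cexp (ii * k ^+ 3 * s'%:C) *
    (w 2%N s' 0 + ii * k' * w 1%N s' 0 - k' ^+ 2 * w 0%N s' 0)) =
    A 2%N + ii * k' * (dir s)%:C * A 1%N - k' ^+ 2 * A 0%N.
  have i2 := trace_transform_integrable k (isT : (2 <= 2)%N).
  have i1 := trace_transform_integrable k (isT : (1 <= 2)%N).
  have i0 := trace_transform_integrable k (isT : (0 <= 2)%N).
  rewrite /A /trace_transform -(cintegralZ _ mT i1) -(cintegralZ _ mT i0).
  rewrite -(cintegralD mT i2 (cintegrableZ _ mT i1)).
  rewrite -(cintegralB mT (cintegrableD mT i2 (cintegrableZ _ mT i1)) (cintegrableZ _ mT i0)).
  apply: cintegral_eq => tau htau; have ht : 0 <= tau <= T by move: htau; rewrite /= in_itv.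
  rewrite !wtr // expr0 expr1 expr2 dd !mul1r.
  by move: (cexp _) (trace _ _ _) (trace _ _ _) (trace _ _ _) => e1 u2 u1 u0; ring.
rewrite gE in g.
have -> : cexp (ii * k ^+ 3 * T%:C) * half_fourier (w 0%N T) k' =
  half_fourier (w 0%N 0) k' - (dir s * sigma)%:C ^+ 3 * (A 2%N + ii * k' * (dir s)%:C * A 1%N - k' ^+ 2 * A 0%N).
  exact: g.
rewrite opprB addrCA subrr addr0.
rewrite (sum_ord3 (fun n => (ii * gamma * k) ^+ (2 - n) * sigma%:C ^+ n.+1 * A n)).
rewrite subn0 subnn expr0 (_ : (2 - 1 = 1)%N) // !expr1 mul1r.
have -> : k' = (dir s)%:C * (gamma * k / sigma%:C) by exact: kE.
rewrite realCM.
exact: relation_algebra dd sn.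
Qed.

End TrueTransforms.

(** The relations selected in each case are those whose argument
    [alpha ^ p * k / kappa] lies in the closed lower half plane. *)
Lemma relation_halfplane {R : realType} c (sigma1 sigma2 : R) r i s p :
  signs c sigma1 sigma2 -> r \in sectors c -> (i < 6 - nconds c)%N ->
  relation_of c r i = (s, p) ->
  exists m, (3 * m <= r.-1 + 2 * p < 3 * m + 3)%N /\
    (-1) ^+ m * (dir s * pick_side s sigma1 sigma2) < 0.
Proof.
have pos (a : R) : 0 < a -> forall m, odd m -> (-1) ^+ m * (1 * a) < 0.
  by move=> a0 m hm; rewrite -signr_odd hm mulN1r mul1r oppr_lt0.
have neg (a : R) : 0 < a -> forall m, odd m = false -> (-1) ^+ m * (-1 * a) < 0.
  by move=> a0 m hm; rewrite -signr_odd hm mul1r mulN1r oppr_lt0.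
(* In every case [m] is the quotient of [r - 1 + 2 p] by 3. *)
case: c => /= /andP[h1 h2]; rewrite !inE.
- have n2 : 0 < - sigma2 by rewrite oppr_gt0.
  move=> /eqP->; case: i => [|[|[|[|i]]]] //= _ [<- <-] /=.
  + by exists 2%N; split => //; exact: neg.
  + by exists 2%N; split => //; exact: neg.
  + by exists 2%N; split => //; rewrite -[sigma2]opprK mulrN -mulNr; exact: neg.
  + by exists 2%N; split => //; rewrite -[sigma2]opprK mulrN -mulNr; exact: neg.
- move=> /or3P[] /eqP->; case: i => [|[|[|i]]] //= _ [<- <-] /=.
  all: try by exists 0%N; split => //; exact: neg.
  all: try by exists 2%N; split => //; exact: neg.
  all: try by exists 4%N; split => //; exact: neg.
  all: try by exists 6%N; split => //; exact: neg.
  all: try by exists 1%N; split => //; exact: pos.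
  all: try by exists 3%N; split => //; exact: pos.
  all: try by exists 5%N; split => //; exact: pos.
- have n1 : 0 < - sigma1 by rewrite oppr_gt0.
  move=> /orP[] /eqP->; case: i => [|[|i]] //= _ [<- <-] /=.
  + by exists 1%N; split => //; rewrite -[sigma1]opprK mulrNN; exact: pos.
  + by exists 1%N; split => //; exact: pos.
  + by exists 3%N; split => //; rewrite -[sigma1]opprK mulrNN; exact: pos.
  + by exists 3%N; split => //; exact: pos.
Qed.

Lemma sum_blocks {U : nmodType} (F : 'I_(3 + 3) -> U) :
  \sum_j F j = \sum_(m < 3) F (lshift 3 m) + \sum_(m < 3) F (rshift 3 m).
Proof. by rewrite big_split_ord. Qed.

Lemma sum_lin3 {U : pzRingType} (J : finType) (A B C : J -> U) a b c :
  a * (\sum_j A j) + b * (\sum_j B j) - c * (\sum_j C j) =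
  \sum_j (a * A j + b * B j - c * C j).
Proof. by rewrite sumrB big_split /= -!mulr_sumr. Qed.

Section Interface.
Context {R : realType}.
Variables (c : sign_case) (sigma1 sigma2 T rho : R).
Variables (beta : 'M[R[i]]_(nconds c, 3 + 3)) (f : 'I_(nconds c) -> R -> R[i]).
Variables (q01 q02 : R -> R[i]) (q1 q2 : R -> R -> R[i]).
Variable X : R[i] -> 'cV[R[i]]_(3 + 3).
Hypothesis hsigma : signs c sigma1 sigma2.
Hypothesis hT : 0 < T.
Hypothesis hq : interface_solution sigma1 sigma2 T beta f q01 q02 q1 q2.
Hypothesis hrho : 0 < rho.
Hypothesis hdet : forall r k, r \in sectors c -> closure (Dsec rho r) k ->
  \det (system_matrix sigma1 sigma2 beta r k) != 0.
Hypothesis hX : forall r k, r \in sectors c -> closure (Dsec rho r) k ->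
  system_matrix sigma1 sigma2 beta r k *m X k =
  system_rhs sigma1 sigma2 T f q01 q02 r k.

Let sig s := pick_side s sigma1 sigma2.
Let q s := pick_side s q1 q2.
Let q0 s := pick_side s q01 q02.

Let hs s : half_solution s (sig s) T (q0 s) (q s).
Proof. by case: s; [exact: is_left hq|exact: is_right hq]. Qed.

Let T0 : 0 <= T. Proof. exact: ltW. Qed.

Lemma sig_neq0 s : sig s != 0.
Proof.
rewrite /sig; move: hsigma; case: (c) => /= /andP[h1 h2]; case: s => /=;
  by rewrite ?(gt_eqF h1) ?(gt_eqF h2) ?(lt_eqF h1) ?(lt_eqF h2).
Qed.

Lemma sectors_of_case s r : r \in sectors_of s (sig s) -> r \in sectors c.
Proof.
move: hsigma; case: (c) => /= /andP[h1 h2]; case: s => /=;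
  rewrite /sectors_of /= ?h1 ?h2 ?(lt_gtF h1) ?(lt_gtF h2) // !inE => h;
  by rewrite ?orbA h ?orbT.
Qed.

Lemma sector_shape r : r \in sectors c -> exists2 n, r = n.+1 & odd n = false.
Proof.
case: (c); rewrite !inE.
- by move=> /eqP->; exists 4%N.
- by move=> /or3P[] /eqP->; [exists 0%N|exists 2%N|exists 4%N].
- by move=> /orP[] /eqP->; [exists 0%N|exists 2%N].
Qed.

Lemma interface_at j t : 0 <= t <= T ->
  interface_form beta j (q1^~ t) (q2^~ t) = f j t.
Proof.
move=> /andP[t0 tT]; have [t_0|t_n0] := eqVneq t 0; last first.
  by apply: (is_interface hq); rewrite tT andbT lt_neqAle eq_sym t_n0.
rewrite t_0 -(is_compatible hq) /interface_form; apply: eq_bigr => n _.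
by rewrite (trace_initial (hs Lft) T0) (trace_initial (hs Rgt) T0).
Qed.

Definition true_transforms k : 'cV[R[i]]_(3 + 3) :=
  col_mx (\col_(n < 3) trace_transform Lft T q1 n k) (\col_(n < 3) trace_transform Rgt T q2 n k).

Let blk s (n : 'I_3) : 'I_(3 + 3) := pick_side s (lshift 3 n) (rshift 3 n).

Lemma true_transformsE s n k : true_transforms k (blk s n) 0 = trace_transform s T (q s) n k.
Proof. by case: s; rewrite /true_transforms ?col_mxEu ?col_mxEd mxE. Qed.

Lemma interface_true k :
  beta *m true_transforms k =
  \col_j cintegral `[0, T] (fun s => cexp (ii * k ^+ 3 * s%:C) * f j s).
Proof.
apply/matrixP => j z; rewrite mxE [RHS]mxE sum_blocks.
have mT : measurableR `[0, T] by exact: measurable_itv.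
pose tr s n := fun tau => cexp (ii * k ^+ 3 * tau%:C) * trace s n (q s ^~ tau).
have itr s (n : 'I_3) : cintegrable `[0, T] (tr s n).
  have n2 : (n <= 2)%N by rewrite -ltnS.
  exact: (trace_transform_integrable (hs s) k n2).
pose F (n : 'I_3) tau := beta j (lshift 3 n) * tr Lft n tau + beta j (rshift 3 n) * tr Rgt n tau.
have iF n : cintegrable `[0, T] (F n).
  by apply: (cintegrableD mT); apply: (cintegrableZ _ mT); exact: itr.
have [_ e] := cintegrable_sum (r := index_enum 'I_3) mT (fun n _ => iF n).
have -> : cintegral `[0, T] (fun s => cexp (ii * k ^+ 3 * s%:C) * f j s) =
    cintegral `[0, T] (fun tau => \sum_(n <- index_enum 'I_3) F n tau).
  apply: cintegral_eq => tau htau; have ht : 0 <= tau <= T by move: htau; rewrite /= in_itv.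
  rewrite -(interface_at j ht) /interface_form mulr_sumr; apply: eq_bigr => n _.
  by rewrite mulrDr /F /tr mulrCA [X in _ + X]mulrCA.
rewrite e; apply: etrans (esym (big_split _ _ _ _ _)) _; apply: eq_bigr => n _.
rewrite (cintegralD mT (cintegrableZ _ mT (itr Lft n)) (cintegrableZ _ mT (itr Rgt n))).
rewrite (cintegralZ _ mT (itr Lft n)) (cintegralZ _ mT (itr Rgt n)).
by congr (_ * _ + _ * _); have := true_transformsE; [move/(_ Lft n k)|move/(_ Rgt n k)];
  rewrite /blk /= => E; rewrite (ord1 z) E.
Qed.

Variable w : side -> nat -> R -> R -> R[i].
Hypothesis H : forall s, half_data (dir s * sig s) T (w s).
Hypothesis w0 : forall s t y, 0 <= t <= T -> 0 < y -> w s 0%N t y = q s (dir s * y) t.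
Hypothesis wtr : forall s n t, 0 <= t <= T ->
  w s n t 0 = (dir s)%:C ^+ n * trace s n (q s ^~ t).

(** These terms are unknown because they involve the solution at the final time. *)
Definition dropped r k (i : 'I_(6 - nconds c)) : R[i] :=
  let: (s, p) := relation_of c r i in
  cexp (ii * k ^+ 3 * T%:C) * half_fourier (w s 0%N T) (alpha ^+ p / (dir s * sig s)%:C * k).

Lemma relation_lower n i s p k : n.+1 \in sectors c -> relation_of c n.+1 i = (s, p) ->
  (i < 6 - nconds c)%N -> sector_set rho n.+1 k ->
  Im (alpha ^+ p / (dir s * sig s)%:C * k) <= 0.
Proof.
move=> hn e hi [z [th [hz hth ->]]].
have [m [m1 m2]] := relation_halfplane hsigma hn hi e.
rewrite mulrAC; exact: (Im_rotated (le_trans (ltW hrho) hz) hth m1 m2).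
Qed.

Lemma relation_row_true n k : n.+1 \in sectors c -> sector_set rho n.+1 k ->
  (\matrix_(i < 6 - nconds c)
       let: (s, p) := relation_of c n.+1 i in
       relation_row s (pick_side s sigma1 sigma2) (alpha ^+ p) k) *m true_transforms k =
  (\col_(i < 6 - nconds c)
         let: (s, p) := relation_of c n.+1 i in
         - fourier s (pick_side s q01 q02)
             (alpha ^+ p * k / (pick_side s sigma1 sigma2)%:C)) +
  \col_i dropped n.+1 k i.
Proof.
move=> hn hk; apply/matrixP => i z; rewrite (ord1 z) mxE [RHS]mxE [X in _ = X + _]mxE [X in _ = _ + X]mxE.
rewrite /dropped; case e : (relation_of c n.+1 i) => [s p].
have hIm := relation_lower hn e (ltn_ord i) hk.
have comm : alpha ^+ p / (dir s * sig s)%:C * k = alpha ^+ p * k / (dir s * sig s)%:C by exact: mulrAC.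
rewrite comm in hIm *.
have rel := relation_true (hs s) (sig_neq0 s) T0 (H s) (@w0 s) (@wtr s) (alphaX3 p) hIm.
have lhs : \sum_j (\matrix_(i < 6 - nconds c)
       let: (s, p) := relation_of c n.+1 i in
       relation_row s (pick_side s sigma1 sigma2) (alpha ^+ p) k) i j * true_transforms k j 0 =
   - (dir s)%:C * \sum_(m < 3) (ii * alpha ^+ p * k) ^+ (2 - m) * (sig s)%:C ^+ m.+1 *
       trace_transform s T (q s) m k.
  rewrite sum_blocks mulr_sumr.
  case: (s) e => e.
    rewrite [X in _ + X]big1 => [|m _]; last by rewrite mxE e row_mxEr mxE mul0r.
    rewrite addr0; apply: eq_bigr => m _.
    rewrite mxE e row_mxEl mxE -(true_transformsE Lft m k) /dir /=.
    by rewrite realCN realC1 opprK mul1r.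
  rewrite big1 ?add0r => [|m _]; last by rewrite mxE e row_mxEl mxE mul0r.
  apply: eq_bigr => m _.
  rewrite mxE e row_mxEr [X in X * _]mxE [X in - X * _]mxE -(true_transformsE Rgt m k) /dir /=.
  by rewrite realC1 mulN1r mulNr.
apply: etrans lhs _; rewrite rel mulrA mulNr -realCM dirK realC1 mulN1r opprB addrC.
by [].
Qed.

Let E0 s (x t : R) k : R[i] := cexp (ii * (k / (sig s)%:C) * x%:C - ii * k ^+ 3 * t%:C).

(** The true transforms solve the system with the terms [dropped] added, so the
    difference solves it with these terms alone on the right-hand side.  By
    Cramer's rule it is a sum of the [error_term]s, each of which decays in the
    sector. *)
Lemma side_error s n (x t : R) : n.+1 \in sectors_of s (sig s) -> halfline s x -> t <= T ->
  is_curve_integral (sector_boundary rho n.+1) (fun k =>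
    E0 s x t k *
    ((sig s)%:C ^+ 2 * (X k (blk s (inord 2)) 0 - trace_transform s T (q s) 2 k) +
     ii * k * (sig s)%:C * (X k (blk s (inord 1)) 0 - trace_transform s T (q s) 1 k) -
     k ^+ 2 * (X k (blk s (inord 0)) 0 - trace_transform s T (q s) 0 k))) 0.
Proof.
move=> hr hx tT; have hn := sectors_of_case hr.
have r0 : 0 <= rho := ltW hrho.
have n_even : odd n = false by have [m [->]] := sector_shape hn.
have inD k : sector_set rho n.+1 k -> closure (Dsec rho n.+1) k by exact: sector_set_closure.
have [P hP] := system_matrix_poly sigma1 sigma2 beta n.+1.
have detE k : (\det P).[k] = \det (system_matrix sigma1 sigma2 beta n.+1 k).
  by rewrite hP det_map_mx.
have d0 k : closure (Dsec rho n.+1) k -> (\det P).[k] != 0.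
  by move=> hk; rewrite detE; exact: hdet.
have [c1 c10 hc1] := poly_lower_bound d0.
have dc k : sector_set rho n.+1 k -> c1 <= normc (\det P).[k] by move=> /inD; exact: hc1.
pose W k : 'cV[R[i]]_(3 + 3) :=
  castmx (nconds_relations c, erefl) (col_mx 0 (\col_i - dropped n.+1 k i)).
have sysN k : sector_set rho n.+1 k ->
    map_mx (horner_eval k) P *m (X k - true_transforms k) = W k.
  move=> hk; rewrite -hP mulmxBr hX //; last exact: inD.
  apply: (addIr (system_matrix sigma1 sigma2 beta n.+1 k *m true_transforms k)).
  rewrite subrK /system_matrix castmx_mulmx mul_col_mx interface_true relation_row_true //.
  rewrite /W /system_rhs -castmx_add add_col_mx add0r; congr (castmx _ (col_mx _ _)).
  apply/matrixP => i z; rewrite [in RHS]mxE [X in _ = X + _]mxE [X in _ = _ + X]mxE.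
  by rewrite [X in _ = _ + (_ + X)]mxE addrCA addNr addr0.
pose N k i : R[i] := (X k - true_transforms k) i 0.
have NE k m : X k (blk s m) 0 - trace_transform s T (q s) m k = N k (blk s m).
  by rewrite /N [RHS]mxE [X in _ = _ + X]mxE -true_transformsE.
have inordE (m : nat) : (m < 3)%N -> (inord m : 'I_3) = m :> nat by exact: inordK.
have NE' (m : nat) k : (m < 3)%N -> X k (blk s (inord m)) 0 - trace_transform s T (q s) m k = N k (blk s (inord m)).
  by move=> m3; rewrite -NE inordE.
pose Q j : {poly R[i]} := ((sig s)%:C ^+ 2)%:P * \adj P (blk s (inord 2)) j +
  (ii * (sig s)%:C) *: 'X * \adj P (blk s (inord 1)) j - 'X^2 * \adj P (blk s (inord 0)) j.
pose err j k := E0 s x t k * ((Q j).[k] * (\det P).[k]^-1 * W k j 0).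
have errE k : sector_set rho n.+1 k -> \sum_j err j k =
    E0 s x t k *
    ((sig s)%:C ^+ 2 * (X k (blk s (inord 2)) 0 - trace_transform s T (q s) 2 k) +
     ii * k * (sig s)%:C * (X k (blk s (inord 1)) 0 - trace_transform s T (q s) 1 k) -
     k ^+ 2 * (X k (blk s (inord 0)) 0 - trace_transform s T (q s) 0 k)).
  move=> hk; rewrite !NE' // /N !(solve_poly (d0 k (inD k hk)) (sysN k hk)).
  rewrite -mulr_sumr; congr (_ * _); rewrite sum_lin3.
  apply: eq_bigr => j _; rewrite /Q hornerD hornerN hornerD !hornerM hornerC hornerZ hornerX.
  move: (\adj P _ _).[k] (\adj P _ _).[k] (\adj P _ _).[k] (_^-1) (W k j 0) => A2 A1 A0 D w'.
  by ring.
apply: (ici_eq_sector errE).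
have mG : measurable_curves (sector_boundary rho n.+1).
  by case=> [|[|[|i]]] //= _; exact: measurable_itv.
apply: (@ici_sum R _ _ (index_enum _) err mG (ici_zero mG)) => j.
pose j' := cast_ord (esym (nconds_relations c)) j.
have [j0 ej|j0 ej] := split_ordP j'.
  apply: (ici_eq_sector (F := fun=> 0)) => [k _|]; last exact: ici_zero.
  by rewrite /err /W castmxE -/j' ej col_mxEu mxE !mulr0.
case e : (relation_of c n.+1 j0) => [s' p].
have y0 : 0 < dir s * x by apply/(dir_halfline s); rewrite mulrA dirK mul1r.
have k0 : dir s * sig s != 0.
  by rewrite mulf_neq0 ?sig_neq0 // -normr_gt0 normr_dir.
have ab : above (dir s * sig s) n.+1.
  have key (b : bool) (a : R) : 0 < a = ~~ b -> n.+1 \in (if b then [:: 5] else [:: 1; 3])%N -> above a n.+1.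
    rewrite /above => ->; case: b => /=; rewrite !inE.
      by move=> /eqP->.
    by move=> /orP[] /eqP->.
  apply: (key _ _ _ hr); rewrite /dir; move: (sig_neq0 s); case: (s) => /= sn.
    by rewrite mulN1r oppr_gt0 -leNgt lt_neqAle sn.
  by rewrite mul1r -leNgt le_eqVlt eq_sym (negbTE sn).
have yk : dir s * x / (dir s * sig s) = x / sig s.
  by rewrite -mulf_div divff ?mul1r // -normr_gt0 normr_dir.
have lower k : sector_set rho n.+1 k -> Im (alpha ^+ p / (dir s' * sig s')%:C * k) <= 0.
  by move=> hk; exact: (relation_lower hn e (ltn_ord j0) hk).
have h := error_term_ici0 r0 n_even (H s') T0 (- Q j) c10 dc lower tT y0 k0 ab yk.
apply: (ici_eq_sector _ h) => k hk.
rewrite /err /W castmxE -/j' ej col_mxEd cast_ord_id mxE /dropped e /error_term /E0.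
by congr (_ * _); rewrite hornerN !mulNr mulrN.
Qed.

End Interface.

Theorem proposition4 (R : realType) (c : sign_case) (sigma1 sigma2 T rho : R)
    (beta : 'M[R[i]]_(nconds c, 3 + 3)) (f : 'I_(nconds c) -> R -> R[i])
    (q01 q02 : R -> R[i]) (q1 q2 : R -> R -> R[i])
    (X : R[i] -> 'cV[R[i]]_(3 + 3))
  (hsigma : signs c sigma1 sigma2)
  (hbeta : normal_form beta)
  (hirreducible : ~~ half_line_reducible sigma1 sigma2 beta)
  (hT : 0 < T)
  (hq : interface_solution sigma1 sigma2 T beta f q01 q02 q1 q2)
  (hfull : forall r, r \in sectors c ->
     exists k, \det (system_matrix sigma1 sigma2 beta r k) != 0)
  (hrho : 0 < rho)
  (hdet : forall r k, r \in sectors c -> closure (Dsec rho r) k ->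
     \det (system_matrix sigma1 sigma2 beta r k) != 0)
  (hX : forall r k, r \in sectors c -> closure (Dsec rho r) k ->
     system_matrix sigma1 sigma2 beta r k *m X k =
     system_rhs sigma1 sigma2 T f q01 q02 r k) :
  (forall x t, x < 0 -> 0 < t < T -> exists I0 I1 : R[i],
    [/\ is_curve_integral real_line (fun k =>
          cexp (ii * k * x%:C - ii * sigma1%:C ^+ 3 * k ^+ 3 * t%:C) *
          fourier Lft q01 k) I0,
        is_curve_integral (Gamma Lft sigma1 rho) (fun k =>
          cexp (ii * (k / sigma1%:C) * x%:C - ii * k ^+ 3 * t%:C) *
          (sigma1%:C ^+ 2 * gpart (X k) 2 + ii * k * sigma1%:C * gpart (X k) 1
           - k ^+ 2 * gpart (X k) 0)) I1 &
        q1 x t = (2 * pi)^-1%:C * I0 + (2 * pi)^-1%:C * I1]) /\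
  (forall x t, 0 < x -> 0 < t < T -> exists I0 I1 : R[i],
    [/\ is_curve_integral real_line (fun k =>
          cexp (ii * k * x%:C - ii * sigma2%:C ^+ 3 * k ^+ 3 * t%:C) *
          fourier Rgt q02 k) I0,
        is_curve_integral (Gamma Rgt sigma2 rho) (fun k =>
          cexp (ii * (k / sigma2%:C) * x%:C - ii * k ^+ 3 * t%:C) *
          (sigma2%:C ^+ 2 * hpart (X k) 2 + ii * k * sigma2%:C * hpart (X k) 1
           - k ^+ 2 * hpart (X k) 0)) I1 &
        q2 x t = (2 * pi)^-1%:C * I0 - (2 * pi)^-1%:C * I1]).
Proof.
have T0 : 0 <= T by exact: ltW.
have r0 : 0 <= rho by exact: ltW.
pose sig s := pick_side s sigma1 sigma2.
pose q s := pick_side s q1 q2.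
have hs s : half_solution s (sig s) T (pick_side s q01 q02) (q s).
  by case: s; [exact: is_left hq|exact: is_right hq].
have [w hw] := choice (fun s => half_data_of_solution (hs s)).
have H s : half_data (dir s * sig s) T (w s) by case: (hw s).
have w0 s : forall t y, 0 <= t <= T -> 0 < y -> w s 0%N t y = q s (dir s * y) t.
  by case: (hw s).
have wtr s : forall n t, 0 <= t <= T -> w s n t 0 = (dir s)%:C ^+ n * trace s n (q s ^~ t).
  by case: (hw s).
pose Z s n k := X k (pick_side s (lshift 3 (inord n)) (rshift 3 (inord n))) 0.
have err s (x t : R) : halfline s x -> 0 < t < T ->
  is_curve_integral (flatten [seq sector_boundary rho r | r <- sectors_of s (sig s)])
    (fun k => cexp (ii * (k / (sig s)%:C) * x%:C - ii * k ^+ 3 * t%:C) *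
      ((sig s)%:C ^+ 2 * (Z s 2%N k - trace_transform s T (q s) 2 k) +
       ii * k * (sig s)%:C * (Z s 1%N k - trace_transform s T (q s) 1 k)
       - k ^+ 2 * (Z s 0%N k - trace_transform s T (q s) 0 k))) 0.
  move=> hx /andP[_ /ltW tT]; apply: ici_sectors => r hr.
  have [n rn _] := sector_shape (sectors_of_case hsigma hr); rewrite rn in hr *.
  exact: (side_error hsigma hT hq hrho hdet hX H w0 wtr hr hx tT).
have formula s x t (hx : halfline s x) (ht : 0 < t < T) :=
  half_formula (hs s) (sig_neq0 hsigma s) r0 hx ht (err s x t hx ht).
split=> x t hx ht.
  have [|I0 [I1 [h0 h1 e]]] := formula Lft x t _ ht; first by rewrite /= in_itv.
  exists I0, I1; split; [exact: h0|exact: h1|].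
  by move: e; rewrite /dir /= realCN realC1 mulN1r opprK.
have [|I0 [I1 [h0 h1 e]]] := formula Rgt x t _ ht; first by rewrite /= in_itv /= andbT.
exists I0, I1; split; [exact: h0|exact: h1|].
by move: e; rewrite /dir /= realC1 mul1r.
Qed.
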